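(* Let $T>0$. The family of HL$(0)$ driving measures $\{\mu_\varepsilon:\varepsilon>0\}$ satisfies, as $\varepsilon\to0$, a large deviation principle in $\mathcal N_T$, equipped with the weak topology, with rate $4/\varepsilon^2$ and convex, good rate function $\mathcal H:\mathcal N_T\to[0,+\infty]$ given by $$\mathcal H(\rho)=\frac1{2\pi}\iint_{S^1\times[0,T]}\bar\rho_t(\theta)\log\bar\rho_t(\theta)\,d\theta\,dt$$ whenever $\rho=\bar\rho_t(\theta)\,d\theta\,dt/2\pi$ and the integral exists, and $\mathcal H(\rho)=+\infty$ otherwise. That is, $\mathcal H$ is convex, lower semicontinuous, has compact level sets $\{\mathcal H\le a\}$, and for every closed $C\subset\mathcal N_T$ and every open $O\subset\mathcal N_T$, $$\limsup_{\varepsilon\to0}\frac{\varepsilon^2}{4}\log\mathbb P(\mu_\varepsilon\in C)\le-\inf_C\mathcal H,\qquad \liminf_{\varepsilon\to0}\frac{\varepsilon^2}{4}\log\mathbb P(\mu_\varepsilon\in O)\ge-\inf_O\mathcal H.$$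
   Context: $S^1=[0,2\pi)$ is identified with the unit circle. $\mathcal N_T$ is the set of Borel measures $\mu$ on $S^1\times[0,T]$ such that $\mu(S^1\times I)=|I|$ (Lebesgue measure) for every interval $I\subset[0,T]$. For $\varepsilon>0$ let $c(\varepsilon)>0$ be defined by $e^{c(\varepsilon)}=1+\frac{\varepsilon^2}{4(1+\varepsilon)}$ (the logarithmic capacity increment of a slit of length $\varepsilon$). Let $\theta_1,\theta_2,\dots$ be i.i.d. uniform random variables on $S^1$. With $T_k=k\,c(\varepsilon)$, the HL$(0)$ driving measure is the random element of $\mathcal N_T$ given by $$\mu_\varepsilon(d\theta,dt)=\mu_{\varepsilon,t}(d\theta)\,dt,\qquad \mu_{\varepsilon,t}=\sum_{k\ge1}\delta_{\theta_k}\mathbf 1_{[T_{k-1},T_k)}(t),\quad t\in[0,T].$$ *)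

(* Defs.v *)
From HB Require Import structures.
From mathcomp Require Import all_boot all_order all_algebra.
From mathcomp Require Import all_classical all_reals all_analysis.
From mathcomp Require Import measurable_realfun.

Set Implicit Arguments.
Unset Strict Implicit.
Unset Printing Implicit Defensive.

Import Order.TTheory GRing.Theory Num.Theory.
Import numFieldNormedType.Exports.

Local Open Scope classical_set_scope.
Local Open Scope ring_scope.

(* The plane of pairs (theta, t) with its Borel sigma-algebra. *)
Notation plane R := (measurableTypeR R * measurableTypeR R)%type.

Definition angles {R : realType} : set R := `[0, 2 * pi[%classic.

Definition cylinder {R : realType} (T : R) : set (plane R) :=
  angles `*` `[0, T]%classic.

(* N_T. A Borel measure on S^1 x [0,T] is a measure on the plane that does not
   charge the complement of [0, 2 pi) x [0, T]. As everywhere in the library,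
   values on non-measurable sets are irrelevant: two elements agreeing on
   measurable sets are topologically indistinguishable. *)
Record driving_measure {R : realType} (T : R) := DrivingMeasure {
  driving_val :> {measure set (plane R) -> \bar R} ;
  driving_support : driving_val (~` cylinder T) = 0%E ;
  driving_marginal : forall I : interval R, [set` I] `<=` `[0, T]%classic ->
    driving_val (angles `*` [set` I]) = lebesgue_measure [set` I] }.

HB.instance Definition _ (R : realType) (T : R) :=
  gen_eqMixin (driving_measure T).
HB.instance Definition _ (R : realType) (T : R) :=
  gen_choiceMixin (driving_measure T).

Definition unit_circle {R : realType} : set (R * R) :=
  [set z | z.1 ^+ 2 + z.2 ^+ 2 = 1].

(* C(S^1 x [0,T]), with S^1 the unit circle of the plane; since S^1 x [0,T] is
   compact these are all the bounded continuous functions. *)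
Definition test_function {R : realType} (T : R) : Type :=
  {g : R * R * R -> R |
    {within unit_circle `*` `[0, T]%classic, continuous g}}.

HB.instance Definition _ (R : realType) (T : R) :=
  gen_eqMixin (test_function T).
HB.instance Definition _ (R : realType) (T : R) :=
  gen_choiceMixin (test_function T).

(* Integral of a test function, through the identification of the angle theta
   in [0, 2 pi) with the point (cos theta, sin theta) of the circle. *)
Definition weak_eval {R : realType} (T : R) (mu : driving_measure T) :
    prod_topology (fun _ : test_function T => (R : topologicalType)) :=
  fun g => (\int[mu]_(x in cylinder T) sval g (cos x.1, sin x.1, x.2))%R.

(* Weak topology: the coarsest one making all the maps mu |-> mu(g)
   continuous. *)
HB.instance Definition _ (R : realType) (T : R) :=
  Topological.copy (driving_measure T) (initial_topology (@weak_eval R T)).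

(* [T_k, T_(k+1)), slits being numbered from 0. *)
Definition slit_interval {R : realType} (c : R) (k : nat) : set R :=
  `[k%:R * c, k.+1%:R * c[%classic.

Section slit_measure.
Local Open Scope ereal_scope.
Context {R : realType}.
Implicit Types (T c t : R) (th : nat -> R).

(* mu_{eps,t}, for slits of capacity c attached at the angles th. *)
Definition slit_fiber c th t (B : set (measurableTypeR R)) : \bar R :=
  \sum_(k <oo) (\1_(slit_interval c k) t)%:E * \d_(th k) B.

Definition slit_fun T c th (A : set (plane R)) : \bar R :=
  \int[lebesgue_measure]_(t in `[0%R, T]%classic)
    slit_fiber c th t (ysection A t).

Lemma slit_fiber_ge0 c th t B : 0 <= slit_fiber c th t B.
Proof.
by apply: nneseries_ge0 => k _ _; rewrite mule_ge0// lee_fin.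
Qed.

Let indic_ge0 (A : set R) t : (0 <= \1_A t :> R)%R.
Proof. by rewrite indicE. Qed.

Lemma slit_fiber_mseries c th t B : slit_fiber c th t B =
  mseries (fun k => mscale (NngNum (indic_ge0 (slit_interval c k) t))
    \d_(th k : measurableTypeR R)) 0 B.
Proof. by []. Qed.

Lemma slit_fiberE c th t B : (0 < c)%R -> (0 <= t)%R ->
  (forall k, B (th k)) -> slit_fiber c th t B = 1.
Proof.
move=> c0 t0 Bth; rewrite /slit_fiber.
pose n := Num.truncn (t / c).
have tc0 : (0 <= t / c)%R by rewrite divr_ge0// ltW.
have /andP[n1 n2] := truncn_itv tc0.
have inE' k : (t \in slit_interval c k) = (k == n).
  apply/idP/eqP.
    rewrite inE /slit_interval/= in_itv/= -ler_pdivlMr// -ltr_pdivrMr// => /andP[k1 k2].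
    by apply/esym/eqP; rewrite /n truncn_eq// k1.
  by move=> ->; rewrite inE /slit_interval/= in_itv/= -ler_pdivlMr// -ltr_pdivrMr// n1.
rewrite (nneseries_split _ n.+1); last first.
  by move=> k _; rewrite mule_ge0// lee_fin.
rewrite add0n eseries0 ?adde0; last first.
  by move=> k nk _; rewrite indicE inE' gtn_eqF ?mul0e.
rewrite big_nat_recr//= big1_seq ?add0e; last first.
  move=> k; rewrite mem_index_iota => /andP[_ kn].
  by rewrite indicE inE' ltn_eqF ?mul0e.
by rewrite indicE inE' eqxx mul1e diracE mem_set.
Qed.

Lemma measurable_slit_fiber c th (A : set (plane R)) : measurable A ->
  measurable_fun setT (fun t : measurableTypeR R =>
    slit_fiber c th t (ysection A t)).
Proof.
move=> mA; apply: ge0_emeasurable_sum => [k t _ _|k _].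
  by rewrite mule_ge0// lee_fin.
apply: emeasurable_funM.
  by apply/measurable_EFinP; apply: measurable_indic; exact: measurable_itv.
exact: (lebesgue_integral_fubini.measurable_fun_ysection \d_(th k) mA).
Qed.

Section measure.
Variables (T c : R) (th : nat -> R).

Let slit0 : slit_fun T c th set0 = 0.
Proof.
rewrite /slit_fun integral0_eq// => t _.
by rewrite ysection0 slit_fiber_mseries measure0.
Qed.

Let slit_ge0 A : 0 <= slit_fun T c th A.
Proof. by apply: integral_ge0 => t _; exact: slit_fiber_ge0. Qed.

Let slit_sigma_additive : semi_sigma_additive (slit_fun T c th).
Proof.
move=> F mF tF mUF.
rewrite [X in _ --> X](_ : _ = \sum_(n <oo) slit_fun T c th (F n)).
  by apply/cvg_closeP; split; [exact: is_cvg_nneseries|rewrite closeE].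
rewrite -integral_nneseries//; last 2 first.
  by move=> n; apply: measurable_funTS; exact: measurable_slit_fiber.
  by move=> n t _; exact: slit_fiber_ge0.
apply: eq_integral => t _; rewrite ysection_bigcup slit_fiber_mseries.
apply/esym/cvg_lim => //.
pose m : {measure set (measurableTypeR R) -> \bar R} :=
  mseries (fun k => mscale (NngNum (indic_ge0 (slit_interval c k) t))
    \d_(th k : measurableTypeR R)) 0.
apply: (@measure_sigma_additive _ _ _ m (fun n => ysection (F n) t)).
- by move=> n; exact: measurable_ysection.
- exact: trivIset_ysection.
Qed.

HB.instance Definition _ := isMeasure.Build _ _ _ (slit_fun T c th)
  slit0 slit_ge0 slit_sigma_additive.

End measure.

Lemma slit_support T c th : (forall k, th k \in `[0, 2 * pi[%R) ->
  slit_fun T c th (~` cylinder T) = 0.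
Proof.
move=> thS; apply: integral0_eq => t tT.
apply: eseries0 => k _ _; rewrite diracE memNset ?mule0// /ysection/= inE.
by apply; split => //=; exact: thS.
Qed.

Lemma slit_marginal T c th : (0 < c)%R ->
  (forall k, th k \in `[0, 2 * pi[%R) ->
  forall I : interval R, [set` I] `<=` `[0%R, T]%classic ->
  slit_fun T c th (angles `*` [set` I]) = lebesgue_measure [set` I].
Proof.
move=> c0 thS I IT; rewrite /slit_fun.
transitivity (\int[lebesgue_measure]_(t in `[0%R, T]%classic)
    (\1_[set` I] t)%:E); last first.
  by rewrite integral_indic//= setIidl.
apply: eq_integral => t; rewrite inE/= in_itv/= => /andP[t0 tT].
rewrite indicE; case: (boolP (t \in [set` I])) => tI.
  rewrite in_ysectionX//; apply: slit_fiberE => // k; exact: thS.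
by rewrite notin_ysectionX// slit_fiber_mseries measure0.
Qed.

Definition slit_measure T c th (c0 : (0 < c)%R)
    (thS : forall k, th k \in `[0, 2 * pi[%R) : driving_measure T :=
  DrivingMeasure (slit_support T c thS) (slit_marginal c0 thS).

End slit_measure.

(* c(eps), i.e. exp (c(eps)) = 1 + eps^2 / (4 (1 + eps)); the value for
   eps <= 0 is a placeholder, irrelevant for limits as eps -> 0+. *)
Definition capacity {R : realType} (eps : R) : R :=
  if 0 < eps then ln (1 + eps ^+ 2 / (4 * (1 + eps))) else 1.

Lemma capacity_gt0 {R : realType} (eps : R) : 0 < capacity eps.
Proof.
rewrite /capacity; case: ifPn => // e0.
by rewrite ln_gt0// ltrDl divr_gt0 ?exprn_gt0// mulr_gt0// addr_gt0.
Qed.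

Lemma expR_capacity {R : realType} (eps : R) : 0 < eps ->
  expR (capacity eps) = 1 + eps ^+ 2 / (4 * (1 + eps)).
Proof.
move=> e0; rewrite /capacity e0 lnK// posrE ltr_wpDr//.
by rewrite divr_ge0 ?exprn_ge0 ?mulr_ge0 ?addr_ge0// ltW.
Qed.

(* The HL(0) driving measure for one realisation th of the angles. *)
Definition HL0_measure {R : realType} (T : R) (th : nat -> R)
    (thS : forall k, th k \in `[0, 2 * pi[) (eps : R) : driving_measure T :=
  slit_measure T (capacity_gt0 eps) thS.

(* rho = f(theta, t) dtheta dt / (2 pi) *)
Definition is_density {R : realType} (T : R) (rho : driving_measure T)
    (f : plane R -> R) : Prop :=
  [/\ measurable_fun (cylinder T) f,
      (forall x, cylinder T x -> (0 <= f x)%R) &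
      forall A, measurable A -> rho A = ((2 * pi)^-1)%R%:E *
        \int[lebesgue_measure \x lebesgue_measure]_(x in A `&` cylinder T)
          (f x)%:E]%E.

Definition entropy_integrable {R : realType} (T : R) (f : plane R -> R) :
    Prop :=
  (lebesgue_measure \x lebesgue_measure)%E.-integrable (cylinder T)
    (fun x => (f x * ln (f x))%R%:E).

Definition entropy_integral {R : realType} (T : R) (f : plane R -> R) :
    \bar R :=
  (((2 * pi)^-1)%R%:E *
    \int[lebesgue_measure \x lebesgue_measure]_(x in cylinder T)
      (f x * ln (f x))%R%:E)%E.

(* The rate function; the value does not depend on the density chosen by cid,
   as two densities of rho agree almost everywhere on the cylinder. *)
Definition driving_entropy {R : realType} (T : R) (rho : driving_measure T) :
    \bar R :=
  match pselect (exists f, is_density rho f /\ entropy_integrable T f) with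
  | left ex => entropy_integral T (sval (cid ex))
  | right _ => +oo%E
  end.

Definition convex_rate {R : realType} (T : R)
    (H : driving_measure T -> \bar R) : Prop :=
  forall (l : R) (r1 r2 r : driving_measure T), 0 <= l <= 1 ->
    (forall A, measurable A ->
      r A = l%:E * r1 A + (1 - l)%:E * r2 A)%E ->
    (H r <= l%:E * H r1 + (1 - l)%:E * H r2)%E.

Definition good_rate {R : realType} (X : topologicalType) (H : X -> \bar R) :
    Prop :=
  [/\ forall x, (0 <= H x)%E, lower_semicontinuous H &
      forall a : R, compact [set x | (H x <= a%:E)%E]].

(* Note that lne 0 = -oo and that the infimum over the empty set is +oo. *)
Definition large_deviation_principle {R : realType} (d : measure_display)
    (Omega : measurableType d) (P : probability Omega R) (X : topologicalType)
    (Y : R -> Omega -> X) (rate : R -> R) (H : X -> \bar R) : Prop :=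
  (forall C : set X, closed C ->
    limf_esup (fun eps : R =>
      ((rate eps)^-1)%:E * lne (P [set w | C (Y eps w)]))%E 0^'+
    <= - ereal_inf (H @` C))%E /\
  (forall O : set X, open O ->
    - ereal_inf (H @` O) <=
    limf_einf (fun eps : R =>
      ((rate eps)^-1)%:E * lne (P [set w | O (Y eps w)]))%E 0^'+)%E.

Lemma twopi_gt0 {R : realType} : 0 < 2 * pi :> R.
Proof. by rewrite mulr_gt0// pi_gt0. Qed.

Definition uniform_angle {R : realType} (d : measure_display)
    (Omega : measurableType d) (P : probability Omega R) (X : {RV P >-> R}) :
    Prop :=
  forall B : set R, measurable B ->
    distribution P X B = uniform_prob (@twopi_gt0 R) B.

Definition mutually_independent {R : realType} (d : measure_display)
    (Omega : measurableType d) (P : probability Omega R)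
    (X : nat -> {RV P >-> R}) : Prop :=
  forall (J : seq nat) (B : nat -> set R), uniq J ->
    (forall k, measurable (B k)) ->
    (P (\bigcap_(k in [set` J]) (X k @^-1` B k)) =
     \prod_(k <- J) P (X k @^-1` B k))%E.

(* Main.v *)
(* Cut S^1 x [0, T] into 2^n x 2^n dyadic cells. The cell masses of all levels
   determine a driving measure and its weak neighbourhoods, and the relative
   entropy of the cell masses with respect to those of d theta dt / 2 pi
   increases with n. If it stays bounded, then the densities along the grids,
   which form a martingale, are Cauchy in L^1, and their limit is a density whose
   entropy obeys the same bound. Together with the compactness of the cell masses
   this gives compact level sets, and shows that the infimum of the entropy over a
   closed set is approached by the entropies at a finite level.

   At level n the slit measure is described, up to an error of order c(eps), by
   the word recording the angular cell of each slit, and all the words are equally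
   likely. There are only polynomially many empirical types, and the number of
   words of a type is at most the exponential of its Shannon entropy: this is the
   upper bound. For the lower bound, draw the letters with the frequencies of
   rho; with probability at least 1/2 the word then gives a slit measure close to
   rho, and on such words the density of this law with respect to the uniform one
   is at most exp ((H(rho) + o(1)) / c(eps)). Finally c(eps) ~ eps^2 / 4. *)

Require Import Defs.
From HB Require Import structures.
From mathcomp Require Import all_boot all_order all_algebra.
From mathcomp Require Import all_classical all_reals all_analysis.
From mathcomp Require Import measurable_realfun.
From mathcomp Require Import ring lra zify.
Set Implicit Arguments.
Unset Strict Implicit.
Unset Printing Implicit Defensive.
Import Order.TTheory GRing.Theory Num.Theory.
Import numFieldNormedType.Exports.
Local Open Scope classical_set_scope.
Local Open Scope ring_scope.

(** * Densities from bounded relative entropy *)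

(** Convergence of all cell masses implies weak convergence, but not conversely: mass may approach
    the side of a cell from the wrong side. This one-sidedness shapes the proof. An open set is
    entered through balls defined by cell masses, which need not be weakly open. For a closed set,
    nothing is discretised: along an ultrafilter the cell masses, being bounded, converge anyway,
    and it is the bound on the grid entropies that turns the limiting masses into a measure, to
    which the ultrafilter then converges weakly. Comparing this limit with a given weak limit
    requires uniqueness of weak limits on measurable sets, which is obtained from explicit functions
    of cosine, sine and time. The Cauchy property in L^1 rests on one scalar inequality: the Bregman
    divergence of x ln x dominates the squared Hellinger distance. The same inequality
    [ln t <= t - 1], at other points, yields the tangents, Jensen's inequality and the modulus of
    continuity of x ln x. That modulus lets entropies of words and of cell masses be compared even
    where some counts vanish. *)

Section xlnx.
Context {R : realType}.
Implicit Types x y s : R.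

Definition xlnx x : R := x * ln x.

(** The left side is the tangent of x ln x at [y], of slope [ln y + 1]. It comes from
    [ln t <= t - 1] at [t = y / x], multiplied by [x]. *)
Lemma xlnx_tangent x y : 0 <= x -> 0 < y -> x * ln y + x - y <= xlnx x.
Proof.
rewrite le_eqVlt => /orP[/eqP <-|x0] y0.
  by rewrite /xlnx !mul0r add0r sub0r oppr_le0 ltW.
have yx : 0 < y / x by rewrite divr_gt0.
have : ln (1 + (y / x - 1)) <= y / x - 1 by apply: le_ln1Dx; rewrite ltrBDl addrN.
rewrite addrCA subrr addr0 ln_div ?posrE// /xlnx => h.
have := ler_wpM2l (ltW x0) h.
rewrite !mulrBr mulr1 mulrCA divff ?gt_eqF// mulr1; lra.
Qed.

Lemma xlnx_ge x : 0 <= x -> x - 1 <= xlnx x.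
Proof. by move=> /xlnx_tangent /(_ ltr01); rewrite ln1 mulr0 add0r. Qed.

Lemma le_ln_sub1 x : 0 < x -> ln x <= x - 1.
Proof.
by move=> x0; have := @le_ln1Dx _ (x - 1); rewrite ltrBDl addrN addrCA subrr addr0; apply.
Qed.

(** Apply [ln t <= t - 1] at [t = sqrt (y / x)] and multiply by [2 * x]. The condition on zeros is
    absolute continuity: as [ln 0 = 0] here, the right side would otherwise be finite at
    [y = 0 < x], where the divergence should be infinite. *)
Lemma hellinger_bregman x y : 0 <= x -> 0 <= y -> (y = 0 -> x = 0) ->
  (Num.sqrt x - Num.sqrt y) ^+ 2 <= x * (ln x - ln y) - x + y.
Proof.
move=> x0 y0 yx.
have [x_0|xn0] := eqVneq x 0.
  by rewrite x_0 sqrtr0 sub0r sqrrN sqr_sqrtr// mul0r subr0 add0r.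
have xp : 0 < x by rewrite lt_neqAle eq_sym xn0.
have yp : 0 < y by rewrite lt_neqAle eq_sym y0 andbT; apply: contra_neq xn0 => /yx.
have sx : 0 < Num.sqrt x by rewrite sqrtr_gt0.
have sy : 0 < Num.sqrt y by rewrite sqrtr_gt0.
have h : ln (Num.sqrt y / Num.sqrt x) <= Num.sqrt y / Num.sqrt x - 1.
  by apply: le_ln_sub1; rewrite divr_gt0.
rewrite ln_div ?posrE// in h.
have lnsq (z : R) : 0 < z -> ln z = 2 * ln (Num.sqrt z).
  by move=> z0; rewrite -{1}(sqr_sqrtr (ltW z0)) lnXn ?sqrtr_gt0// mulr_natl.
have := ler_wpM2l (ltW xp) h.
rewrite (lnsq x)// (lnsq y)//.
have -> : x * (Num.sqrt y / Num.sqrt x - 1) = Num.sqrt x * Num.sqrt y - x.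
  rewrite -[in X in X * _](sqr_sqrtr x0) -[X in _ = _ - X](sqr_sqrtr x0).
  by field; rewrite gt_eqF.
rewrite sqrrB (sqr_sqrtr x0) (sqr_sqrtr y0) -mulr_natl.
lra.
Qed.

(** Factor [x - y] as a difference of squares of roots, use the weighted arithmetic-geometric
    inequality with weight [s], then [(a + b)^2 <= 2 (a^2 + b^2)]. The free [s] makes the term in
    the total mass small before the divergence is looked at. *)
Lemma dist_le_bregman x y s : 0 <= x -> 0 <= y -> (y = 0 -> x = 0) -> 0 < s ->
  `|x - y| <= (2 * s)^-1 * (x * (ln x - ln y) - x + y) + s * (x + y).
Proof.
move=> x0 y0 yx s0.
have h := hellinger_bregman x0 y0 yx.
have s2 : 0 < (2 * s)^-1 by rewrite invr_gt0 mulr_gt0.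
apply: le_trans (lerD (ler_wpM2l (ltW s2) h) (lexx _)).
set a := Num.sqrt x; set b := Num.sqrt y.
have a0 : 0 <= a by exact: sqrtr_ge0.
have b0 : 0 <= b by exact: sqrtr_ge0.
have -> : x = a ^+ 2 by rewrite sqr_sqrtr.
have -> : y = b ^+ 2 by rewrite sqr_sqrtr.
rewrite subr_sqr normrM (ger0_norm (addr_ge0 a0 b0)).
set u := `|a - b|.
have -> : (a - b) ^+ 2 = u ^+ 2 by rewrite real_normK// num_real.
apply: (@le_trans _ _ ((2 * s)^-1 * u ^+ 2 + (s / 2) * (a + b) ^+ 2)).
  rewrite -subr_ge0.
  have -> : (2 * s)^-1 * u ^+ 2 + s / 2 * (a + b) ^+ 2 - u * (a + b) =
      (2 * s)^-1 * (u - s * (a + b)) ^+ 2 by field; rewrite gt_eqF.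
  by rewrite mulr_ge0 ?sqr_ge0// ltW.
rewrite lerD2l -subr_ge0.
have -> : s * (a ^+ 2 + b ^+ 2) - s / 2 * (a + b) ^+ 2 = s / 2 * (a - b) ^+ 2 by field.
by rewrite mulr_ge0 ?sqr_ge0// divr_ge0// ltW.
Qed.

(** Continuity of x ln x at 0, with a rate; it follows from [ln t <= t - 1] at [t = 1 / sqrt x]. *)
Lemma norm_xlnx_le x : 0 <= x -> x <= 1 -> `|xlnx x| <= 2 * Num.sqrt x.
Proof.
rewrite le_eqVlt => /orP[/eqP<-|x0] x1.
  by rewrite /xlnx mul0r normr0 mulr_ge0// sqrtr_ge0.
have sx : 0 < Num.sqrt x by rewrite sqrtr_gt0.
rewrite /xlnx ler0_norm ?mulr_ge0_le0 ?ln_le0// ?(ltW x0)//.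
have h : ln (Num.sqrt x)^-1 <= (Num.sqrt x)^-1 - 1 by apply: le_ln_sub1; rewrite invr_gt0.
rewrite lnV ?posrE// in h.
have -> : ln x = 2 * ln (Num.sqrt x).
  by rewrite -{1}(sqr_sqrtr (ltW x0)) lnXn// mulr_natl.
have := ler_wpM2l (ltW x0) h.
have -> : x * ((Num.sqrt x)^-1 - 1) = Num.sqrt x - x.
  rewrite -[in X in X * _](sqr_sqrtr (ltW x0)) -[X in _ = _ - X](sqr_sqrtr (ltW x0)).
  by field; rewrite gt_eqF.
lra.
Qed.

Lemma xlnx_cvg (I : Type) (F : set_system I) (FF : Filter F) (u : I -> R) (l : R) :
  (forall i, 0 <= u i) -> 0 <= l -> u i @[i --> F] --> l ->
  xlnx (u i) @[i --> F] --> xlnx l.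
Proof.
move=> u0; rewrite le_eqVlt => /orP[/eqP <-|l0] ul; last first.
  apply: cvgM => //; apply: (cvg_comp _ _ ul); exact: continuous_ln.
rewrite {2}/xlnx mul0r.
apply/cvgrPdist_le => e e0.
(* Chosen so that [2 * sqrt d <= e] in [norm_xlnx_le]. *)
pose d := Num.min 1 ((e / 2) ^+ 2).
have d0 : 0 < d by rewrite /d lt_min ltr01 exprn_gt0// divr_gt0.
move/cvgrPdist_le : ul => /(_ _ d0); apply: filterS => i.
rewrite !sub0r !normrN (ger0_norm (u0 i)) /d le_min => /andP[u1 u2].
apply: le_trans (norm_xlnx_le (u0 i) u1) _.
have : Num.sqrt (u i) <= Num.sqrt ((e/2)^+2) by rewrite ler_wsqrtr.
rewrite sqrtr_sqr ger0_norm ?divr_ge0 ?(ltW e0)// => h; rewrite mulrC -ler_pdivlMr//.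
Qed.

Lemma cvg_sum (I : Type) (F : set_system I) (FF : Filter F) (Q : Type)
    (s : seq Q) (P : pred Q) (u : I -> Q -> R) (l : Q -> R) :
  (forall q, u i q @[i --> F] --> l q) ->
  \sum_(q <- s | P q) u i q @[i --> F] --> \sum_(q <- s | P q) l q.
Proof. by move=> ul; apply: cvg_big => //; exact: add_continuous. Qed.

Lemma xlnx_sum_cvg (I : Type) (F : set_system I) (FF : Filter F) (Q : finType)
    (u : I -> Q -> R) (l : Q -> R) (k : Q -> R) :
  (forall i q, 0 <= u i q) -> (forall q, 0 <= l q) -> (forall q, 0 < k q) ->
  (forall q, u i q @[i --> F] --> l q) ->
  \sum_q u i q * ln (u i q / k q) @[i --> F] --> \sum_q l q * ln (l q / k q).
Proof.
move=> u0 l0 k0 ul.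
rewrite [X in _ --> X](_ : _ = \sum_q k q * xlnx (l q / k q)); last first.
  by apply: eq_bigr => q _; rewrite /xlnx mulrA mulrCA divff ?gt_eqF// mulr1.
rewrite [X in X i @[i --> _]](_ : _ = fun i => \sum_q k q * xlnx (u i q / k q)); last first.
  by apply/funext => i; apply: eq_bigr => q _; rewrite /xlnx mulrA mulrCA divff ?gt_eqF// mulr1.
apply: cvg_sum => q; apply: cvgMl_tmp; apply: xlnx_cvg => //.
- by move=> i; rewrite divr_ge0// ltW.
- by rewrite divr_ge0// ltW.
- exact: cvgMr_tmp (ul q).
Qed.

End xlnx.

Section nested_partitions.
Context d (X : measurableType d) (R : realType) (mu : {measure set X -> \bar R}).
Context (D : set X) (I : nat -> finType).
Variables (k : forall n, X -> I n) (r : forall n, I n.+1 -> I n).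
Variables (l v : forall n, I n -> R).
Hypothesis mD : measurable D.
Hypothesis mk : forall n i, measurable (D `&` k n @^-1` [set i]).
Hypothesis kr : forall n x, k n x = r (k n.+1 x).
Hypothesis mul : forall n i, mu (D `&` k n @^-1` [set i]) = (l i)%:E.
Hypothesis l_gt0 : forall n (i : I n), 0 < l i.
Hypothesis v_ge0 : forall n (i : I n), 0 <= v i.
Hypothesis vr : forall n (i : I n), v i = \sum_(j | r j == i) v j.

(** With the level written [p + m], recursion on [p] makes the types match by computation, and no
    cast between index types appears. *)
Fixpoint coarsen p m : I (p + m) -> I m :=
  if p is p'.+1 then fun j => coarsen (r j) else fun j => j.

Lemma coarsenE p m x : k m x = coarsen (k (p + m) x).
Proof. by elim: p => //= p IH; rewrite -kr. Qed.

Lemma sum_coarsen (w : forall n, I n -> R) :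
  (forall n (i : I n), w n i = \sum_(j | r j == i) w _ j) ->
  forall p m (i : I m), w _ i = \sum_(j : I (p + m) | coarsen j == i) w _ j.
Proof.
move=> wr p m i; elim: p => [|p IH] /=; first by rewrite big_pred1_eq.
rewrite IH (partition_big (@r (p + m)) (fun j => coarsen j == i))//=.
apply: eq_bigr => j ji; rewrite wr; apply: eq_bigl => j'.
by case: eqP => [->|]; rewrite ?ji ?andbF.
Qed.

Lemma measurable_step n (G : I n -> R) : measurable_fun D (fun x => G (k n x)).
Proof.
move=> _ Y mY.
rewrite (_ : _ `&` _ = \bigcup_(i in [set i | Y (G i)]) (D `&` k n @^-1` [set i])).
  by apply: fin_bigcup_measurable => //; exact: finite_finset.
apply/seteqP; split => [x [Dx Yx]|x [i Yi [Dx /= kx]]]; last by split => //=; rewrite kx.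
by exists (k n x).
Qed.

Lemma integral_step n (G : I n -> R) : (forall i, 0 <= G i) ->
  (\int[mu]_(x in D) (G (k n x))%:E = (\sum_i G i * l i)%:E)%E.
Proof.
move=> G0.
rewrite (_ : \int[mu]_(x in D) _ =
    \int[mu]_(x in D) (\sum_i (G i)%:E * (\1_(D `&` k n @^-1` [set i]) x)%:E))%E; last first.
  apply: eq_integral => x; rewrite inE => Dx.
  rewrite (bigD1 (k n x))//= big1 ?adde0; last first.
    move=> i ik; rewrite indicE memNset ?mule0// => -[_ /= ki].
    by rewrite ki eqxx in ik.
  by rewrite indicE mem_set// mule1.
rewrite ge0_integral_sum//; last 2 first.
  - move=> i; apply: emeasurable_funM => //.
    by apply/measurable_EFinP; exact: measurable_indic.
  - by move=> i x _; rewrite -EFinM lee_fin mulr_ge0 ?indicE.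
rewrite -sumEFin; apply: eq_bigr => i _.
rewrite ge0_integralZl//; last 2 first.
  - by apply/measurable_EFinP; exact: measurable_indic.
  - by rewrite lee_fin.
by rewrite integral_indic// setIAC setIid mul EFinM.
Qed.

Lemma integral_step_cell p m (G : I (p + m) -> R) (i : I m) :
  (forall j, 0 <= G j) ->
  (\int[mu]_(x in D `&` k m @^-1` [set i]) (G (k (p + m) x))%:E =
   (\sum_(j | coarsen j == i) G j * l j)%:E)%E.
Proof.
move=> G0; rewrite integral_mkcondr.
pose G' j := if coarsen j == i then G j else 0.
transitivity (\int[mu]_(x in D) (G' (k (p + m) x))%:E)%E.
  apply: eq_integral => x _; rewrite /patch /G' -coarsenE.
  case: (k m x =P i) => kx; first by rewrite mem_set.
  by rewrite memNset.
rewrite integral_step; last by move=> j; rewrite /G'; case: ifP.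
congr (_%:E); rewrite [RHS]big_mkcond/=; apply: eq_bigr => j _.
by rewrite /G'; case: ifP; rewrite ?mul0r.
Qed.

(** Additivity of the reference masses is not assumed: it comes from integrating 1 over a cell
    through the next level. *)
Lemma measure_sum_children n (i : I n) : l i = \sum_(j | r j == i) l j.
Proof.
have := @integral_step_cell 1 n (fun=> 1) i (fun=> ler01).
under [in X in _ = X -> _]eq_bigr do rewrite mul1r.
by rewrite integral_cst// mul1e mul => -[].
Qed.

Definition step_density n (i : I n) := v i / l i.
Definition step_entropy n := \sum_(i : I n) v i * ln (v i / l i).

Lemma step_density_ge0 n (i : I n) : 0 <= step_density i.
Proof. by rewrite divr_ge0// ltW. Qed.

(** The tower property: a function of the coarse cell only sees the coarse masses. *)
Lemma sum_coarsen_comp (w : forall n, I n -> R) (G : forall n, I n -> R) :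
  (forall n (i : I n), w n i = \sum_(j | r j == i) w _ j) ->
  forall p m, \sum_(j : I (p + m)) w _ j * G _ (coarsen j) = \sum_(i : I m) w _ i * G _ i.
Proof.
move=> wr p m; rewrite (partition_big (@coarsen p m) xpredT)//=.
apply: eq_bigr => i _; rewrite (sum_coarsen wr p i) mulr_suml.
by apply: eq_bigr => j /eqP ->.
Qed.

(** The Bregman divergence of x ln x between the density on a cell and on its ancestor. The linear
    terms cancel in the sum and make each term nonnegative. *)
Definition bregman_step p m (j : I (p + m)) :=
  step_density j * (ln (step_density j) - ln (step_density (coarsen j)))
  - step_density j + step_density (coarsen j).

Lemma coarsen_density0 p m (j : I (p + m)) :
  step_density (coarsen j) = 0 -> step_density j = 0.
Proof.
rewrite /step_density => /eqP; rewrite mulf_eq0 invr_eq0 (gt_eqF (l_gt0 _)) orbF => /eqP h.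
rewrite [v j](_ : _ = 0) ?mul0r//; apply/eqP; rewrite eq_le v_ge0 andbT -h.
rewrite (sum_coarsen vr p (coarsen j)) (bigD1 j)//= lerDl; exact: sumr_ge0.
Qed.

(** By the tower property the logarithm of the coarse density integrates to the coarse entropy, and
    both linear terms integrate to the same total mass. *)
Lemma sum_bregman p m : \sum_(j : I (p + m)) bregman_step j * l j =
  step_entropy (p + m) - step_entropy m.
Proof.
have sl : forall n (j : I n), step_density j * l j = v j.
  by move=> n j; rewrite /step_density mulfVK// gt_eqF.
transitivity (\sum_(j : I (p + m)) (v j * ln (step_density j)) -
  \sum_(j : I (p + m)) v j * ln (step_density (coarsen j)) -
  \sum_(j : I (p + m)) v j * 1 + \sum_(j : I (p + m)) l j * step_density (coarsen j)).
  rewrite -sumrB -sumrB -big_split/=; apply: eq_bigr => j _.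
  by rewrite /bregman_step -!sl; ring.
rewrite (sum_coarsen_comp (fun n (i : I n) => ln (step_density i)) vr).
rewrite (sum_coarsen_comp step_density measure_sum_children).
rewrite (sum_coarsen_comp (fun _ _ => 1) vr).
under [X in _ + X]eq_bigr do rewrite mulrC sl.
by under [X in _ - X + _]eq_bigr do rewrite mulr1; rewrite subrK.
Qed.

Lemma bregman_step_ge0 p m (j : I (p + m)) : 0 <= bregman_step j.
Proof.
apply: le_trans (hellinger_bregman _ _ (@coarsen_density0 _ _ j)); first exact: sqr_ge0.
  exact: step_density_ge0.
exact: step_density_ge0.
Qed.

Lemma step_entropy_le p m : step_entropy m <= step_entropy (p + m).
Proof.
rewrite -subr_ge0 -sum_bregman sumr_ge0// => j _.
by rewrite mulr_ge0 ?bregman_step_ge0// ltW.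
Qed.

Let V := \sum_(i : I 0) v i.

Lemma sum_mass n : \sum_(i : I n) v i = V.
Proof.
have := @sum_coarsen_comp v (fun _ _ => 1) vr n 0; rewrite addn0.
under eq_bigr do rewrite mulr1; move=> ->.
by under eq_bigr do rewrite mulr1.
Qed.

(* The entropy increments are Bregman divergences, and these control the L^1
   increments of the martingale of densities; so bounded entropy alone makes the
   martingale Cauchy in L^1. *)
Lemma integral_dist_step p m s : 0 < s ->
  (\int[mu]_(x in D) `|step_density (k (p + m) x) - step_density (k m x)|%:E <=
  ((2 * s)^-1 * (step_entropy (p + m) - step_entropy m) + s * (2 * V))%:E)%E.
Proof.
move=> s0; under eq_integral do rewrite (coarsenE p m).
rewrite (@integral_step _ (fun j => `|step_density j - step_density (coarsen j)|))//.
rewrite lee_fin -sum_bregman.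
have -> : 2 * V = \sum_(j : I (p + m)) (step_density j + step_density (coarsen j)) * l j.
  under [RHS]eq_bigr do rewrite mulrDl [X in _ + X]mulrC.
  rewrite big_split/= (sum_coarsen_comp step_density measure_sum_children).
  rewrite mulr_natl mulr2n -{1}(sum_mass (p + m)) -(sum_mass m).
  congr (_ + _); apply: eq_bigr => j _; rewrite /step_density ?mulfVK ?gt_eqF//.
  by rewrite mulrC mulfVK// gt_eqF.
rewrite !mulr_sumr -big_split; apply: ler_sum => j _ /=.
rewrite !mulrA -mulrDl ler_wpM2r ?(ltW (l_gt0 _))//.
exact: dist_le_bregman (step_density_ge0 _) (step_density_ge0 _) (@coarsen_density0 _ _ j) s0.
Qed.

Let f_ n x := step_density (k n x).

Let f_ge0 n x : 0 <= f_ n x. Proof. exact: step_density_ge0. Qed.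

Let mf_ n : measurable_fun D (f_ n). Proof. exact: measurable_step. Qed.

Variable a : R.
Hypothesis step_entropy_le_a : forall n, step_entropy n <= a.

Let V_ge0 : 0 <= V. Proof. exact: sumr_ge0. Qed.

Lemma step_density_cauchy (e : R) : 0 < e -> exists N, forall m n,
  (N <= m <= n)%N -> (\int[mu]_(x in D) `|f_ n x - f_ m x|%:E <= e%:E)%E.
Proof.
move=> e0.
have V1 : 0 < V + 1 by rewrite ltr_wpDl.
(* This gives [s * (2 * V) <= e / 2]; the [+ 1] covers [V = 0]. *)
pose s := e / (4 * (V + 1)).
have s0 : 0 < s by rewrite divr_gt0// mulr_gt0.
have hs : has_sup (range step_entropy).
  by split; [exists (step_entropy 0), 0%N|exists a => _ [n _ <-]].
(* The entropies increase and are bounded. From a level within [s * e] of their supremum on, the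
   increments are below [s * e], and [(2 * s)^-1 * (s * e) = e / 2]. *)
have [_ [N _ <-] hN] := @sup_adherent _ _ (s * e) (mulr_gt0 s0 e0) hs.
exists N => m n /andP[Nm mn].
rewrite -(subnK mn); apply: le_trans (integral_dist_step _ _ s0) _.
have hm : step_entropy N <= step_entropy m by rewrite -(subnK Nm) step_entropy_le.
have hn : step_entropy (n - m + m) <= sup (range step_entropy).
  by apply: ub_le_sup; [exact: hs.2|exists (n - m + m)%N].
rewrite lee_fin.
apply: (@le_trans _ _ ((2 * s)^-1 * (s * e) + s * (2 * V))).
  rewrite lerD2r; apply: ler_wpM2l; first by rewrite invr_ge0 mulr_ge0// ltW.
  rewrite lerBlDr.
  by apply: (le_trans hn); rewrite -lerBlDl; apply: le_trans hm; rewrite ltW.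
have -> : (2 * s)^-1 * (s * e) = e / 2 by field; rewrite gt_eqF.
have : s * (2 * V) <= s * (2 * (V + 1)).
  by apply: ler_wpM2l; [exact: ltW|rewrite ler_wpM2l// lerDl].
have -> : s * (2 * (V + 1)) = e / 2 by rewrite /s; field; rewrite gt_eqF.
lra.
Qed.

(** A subsequence of densities with summable L^1 increments converges almost everywhere, dominated
    by its first term plus the sum of the increments. Dominated convergence gives the cell
    integrals, Fatou's lemma the entropy bound. *)
Theorem bounded_entropy_density : exists f : X -> R,
  [/\ measurable_fun D f, forall x, 0 <= f x,
    forall m (i : I m), (\int[mu]_(x in D `&` k m @^-1` [set i]) (f x)%:E = (v i)%:E)%E,
    mu.-integrable D (fun x => (xlnx (f x))%:E) &
    (\int[mu]_(x in D) (xlnx (f x))%:E <= a%:E)%E].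
Proof.
have half_gt0 K : 0 < 2^-1 ^+ K :> R by rewrite exprn_gt0// invr_gt0.
pose N K := sval (cid (step_density_cauchy (half_gt0 K))).
have NP K m n : (N K <= m <= n)%N ->
    (\int[mu]_(x in D) `|f_ n x - f_ m x|%:E <= (2^-1 ^+ K)%:E)%E.
  by rewrite /N; case: cid => /= N0; apply.
(* Summing the [N i] makes the sequence nondecreasing and at least [N K]; adding [K] makes it pass
   every level. *)
pose n_ K := (\sum_(i < K.+1) N i + K)%N.
pose U K x := f_ (n_ K) x.
have nS K : (n_ K <= n_ K.+1)%N.
  by rewrite /n_ [in leqRHS]big_ord_recr/= leq_add ?leq_addr.
have U_ge0 K x : 0 <= U K x by exact: f_ge0.
have mU K : measurable_fun D (U K) by exact: mf_.
pose dU K x := `|U K.+1 x - U K x|.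
have mdU K : measurable_fun D (dU K).
  by apply/measurableT_comp => //; exact: measurable_funB.
have dU_int K : (\int[mu]_(x in D) (dU K x)%:E <= (2^-1 ^+ K)%:E)%E.
  apply: NP; rewrite nS andbT /n_ big_ord_recr/=; rewrite -addnA addnCA leq_addr//.
pose g x := (\sum_(K <oo) (dU K x)%:E)%E.
have mg : measurable_fun D g.
  apply: ge0_emeasurable_sum => [K x _ _|K _]; first by rewrite lee_fin normr_ge0.
  by apply/measurable_EFinP.
have g0 x : (0 <= g x)%E by apply: nneseries_ge0 => K _ _; rewrite lee_fin normr_ge0.
have g_int : (\int[mu]_(x in D) g x <= 2%:E)%E.
  rewrite integral_nneseries//; last 2 first.
    by move=> K; apply/measurable_EFinP.
    by move=> K x _; rewrite lee_fin normr_ge0.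
  apply: (@le_trans _ _ (\sum_(K <oo) (2^-1 ^+ K)%:E)%E).
    by apply: lee_nneseries => // K _ _; apply: integral_ge0 => x _; rewrite lee_fin normr_ge0.
  apply: lime_le; first by apply: is_cvg_nneseries => K _ _; rewrite lee_fin.
  apply: nearW => n; rewrite sumEFin lee_fin.
  rewrite [leRHS](_ : _ = 1 / (1 - 2^-1)); last by field.
  have -> : \sum_(0 <= i < n) 2^-1 ^+ i = series (geometric 1 2^-1) n :> R.
    by apply: eq_bigr => i _; rewrite /= mul1r.
  apply: geometric_le_lim; rewrite ?invr_gt0//.
  by rewrite ger0_norm ?invr_ge0// invf_lt1// ltr1n.
have ig : mu.-integrable D g.
  apply/integrableP; split => //; under eq_integral do rewrite gee0_abs//.
  exact: le_lt_trans g_int (ltry _).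
have cvgU x : g x \is a fin_num -> cvgn (U ^~ x).
  move=> gx.
  have cs : cvgn (series (fun K => U K.+1 x - U K x)).
    apply: normed_cvg; apply: nondecreasing_is_cvgn; last first.
      exists (fine (g x)) => _ [n _ <-]; rewrite -lee_fin fineK// /series/= -sumEFin.
      by apply: nneseries_lim_ge => K _ _; rewrite lee_fin normr_ge0.
    by apply: nondecreasing_series => n _ _; exact: normr_ge0.
  have -> : U^~ x = (fun n => U 0 x + series (fun K => U K.+1 x - U K x) n).
    apply/funext => n; rewrite /series/= telescope_sumr// addrC subrK//.
  by apply: is_cvgD => //; exact: is_cvg_cst.
have aeU : {ae mu, forall x, D x -> cvgn (U ^~ x)}.
  by apply: filterS (integrable_ae mD ig) => x gx Dx; apply: cvgU; exact: gx.
(* An upper limit is measurable without discarding the null set where the sequence diverges. *)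
pose f x := fine (limn_esup (fun K => (U K x)%:E)).
have mf : measurable_fun D f.
  apply: (@measurableT_comp _ _ _ _ _ _ fine); first exact: fine_measurable.
  by apply: measurable_fun_limn_esup => K; apply/measurable_EFinP.
have fU x : cvgn (U ^~ x) -> U K x @[K --> \oo] --> f x.
  move=> cU; suff -> : f x = limn (U^~ x) by [].
  have /cvg_limn_einf_sup[_ e] : (U K x)%:E @[K --> \oo] --> (limn (U^~ x))%:E.
    by apply: cvg_EFin => //; exact: nearW.
  by rewrite /f e.
have f0 x : 0 <= f x.
  apply: fine_ge0; rewrite limn_esup_lim; apply: lime_ge; first exact: is_cvg_esups.
  apply: nearW => n; rewrite /esups; apply: le_ereal_sup_tmp.
  by exists (U n x)%:E; [exists n => /=|rewrite lee_fin].
have Ug K x : ((U K x)%:E <= (U 0 x)%:E + g x)%E.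
  have h : U K x <= U 0 x + \sum_(0 <= i < K) dU i x.
    have -> : U K x = U 0 x + \sum_(0 <= i < K) (U i.+1 x - U i x).
      by rewrite telescope_sumr// addrC subrK.
    by rewrite lerD2l; apply: ler_sum => i _; exact: ler_norm.
  apply: (@le_trans _ _ (U 0 x + \sum_(0 <= i < K) dU i x)%:E); first by rewrite lee_fin.
  rewrite EFinD leeD2l// -sumEFin.
  by apply: nneseries_lim_ge => i _ _; rewrite lee_fin normr_ge0.
have aeUf : {ae mu, forall x, D x -> U K x @[K --> \oo] --> f x}.
  by apply: filterS aeU => x h /h; exact: fU.
have entropy_int n : (\int[mu]_(x in D) (xlnx (f_ n x) + 1)%:E <= a%:E + mu D)%E.
  rewrite (@integral_step n (fun i => xlnx (step_density i) + 1)); last first.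
    by move=> i; rewrite -lerBlDr sub0r (le_trans _ (xlnx_ge (step_density_ge0 i)))// lerDr step_density_ge0.
  have muD : mu D = (\sum_i l (i : I n))%:E.
    have := @integral_step n (fun=> 1) (fun=> ler01).
    by rewrite integral_cst// mul1e => ->; under eq_bigr do rewrite mul1r.
  rewrite muD -EFinD lee_fin.
  under eq_bigr do rewrite mulrDl mul1r.
  rewrite big_split/= lerD2r; apply: le_trans (step_entropy_le_a n).
  by apply: ler_sum => i _; rewrite /xlnx mulrAC /step_density mulfVK// gt_eqF.
have muDfin : (mu D < +oo)%E.
  have := @integral_step 0 (fun=> 1) (fun=> ler01).
  by rewrite integral_cst// mul1e => ->; exact: ltry.
have mxlnx (h : X -> R) : measurable_fun D h -> measurable_fun D (fun x => xlnx (h x)).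
  move=> mh; apply: measurable_funM => //.
  by apply: measurableT_comp mh; exact: measurable_ln.
(* Fatou's lemma asks for nonnegative functions. Since [y - 1 <= xlnx y], adding 1 suffices; its
   integral [mu D] is finite and is removed at the end. *)
have fatou_f : (\int[mu]_(x in D) (xlnx (f x) + 1)%:E <= a%:E + mu D)%E.
  have x1ge0 y : 0 <= y -> 0 <= xlnx y + 1.
    by move=> y0; rewrite -lerBlDr sub0r (le_trans _ (xlnx_ge y0))// lerDr.
  have mUx K : measurable_fun D (fun x => (xlnx (U K x) + 1)%:E).
    by apply/measurable_EFinP; apply: measurable_funD => //; exact: mxlnx.
  have := @fatou _ _ _ mu D mD (fun K x => (xlnx (U K x) + 1)%:E) mUx.
  have Ux0 K x : D x -> (0 <= (xlnx (U K x) + 1)%:E)%E by move=> _; rewrite lee_fin x1ge0.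
  move=> /(_ Ux0) h; apply: le_trans (le_trans h _); last first.
    rewrite limn_einf_lim; apply: lime_le; first exact: is_cvg_einfs.
    apply: nearW => K; apply: le_trans (entropy_int (n_ K)).
    by apply: ge_ereal_inf; exists (\int[mu]_(x in D) (xlnx (U K x) + 1)%:E)%E => //; exists K => /=.
  rewrite (ge0_ae_eq_integral (g := fun x => limn_einf (fun K => (xlnx (U K x) + 1)%:E)))//.
  - by apply/measurable_EFinP; apply: measurable_funD => //; exact: mxlnx.
  - rewrite (_ : (fun x => _) = fun x => - limn_esup (fun K => - (xlnx (U K x) + 1)%:E))%E; last first.
      apply/funext => x; rewrite -limn_einfN; congr limn_einf.
      by apply/funext => K; rewrite /= opprK.
    by apply: measurableT_comp => //; apply: measurable_fun_limn_esup => K; exact: measurableT_comp.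
  - by move=> x _; rewrite lee_fin x1ge0.
  - move=> x _; rewrite limn_einf_lim; apply: lime_ge; first exact: is_cvg_einfs.
    by apply: nearW => K; apply: le_ereal_inf_tmp => _ [m /= _ <-]; rewrite lee_fin x1ge0.
  - apply: filterS aeUf => x h' Dx; apply/esym.
    suff /cvg_limn_einf_sup[-> _] : (xlnx (U K x) + 1)%:E @[K --> \oo] --> (xlnx (f x) + 1)%:E by [].
    apply: cvg_EFin; first exact: nearW.
    by apply: cvgD; [exact: (xlnx_cvg _ _ _ (h' Dx))|exact: cvg_cst].
have ixlnx1 : mu.-integrable D (fun x => (xlnx (f x) + 1)%:E).
  apply/integrableP; split.
    by apply/measurable_EFinP; apply: measurable_funD => //; exact: mxlnx.
  under eq_integral.
    move=> x _; rewrite gee0_abs; first over.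
    by rewrite lee_fin -lerBlDr sub0r (le_trans _ (xlnx_ge (f0 x)))// lerDr.
  by apply: le_lt_trans fatou_f _; rewrite lte_add_pinfty// ltry.
have i1 : mu.-integrable D (fun=> 1%:E).
  apply/integrableP; split; first exact: measurable_cst.
  by rewrite integral_cst// normr1 mul1e.
have ixlnx : mu.-integrable D (fun x => (xlnx (f x))%:E).
  have := integrableB mD ixlnx1 i1; apply: eq_integrable => // x _ /=.
  by rewrite -EFinB addrK.
exists f; split => //.
- move=> m i; set E := D `&` _.
  have mE : measurable E by exact: mk.
  have ED : E `<=` D by exact: subIsetl.
  have iU0 : mu.-integrable D (fun x => (U 0 x)%:E).
    apply/integrableP; split; first exact/measurable_EFinP.
    under eq_integral do rewrite gee0_abs ?lee_fin//.
    rewrite (@integral_step _ (@step_density _)) ?ltry//; exact: step_density_ge0.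
  have [|||||_ _ cvg_int] := @dominated_convergence _ _ _ mu E mE (fun K x => (U K x)%:E)
    (fun x => (f x)%:E) (fun x => (U 0 x)%:E + g x)%E.
  - by move=> K; apply/measurable_EFinP; exact: measurable_funS (mU K).
  - by apply/measurable_EFinP; exact: measurable_funS mf.
  - apply: filterS aeUf => x h /ED Dx; apply: cvg_EFin; first exact: nearW.
    exact: h.
  - by apply: (integrableS mD) => //; exact: integrableD.
  - by apply: aeW => x K _; rewrite gee0_abs ?lee_fin.
  apply: (cvg_unique _ cvg_int) => //.
  (* Past level [m] the integral over a cell of level [m] no longer changes: it is the sum of the
     masses of its descendants. *)
  apply: cvg_near_cst; exists m => // K /= mK.
  have mn : (m <= n_ K)%N by rewrite (leq_trans mK)// leq_addl.
  rewrite /U -(subnK mn) (@integral_step_cell _ _ (@step_density _))//; last first.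
    exact: step_density_ge0.
  congr (_%:E); rewrite [RHS](sum_coarsen vr (n_ K - m)).
  by apply: eq_bigr => j _; rewrite /step_density mulfVK// gt_eqF.
- have := fatou_f; under eq_integral do rewrite EFinD.
  by rewrite integralD// integral_cst// mul1e leeD2rE// ge0_fin_numE.
Qed.

End nested_partitions.

(** * Dyadic cells and the weak topology *)

Section dyadic.
Context {R : realType}.
Implicit Types (b y : R) (n : nat).

Lemma dyadic_subproof n b y : (minn (Num.truncn (y / b * 2 ^+ n)) (2 ^ n).-1 < 2 ^ n)%N.
Proof. by rewrite (leq_ltn_trans (geq_minr _ _))// prednK ?expn_gt0. Qed.

(* The minimum puts the right endpoint [y = b] in the last interval. *)
Definition dyadic n b y : 'I_(2 ^ n) := Ordinal (dyadic_subproof n b y).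

(** [closed] is true for time, where the last interval contains [T], and false for the angle, which
    never reaches [2 * pi]. *)
Definition dyadic_itv n b (closed : bool) (i : 'I_(2 ^ n)) : interval R :=
  Interval (BLeft (i%:R * b / 2 ^+ n))
    (BSide (~~ (closed && (i.+1 == 2 ^ n)%N)) (i.+1%:R * b / 2 ^+ n)).

Lemma dyadicP n b y (i : 'I_(2 ^ n)) (closed : bool) : 0 < b -> 0 <= y ->
  (if closed then y <= b else y < b) ->
  (dyadic n b y == i) = (y \in dyadic_itv b closed i).
Proof.
move=> b0 y0 yb.
have n0 : 0 < 2 ^+ n :> R by rewrite exprn_gt0.
set z := y / b * 2 ^+ n.
have z0 : 0 <= z by rewrite mulr_ge0// ?divr_ge0// ltW.
have zE (k : nat) : ((k%:R * b / 2 ^+ n <= y) = (k%:R <= z)) *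
    ((y < k%:R * b / 2 ^+ n) = (z < k%:R)) * ((y <= k%:R * b / 2 ^+ n) = (z <= k%:R)).
  have -> : y = z * b / 2 ^+ n by rewrite /z; field; rewrite !gt_eqF.
  by rewrite !(ler_pM2r, ltr_pM2r) ?invr_gt0// !(ler_pM2r, ltr_pM2r).
have zle : z <= (2 ^ n)%:R.
  rewrite natrX /z -[leRHS]mul1r ler_pM2r// ler_pdivrMr// mul1r.
  by case: closed yb => // /ltW.
have zlt : ~~ closed -> z < (2 ^ n)%:R.
  by case: closed yb => // yb _; rewrite natrX /z -[ltRHS]mul1r ltr_pM2r// ltr_pdivrMr// mul1r.
rewrite itv_boundlr/= bnd_simp zE/=.
rewrite -val_eqE/= -/z.
set t := Num.truncn z.
have ti : (i%:R <= z) = (i <= t)%N by rewrite truncn_ge_nat.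
have tS : (z < i.+1%:R) = (t < i.+1)%N by rewrite truncn_lt_nat.
have [il|il] := eqVneq i.+1 (2 ^ n)%N.
  transitivity (i%:R <= z); first by rewrite ti; lia.
  case: closed yb zlt => //= yb zlt.
    by rewrite bnd_simp zE il zle andbT.
  by rewrite bnd_simp zE il zlt// andbT.
rewrite andbF/= bnd_simp zE ti tS.
have := ltn_ord i; lia.
Qed.

Lemma half_ord_subproof n (j : 'I_(2 ^ n.+1)) : (j./2 < 2 ^ n)%N.
Proof. by rewrite ltn_half_double -mul2n -expnS. Qed.

Definition half_ord n (j : 'I_(2 ^ n.+1)) : 'I_(2 ^ n) :=
  Ordinal (half_ord_subproof j).

(** Stated for every real [y], as the partition argument requires compatible labels on the whole
    plane. Truncation sends negative numbers to 0, and halving turns the cap [2 ^ n.+1 - 1] into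
    [2 ^ n - 1]. *)
Lemma dyadicS n b y : 0 < b -> dyadic n b y = half_ord (dyadic n.+1 b y).
Proof.
move=> b0; apply: val_inj => /=.
have [y0|y0] := ltP y 0.
  have trunc0 m : Num.truncn (y / b * 2 ^+ m) = 0%N.
    apply/truncn0Pn; rewrite -ltNge (lt_trans _ ltr01)//.
    by rewrite pmulr_llt0 ?exprn_gt0// pmulr_llt0// invr_gt0.
  by rewrite !trunc0 !min0n.
have yb0 : 0 <= y / b by rewrite divr_ge0// ltW.
have z0 : 0 <= y / b * 2 ^+ n by rewrite mulr_ge0// exprn_ge0.
have z0' : 0 <= y / b * 2 ^+ n.+1 by rewrite mulr_ge0// exprn_ge0.
have h : Num.truncn (y / b * 2 ^+ n) = (Num.truncn (y / b * 2 ^+ n.+1))./2.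
  apply/eqP; rewrite truncn_eq//.
  have /andP[h1 h2] := truncn_itv z0'.
  set t := Num.truncn _ in h1 h2 *.
  have h3 : ((t./2).*2%:R <= t%:R :> R) by rewrite ler_nat; lia.
  have h4 : (t.+1%:R <= (t./2.+1).*2%:R :> R) by rewrite ler_nat; lia.
  rewrite -muln2 natrM in h3; rewrite -muln2 natrM in h4.
  rewrite exprS in h1 h2.
  by apply/andP; split; lra.
rewrite h expnS; have := expn_gt0 2 n; lia.
Qed.

Lemma dyadic_dist n b x y : 0 < b -> 0 <= x <= b -> 0 <= y <= b ->
  dyadic n b x = dyadic n b y -> `|x - y| <= b / 2 ^+ n.
Proof.
move=> b0 /andP[x0 xb] /andP[y0 yb] xy.
have /esym := @dyadicP n b x (dyadic n b y) true b0 x0 xb.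
have /esym := @dyadicP n b y (dyadic n b y) true b0 y0 yb.
rewrite xy eqxx !itv_boundlr => /andP[+ h1] /andP[+ h2]; rewrite !bnd_simp => h3 h4.
have h1' : y <= (dyadic n b y).+1%:R * b / 2 ^+ n.
  by case: (_ && _) h1; rewrite /= bnd_simp// => /ltW.
have h2' : x <= (dyadic n b y).+1%:R * b / 2 ^+ n.
  by case: (_ && _) h2; rewrite /= bnd_simp// => /ltW.
rewrite -[in X in X * _]addn1 natrD in h1'.
rewrite -[in X in X * _]addn1 natrD in h2'.
by rewrite ler_norml; apply/andP; split; lra.
Qed.

Lemma lebesgue_dyadic_itv n b (closed : bool) (i : 'I_(2 ^ n)) : 0 < b ->
  lebesgue_measure [set` dyadic_itv b closed i] = (b / 2 ^+ n)%:E.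
Proof.
move=> b0; rewrite lebesgue_measure_itv/= lte_fin.
have n0 : 0 < 2 ^+ n :> R by rewrite exprn_gt0.
rewrite ltr_pM2r ?invr_gt0// ltr_pM2r// ltr_nat ltnSn -EFinB; congr (_%:E).
by rewrite -addn1 natrD; ring.
Qed.

Lemma dyadic_itv_sub n b (closed : bool) (i : 'I_(2 ^ n)) : 0 < b ->
  [set` dyadic_itv b closed i] `<=` [set` Interval (BLeft 0) (BSide (~~ closed) b)].
Proof.
move=> b0 y /=; rewrite !itv_boundlr !bnd_simp => /andP[h1 h2].
have n0 : 0 < 2 ^+ n :> R by rewrite exprn_gt0.
have il : i.+1%:R * b / 2 ^+ n <= b.
  by rewrite ler_pdivrMr// mulrC ler_pM2l// -natrX ler_nat ltn_ord.
apply/andP; split.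
  by apply: le_trans h1; rewrite divr_ge0 ?mulr_ge0// ltW.
case: closed h2 => /=; last by rewrite !bnd_simp => /lt_le_trans; apply.
case: eqP => _ /=; rewrite !bnd_simp; first by move/le_trans; apply.
by move=> /ltW/le_trans; apply.
Qed.

End dyadic.

Lemma bounded_integrable d (X : measurableType d) (R : realType)
    (mu : {measure set X -> \bar R}) (A : set X) (f : X -> R) (M : R) :
  measurable A -> (mu A < +oo)%E -> measurable_fun A f ->
  (forall x, A x -> `|f x| <= M) -> mu.-integrable A (EFin \o f).
Proof.
move=> mA muA mf fM; apply: measurable_bounded_integrable => //.
by exists M; split; [exact: num_real|move=> N MN x /fM /le_trans; apply; exact: ltW].
Qed.

Section cells.
Context {R : realType} (T : R).
Hypothesis T_gt0 : 0 < T.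
Implicit Types (n : nat) (rho : driving_measure T).

Definition cell_index n (x : plane R) : 'I_(2 ^ n) * 'I_(2 ^ n) :=
  (dyadic n (2 * pi) x.1, dyadic n T x.2).

Definition cell_parent n (q : 'I_(2 ^ n.+1) * 'I_(2 ^ n.+1)) :
  'I_(2 ^ n) * 'I_(2 ^ n) := (half_ord q.1, half_ord q.2).

Definition cell n (q : 'I_(2 ^ n) * 'I_(2 ^ n)) : set (plane R) :=
  cylinder T `&` cell_index n @^-1` [set q].

Lemma cell_indexS n x : cell_index n x = cell_parent (cell_index n.+1 x).
Proof.
rewrite /cell_index /cell_parent /= (dyadicS n x.1 twopi_gt0).
by rewrite (dyadicS n x.2 T_gt0).
Qed.

Lemma cellE n (q : 'I_(2 ^ n) * 'I_(2 ^ n)) :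
  cell q = [set` dyadic_itv (2 * pi) false q.1] `*` [set` dyadic_itv T true q.2].
Proof.
apply/seteqP; split => [x [[/= x1 x2] <-]|x [/= x1 x2]].
  rewrite /angles /= in_itv/= in x1; rewrite in_itv/= in x2.
  move: x1 x2 => /andP[? ?] /andP[? ?].
  by split => /=; rewrite -dyadicP// ?eqxx// twopi_gt0.
have /= h1 := dyadic_itv_sub (@twopi_gt0 R) x1.
have /= h2 := dyadic_itv_sub T_gt0 x2.
split; first by [].
move: h1 h2; rewrite !in_itv/= => /andP[? ?] /andP[? ?].
rewrite /cell_index [RHS]surjective_pairing; congr pair; apply/eqP.
  by rewrite (@dyadicP _ _ _ _ _ false)// twopi_gt0.
by rewrite (@dyadicP _ _ _ _ _ true).
Qed.

Lemma measurable_cylinder : measurable (@cylinder R T).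
Proof. by apply: measurableX; exact: measurable_itv. Qed.

Lemma measurable_cell n (q : 'I_(2 ^ n) * 'I_(2 ^ n)) : measurable (cell q).
Proof. by rewrite cellE; apply: measurableX; exact: measurable_itv. Qed.

Lemma lebesgue_cell n (q : 'I_(2 ^ n) * 'I_(2 ^ n)) :
  ((lebesgue_measure \x lebesgue_measure) (cell q) =
   (2 * pi / 2 ^+ n * (T / 2 ^+ n))%:E)%E.
Proof.
rewrite cellE product_measure1E; [|exact: measurable_itv|exact: measurable_itv].
by rewrite EFinM; congr (_ * _)%E; apply: lebesgue_dyadic_itv; rewrite ?twopi_gt0.
Qed.

Lemma driving_cylinder rho : rho (cylinder T) = T%:E.
Proof.
rewrite driving_marginal//= lebesgue_measure_itv/= lte_fin T_gt0.
by rewrite EFinN sube0.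
Qed.

Definition cell_mass rho n q : R := fine (rho (@cell n q)).

Lemma cell_massE rho n q : rho (@cell n q) = (cell_mass rho q)%:E.
Proof.
rewrite fineK// ge0_fin_numE//; apply: le_lt_trans (ltry T).
rewrite -(driving_cylinder rho); apply: le_measure; rewrite ?inE.
- exact: measurable_cell.
- exact: measurable_cylinder.
- exact: subIsetl.
Qed.

Lemma cell_mass_ge0 rho n q : 0 <= @cell_mass rho n q.
Proof. exact: fine_ge0. Qed.

Lemma cell_mass_parent rho n (q : 'I_(2 ^ n) * 'I_(2 ^ n)) :
  cell_mass rho q = \sum_(q' | cell_parent q' == q) cell_mass rho q'.
Proof.
exact: (@measure_sum_children _ _ _ rho (cylinder T) _ cell_index cell_parent
  (fun n q => cell_mass rho q) measurable_cylinder
  measurable_cell cell_indexS (cell_massE rho)).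
Qed.

Lemma integral_cells rho n (G : 'I_(2 ^ n) * 'I_(2 ^ n) -> R) :
  (forall q, 0 <= G q) ->
  (\int[rho]_(x in cylinder T) (G (cell_index n x))%:E =
   (\sum_q G q * cell_mass rho q)%:E)%E.
Proof.
exact: (@integral_step _ _ _ rho (cylinder T) _ cell_index
  (fun n q => cell_mass rho q) measurable_cylinder measurable_cell (cell_massE rho)).
Qed.

Lemma sum_cell_mass rho n : \sum_q cell_mass rho (q : 'I_(2 ^ n) * 'I_(2 ^ n)) = T.
Proof.
have := @integral_cells rho n (fun=> 1) (fun=> ler01).
rewrite integral_cst ?mul1e; last exact: measurable_cylinder.
rewrite driving_cylinder => -[->]; by apply: eq_bigr => q _; rewrite mul1r.
Qed.

Lemma cell_mass_le rho n q : @cell_mass rho n q <= T.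
Proof.
rewrite -(sum_cell_mass rho n) (bigD1 q)//= lerDl sumr_ge0// => i _.
exact: cell_mass_ge0.
Qed.

Lemma sum_cell_mass_time rho n (j : 'I_(2 ^ n)) :
  \sum_(i < 2 ^ n) cell_mass rho (i, j) = T / 2 ^+ n.
Proof.
have := @integral_cells rho n (fun q => (q.2 == j)%:R) (fun=> ler0n _ _).
have mJ : measurable (angles `*` [set` dyadic_itv T true j] : set (plane R)).
  by apply: measurableX; exact: measurable_itv.
rewrite (_ : \int[rho]_(x in _) _ =
    \int[rho]_(x in cylinder T) (\1_(angles `*` [set` dyadic_itv T true j]) x)%:E)%E; last first.
  apply: eq_integral => x; rewrite inE => -[/= x1 x2].
  congr (_%:E); rewrite indicE; congr (nat_of_bool _)%:R.
  move: x2; rewrite in_itv/= => /andP[t0 tT].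
  rewrite (@dyadicP _ _ _ _ _ true)//; apply/idP/idP => [h|]; first by rewrite inE.
  by rewrite inE => -[].
rewrite integral_indic//; last exact: measurable_cylinder.
rewrite setIidl; last first.
  by move=> x [/= x1 /(dyadic_itv_sub T_gt0) x2]; split.
rewrite driving_marginal; last exact: dyadic_itv_sub.
rewrite lebesgue_dyadic_itv// => -[->].
rewrite (eq_bigr (fun q => if q.2 == j then cell_mass rho (q.1, q.2) else 0)); last first.
  by move=> [q1 q2] _ /=; case: eqP; rewrite ?mul1r ?mul0r.
rewrite -big_mkcond -(pair_big xpredT (fun q => q == j) (fun i j => cell_mass rho (i, j)))/=.
by apply: eq_bigr => i _; rewrite big_pred1_eq.
Qed.

Lemma Rintegral_cells_dist rho n (G : plane R -> R) g e :
  measurable_fun (cylinder T) G ->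
  (forall x, cylinder T x -> `|G x - g (cell_index n x)| <= e) ->
  `|(\int[rho]_(x in cylinder T) G x)%R - \sum_q g q * cell_mass rho q| <= e * T.
Proof.
move=> mG Gg.
have mC := measurable_cylinder.
have fC : (rho (cylinder T) < +oo)%E by rewrite driving_cylinder ltry.
have mstep (h : 'I_(2 ^ n) * 'I_(2 ^ n) -> R) :
    measurable_fun (cylinder T) (fun x => h (cell_index n x)).
  by apply: measurable_step; exact: measurable_cell.
have istep (h : 'I_(2 ^ n) * 'I_(2 ^ n) -> R) :
    rho.-integrable (cylinder T) (EFin \o (fun x => h (cell_index n x))).
  apply: (@bounded_integrable _ _ _ _ _ _ (\sum_q `|h q|)) => // x _ /=; rewrite (bigD1 (cell_index n x))//= lerDl.
  exact: sumr_ge0.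
have iD : rho.-integrable (cylinder T) (EFin \o (fun x => G x - g (cell_index n x))).
  by apply: (@bounded_integrable _ _ _ _ _ _ e) => //; exact: measurable_funB.
have iG : rho.-integrable (cylinder T) (EFin \o G).
  have := integrableD mC iD (istep g); apply: eq_integrable => // x _ /=.
  by rewrite -EFinD subrK.
have -> : \sum_q g q * cell_mass rho q =
    (\int[rho]_(x in cylinder T) g (cell_index n x))%R.
  (* [integral_cells] is for nonnegative step functions: shift [g] by a constant, whose contribution
     is known from the total mass [T]. *)
  pose M := \sum_q `|g q|.
  have gM q : 0 <= g q + M.
    rewrite -lerBlDr sub0r lerNl; apply: (@le_trans _ _ `|g q|); first by rewrite -normrN ler_norm.
    by rewrite /M (bigD1 q)//= lerDl sumr_ge0.
  have := @integral_cells rho n (fun q => g q + M) gM => /(congr1 fine) /= h.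
  have : (\int[rho]_(x in cylinder T) (g (cell_index n x) + M))%R =
    \sum_q (g q + M) * cell_mass rho q by [].
  rewrite RintegralD//; last exact: (istep (fun=> M)).
  rewrite Rintegral_cst// driving_cylinder/=.
  under eq_bigr do rewrite mulrDl.
  by rewrite big_split/= -mulr_sumr sum_cell_mass => /addIr.
rewrite -RintegralB//.
apply: le_trans (le_normr_Rintegral _ _) _ => //.
rewrite -[T in leRHS]/(fine T%:E) -(driving_cylinder rho) -Rintegral_cst//.
apply: le_Rintegral => //.
- by apply/integrable_abse : iD.
- exact: (istep (fun=> e)).
Qed.

End cells.

(** * Test functions seen through the cells *)

Section test_functions.
Context {R : realType} (T : R).
Hypothesis T_gt0 : 0 < T.
Implicit Types (n : nat) (rho : driving_measure T) (g : test_function T).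

Definition circle_point (x : R * R) : R * R * R := (cos x.1, sin x.1, x.2).

Lemma circle_point_continuous : continuous circle_point.
Proof.
move=> x.
have h1 : cos z.1 @[z --> x] --> cos x.1.
  by apply: (@continuous_comp _ _ _ fst cos); [exact: cvg_fst|exact: continuous_cos].
have h2 : sin z.1 @[z --> x] --> sin x.1.
  by apply: (@continuous_comp _ _ _ fst sin); [exact: cvg_fst|exact: continuous_sin].
have h3 : z.2 @[z --> x] --> x.2 by exact: cvg_snd.
exact: (cvg_pair (cvg_pair h1 h2) h3).
Qed.

(** Heine's theorem for the pullback of [g] to the rectangle of angles and times. The angle [2 * pi]
    is included for compactness, which the half-open cylinder lacks. *)
Lemma test_function_unif_continuous g (e : R) : 0 < e -> exists2 d : R, 0 < d &
  forall x y : R * R, (`[0, 2 * pi] `*` `[0, T]) x -> (`[0, 2 * pi] `*` `[0, T]) y ->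
    `|x.1 - y.1| < d -> `|x.2 - y.2| < d ->
    `|sval g (circle_point x) - sval g (circle_point y)| < e.
Proof.
move=> e0; set K : set (R * R) := _ `*` _.
have cK : compact K by apply: compact_setX; exact: segment_compact.
pose P (d : R) (x : R * R) := forall y, K y -> `|x.1 - y.1| < d -> `|x.2 - y.2| < d ->
    `|sval g (circle_point x) - sval g (circle_point y)| < e.
pose P' (d : R) (x : R * R) := K x -> P d x.
suff : \forall d \near 0^'+, K `<=` P' d.
  case => d /= d0 h; exists (d / 2); first by rewrite divr_gt0.
  move=> x y Kx Ky; apply: h => //.
  - by rewrite /ball/= sub0r normrN ger0_norm ?divr_ge0 ?ltW// gtr_pMr// invf_lt1// ltr1n.
  - by rewrite divr_gt0.
(* Near each point a ball and all small [d] work together; the covering form of compactness then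
   yields one [d] for the whole rectangle. *)
have /compact_near_coveringP cov := cK.
apply: (cov R 0^'+ P') => x Kx.
pose A : set (R * R * R) := unit_circle `*` `[0, T]%classic.
have KA z : K z -> A (circle_point z).
  by move=> [_ z2]; split; [rewrite /unit_circle/= cos2Dsin2|exact: z2].
have : \forall z \near x, A (circle_point z) ->
    `|sval g (circle_point x) - sval g (circle_point z)| < e / 2.
  have gx : sval g @ within A (nbhs (circle_point x)) --> sval g (circle_point x).
    by rewrite nbhs_subspace_in; [exact: svalP g _|exact: KA].
  have e2 : 0 < e / 2 by rewrite divr_gt0.
  move/cvgrPdist_lt : gx => /(_ _ e2).
  by move=> h; exact: (@circle_point_continuous x _ h).
move=> /nbhs_ballP[r /= r0 hr].
have r2 : 0 < r / 2 by rewrite divr_gt0.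
exists (ball x (r / 2), [set d | d < r / 2]).
  split => /=; first exact: nbhsx_ballx.
  exact: nbhs_right_lt.
move=> [x' d] /= [[x'1 x'2]]; move=> dr Kx' y Ky y1 y2.
have hx' : `|sval g (circle_point x) - sval g (circle_point x')| < e / 2.
  apply: hr; last exact: KA.
  by split; apply: le_ball; [|exact: x'1| |exact: x'2]; lra.
have hy : `|sval g (circle_point x) - sval g (circle_point y)| < e / 2.
  apply: hr; last exact: KA.
  rewrite /ball/= in x'1 x'2.
  have h a b c : `|a - b| < r / 2 -> `|b - c| < d -> `|a - c| < r.
    by move=> ab bc; apply: le_lt_trans (ler_distD b _ _) _; rewrite [ltRHS](splitr r) ltrD// (lt_trans bc).
  by split; [exact: h x'1 y1|exact: h x'2 y2].
rewrite (le_lt_trans (ler_distD (sval g (circle_point x)) _ _))// [ltRHS](splitr e).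
by rewrite ltrD// distrC.
Qed.


Lemma exists_pow2_gt (C d : R) : 0 < d -> exists n0, forall n, (n0 <= n)%N -> C / 2 ^+ n < d.
Proof.
move=> d0; exists (Num.truncn (C / d)).+1 => n hn.
rewrite ltr_pdivrMr ?exprn_gt0// -ltr_pdivrMl// mulrC.
apply: (lt_le_trans (truncnS_gt _)).
apply: (@le_trans _ _ n%:R); first by rewrite ler_nat.
by rewrite -natrX ler_nat ltnW// ltn_expl.
Qed.

Lemma test_function_cells g (e : R) : 0 < e -> exists n0, forall n, (n0 <= n)%N ->
  forall x y, cylinder T x -> cylinder T y -> cell_index T n x = cell_index T n y ->
  `|sval g (circle_point x) - sval g (circle_point y)| <= e.
Proof.
move=> /(test_function_unif_continuous g)[d d0 gd].
have [n1 h1] := exists_pow2_gt (2 * pi) d0.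
have [n2 h2] := exists_pow2_gt T d0.
exists (maxn n1 n2) => n; rewrite geq_max => /andP[/h1 n1n /h2 n2n] x y.
move=> -[]; rewrite /angles/= !in_itv/= => /andP[x0 x1] /andP[x2 x3].
move=> -[]; rewrite /angles/= !in_itv/= => /andP[y0 y1] /andP[y2 y3].
move=> -[e1 e2]; apply/ltW/gd.
- by split; rewrite /= in_itv/= ?x0 ?x2 ?(ltW x1).
- by split; rewrite /= in_itv/= ?y0 ?y2 ?(ltW y1).
- apply: le_lt_trans n1n; apply: dyadic_dist; first exact: twopi_gt0.
  + by rewrite x0 ltW.
  + by rewrite y0 ltW.
  + exact: val_inj.
- apply: le_lt_trans n2n; apply: dyadic_dist => //.
  + by rewrite x2.
  + by rewrite y2.
  + exact: val_inj.
Qed.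

Definition cell_point n (q : 'I_(2 ^ n) * 'I_(2 ^ n)) : R * R := xget (0, 0) (cell T q).

Lemma cell_pointP n x : cylinder T x ->
  cylinder T (cell_point (cell_index T n x)) /\
  cell_index T n (cell_point (cell_index T n x)) = cell_index T n x.
Proof.
by move=> Cx; have [] := @xgetPex _ (0, 0) (cell T (cell_index T n x)) (ex_intro _ x (conj Cx erefl)).
Qed.

(** Nothing is known of [g] off the circle times [[0, T]]. Measurability on the cylinder comes from
    pointwise approximation by functions constant on the cells. *)
Lemma measurable_test_function g :
  measurable_fun (cylinder T) (fun x => sval g (circle_point x)).
Proof.
pose h n (x : plane R) := sval g (circle_point (cell_point (cell_index T n x))).
have mh n : measurable_fun (cylinder T) (h n).
  apply: (measurable_step (fun n => @measurable_cell R T T_gt0 n)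
    (fun q => sval g (circle_point (cell_point q)))).
apply: (measurable_fun_cvg mh).
move=> x Cx; apply/cvgrPdist_le => e /(test_function_cells g)[n0 hn].
exists n0 => // n /= nn0; have [] := cell_pointP n Cx => C' E.
by apply: (hn n).
Qed.

(** The level and the constant depend on [g] alone. An oscillation [e / (2 * T)] inside cells costs
    [e / 2] for each of the two measures, both of mass [T]. *)
Lemma weak_eval_cells_dist g (e : R) : 0 < e -> exists n (M : R), 0 <= M /\
  forall rho rho' : driving_measure T,
    `|weak_eval rho g - weak_eval rho' g| <=
    e + M * \sum_q `|cell_mass rho q - cell_mass rho' (q : 'I_(2 ^ n) * 'I_(2 ^ n))|.
Proof.
move=> e0; pose e' := e / (2 * T).
have e'0 : 0 < e' by rewrite divr_gt0// mulr_gt0.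
have [n h] := test_function_cells g e'0.
pose gq (q : 'I_(2 ^ n) * 'I_(2 ^ n)) := sval g (circle_point (cell_point q)).
have approx r := @Rintegral_cells_dist _ _ T_gt0 r n _ gq e' (measurable_test_function g).
have gqe x : cylinder T x -> `|sval g (circle_point x) - gq (cell_index T n x)| <= e'.
  by move=> Cx; have [] := cell_pointP n Cx => C' E; apply: (h n).
pose M := \sum_q `|gq q|; exists n, M; split; first exact: sumr_ge0.
move=> r r'.
pose s (r : driving_measure T) := \sum_q gq q * cell_mass r q.
apply: (le_trans (ler_distD (s r) _ _)).
apply: (@le_trans _ _ (e' * T + (M * (\sum_q `|cell_mass r q - cell_mass r' q|) + e' * T))).
  apply: lerD; first exact: approx.
  apply: (le_trans (ler_distD (s r') _ _)); apply: lerD.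
    rewrite -sumrB mulr_sumr; apply: (le_trans (ler_norm_sum _ _ _)).
    apply: ler_sum => q _; rewrite -mulrBr normrM ler_wpM2r//.
    by rewrite /M (bigD1 q)//= lerDl sumr_ge0.
  by rewrite distrC; exact: approx.
have -> : e = e' * T + e' * T by rewrite /e'; field; rewrite gt_eqF.
lra.
Qed.

(** The converse fails: a measure carried by one angle, moved up to the side of a cell from below,
    converges weakly while the cell masses jump. *)
Lemma cvg_cell_mass (F : set_system (driving_measure T)) (FF : Filter F) rho :
  (forall n (q : 'I_(2 ^ n) * 'I_(2 ^ n)), cell_mass r q @[r --> F] --> cell_mass rho q) ->
  F --> rho.
Proof.
move=> Frho.
suff wc : (@weak_eval R T @ F) --> weak_eval rho.
  move=> A /= [_ [[B Bop <-] Brho sBA]].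
  have FB : (@weak_eval R T @ F) B by apply: wc; apply: open_nbhs_nbhs.
  by rewrite nbhs_filterE; apply: (filterS sBA).
apply/cvg_sup => g.
apply/cvg_image.
  rewrite eqEsubset; split => [y//|y _].
  by exists (fun=> y).
have wg : weak_eval r g @[r --> F] --> weak_eval rho g.
  apply/cvgrPdist_lt => e e0.
  have e2 : 0 < e / 2 by rewrite divr_gt0.
  have [n [M [M0 h]]] := weak_eval_cells_dist g e2.
  have : \sum_q `|cell_mass rho q - cell_mass r (q : 'I_(2 ^ n) * 'I_(2 ^ n))| @[r --> F] -->
      \sum_q `|cell_mass rho q - cell_mass rho (q : 'I_(2 ^ n) * 'I_(2 ^ n))|.
    by apply: cvg_sum => q; apply: cvg_norm; apply: cvgB; [exact: cvg_cst|exact: Frho].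
  under eq_bigr do rewrite subrr normr0.
  rewrite big1// => /cvgrPdist_lt.
  have M1 : 0 < e / 2 / (M + 1) by rewrite divr_gt0// ltr_wpDl.
  move=> /(_ _ M1); apply: filterS => r; rewrite sub0r normrN ger0_norm ?sumr_ge0// => hr.
  apply: le_lt_trans (h _ _) _; rewrite [ltRHS](splitr e) ltrD2l.
  apply: (@le_lt_trans _ _ ((M + 1) * \sum_q `|cell_mass rho q - cell_mass r (q : 'I_(2 ^ n) * 'I_(2 ^ n))|)).
    by rewrite ler_wpM2r ?sumr_ge0// lerDl.
  by rewrite mulrC -ltr_pdivlMr// ltr_wpDl.
move=> B /= wB; exists ((fun f : test_function T -> R => f g) @^-1` B); first exact: wg.
by rewrite image_preimage// eqEsubset; split => [y//|y _]; exists (fun=> y).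
Qed.

(** One integer bounds both the levels inspected and the radius, so that the balls decrease and form
    a countable filter base. *)
Definition cell_ball rho n : set (driving_measure T) :=
  [set r | forall m (q : 'I_(2 ^ m) * 'I_(2 ^ m)), (m <= n)%N ->
    `|cell_mass r q - cell_mass rho q| < n.+1%:R^-1].

(** Along the filter generated by the balls all cell masses converge to those of [rho], so this
    filter converges weakly to [rho]. *)
Lemma cell_ball_nbhs rho (O : set (driving_measure T)) : nbhs rho O ->
  exists n, cell_ball rho n `<=` O.
Proof.
move=> rO; pose F : set_system (driving_measure T) := filter_from setT (cell_ball rho).
have FF : Filter F.
  apply: filter_from_filter; first by exists 0%N.
  move=> i j _ _; exists (maxn i j) => // r hr.
  have le_inv (a b : nat) : (a <= b)%N -> b.+1%:R^-1 <= a.+1%:R^-1 :> R.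
    by move=> ab; rewrite lef_pV2 ?posrE// ler_nat.
  split => m q mi; (apply: lt_le_trans (hr m q _) (le_inv _ _ _); last first).
  - exact: leq_maxl.
  - by rewrite (leq_trans mi)// leq_maxl.
  - exact: leq_maxr.
  - by rewrite (leq_trans mi)// leq_maxr.
suff /(_ O rO)[n _ hn] : F --> rho by exists n.
apply: cvg_cell_mass => m q; apply/cvgrPdist_lt => e e0.
have [N hN] : exists N : nat, N.+1%:R^-1 < e.
  exists (Num.truncn e^-1); rewrite invf_plt ?posrE//; exact: truncnS_gt.
exists (maxn m N) => // r hr; rewrite distrC; apply: lt_trans hN.
apply: lt_le_trans (hr m q (leq_maxl _ _)) _.
by rewrite lef_pV2 ?posrE// ler_nat ltnS leq_maxr.
Qed.

End test_functions.

(** * The rate function *)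

Lemma exists_density_measure d (X : measurableType d) (R : realType)
    (mu : {measure set X -> \bar R}) (D : set X) (f : X -> R) (c : R) :
  measurable D -> 0 <= c -> measurable_fun D f -> (forall x, D x -> 0 <= f x) ->
  exists m : {measure set X -> \bar R}, forall A, measurable A ->
    (m A = c%:E * \int[mu]_(x in A `&` D) (f x)%:E)%E.
Proof.
move=> mD c0 mf f0.
pose nu (A : set X) := (c%:E * \int[mu]_(x in A `&` D) (f x)%:E)%E.
have nu0 : nu set0 = 0%E by rewrite /nu set0I integral_set0 mule0.
have nu_ge0 A : (0 <= nu A)%E.
  by rewrite mule_ge0 ?lee_fin//; apply: integral_ge0 => x [_ /f0]; rewrite lee_fin.
have nu_add : semi_sigma_additive nu.
  move=> F mF tF mUF; rewrite /nu setI_bigcupl ge0_integral_bigcup//=.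
  - rewrite -nneseriesZl; last first.
      by move=> k _; apply: integral_ge0 => x [_ /f0]; rewrite lee_fin.
    apply: is_cvg_nneseries => k _ _.
    by rewrite mule_ge0 ?lee_fin//; apply: integral_ge0 => x [_ /f0]; rewrite lee_fin.
  - by move=> k; exact: measurableI.
  - apply/measurable_EFinP; apply: measurable_funS mf => // x [k _ [_]]//.
  - by move=> x [k _ [_ /f0]]; rewrite lee_fin.
  - exact: trivIset_setIr.
pose m : {measure set X -> \bar R} :=
  HB.pack nu (isMeasure.Build _ _ _ nu nu0 nu_ge0 nu_add).
by exists m.
Qed.

Section grid_density.
Context {R : realType} (T : R).
Hypothesis T_gt0 : 0 < T.

Local Notation grid n := ('I_(2 ^ n) * 'I_(2 ^ n))%type.

(** [T / (2 ^+ n * 2 ^+ n)] is the mass of each cell for d theta dt / 2 pi. *)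
Definition grid_entropy n (y : grid n -> R) : R :=
  \sum_q y q * ln (y q / (T / (2 ^+ n * 2 ^+ n))).

Lemma dyadic_le n (b s t : R) : 0 < b -> s <= t -> (dyadic n b s <= dyadic n b t)%N.
Proof.
move=> b0 st /=; have : (Num.truncn (s / b * 2 ^+ n) <= Num.truncn (t / b * 2 ^+ n))%N.
  by apply: le_truncn; rewrite !ler_pM2r ?exprn_gt0 ?invr_gt0.
lia.
Qed.

(* Squeeze [0, s] between unions of dyadic time slabs. *)
Lemma driving_marginal_dyadic (m : {measure set (plane R) -> \bar R}) :
  (forall n (q : grid n), m (cell T q) \is a fin_num) ->
  (forall n (j : 'I_(2 ^ n)), \sum_(i < 2 ^ n) fine (m (cell T (i, j))) = T / 2 ^+ n) ->
  forall I : interval R, [set` I] `<=` `[0, T]%classic ->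
    m (angles `*` [set` I]) = lebesgue_measure [set` I].
Proof.
move=> mfin mT.
have cell_int n (G : grid n -> R) : (forall q, 0 <= G q) ->
    (\int[m]_(x in cylinder T) (G (cell_index T n x))%:E =
     (\sum_q G q * fine (m (cell T q)))%:E)%E.
  apply: (@integral_step _ _ _ m (cylinder T) (fun n => grid n) (cell_index T)
    (fun n q => fine (m (cell T q)))).
  - exact: measurable_cylinder.
  - exact: measurable_cell.
  - by move=> k q; rewrite fineK.
have slab n (k : nat) : (k <= 2 ^ n)%N ->
    m (cylinder T `&` [set x | (dyadic n T x.2 < k)%N]) = (k%:R * (T / 2 ^+ n))%:E.
  move=> kn; have := cell_int n (fun q => (q.2 < k)%N%:R) (fun=> ler0n _ _).
  have mS : measurable (cylinder T `&` [set x : plane R | (dyadic n T x.2 < k)%N]).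
    rewrite (_ : _ `&` _ = \bigcup_(q in [set q : grid n | (q.2 < k)%N]) cell T q).
      by apply: fin_bigcup_measurable => // q _; exact: measurable_cell.
    apply/seteqP; split => [x [Cx /= xk]|x [q /= qk [Cx /= xq]]].
      by exists (cell_index T n x).
    by split => //=; move: qk; rewrite -xq.
  rewrite (_ : \int[m]_(x in _) _ =
      \int[m]_(x in cylinder T) (\1_(cylinder T `&` [set x | (dyadic n T x.2 < k)%N]) x)%:E)%E; last first.
    apply: eq_integral => x; rewrite inE => Cx; rewrite indicE; congr (_%:R%:E).
    congr nat_of_bool; apply/idP/idP => [h|]; first by rewrite inE.
    by rewrite inE => -[].
  rewrite integral_indic//; last exact: measurable_cylinder.
  rewrite setIAC setIid => ->; congr (_%:E).
  rewrite (eq_bigr (fun q : grid n => if (q.2 < k)%N then fine (m (cell T (q.1, q.2))) else 0)); last first.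
    by move=> [q1 q2] _ /=; case: ifP; rewrite ?mul1r ?mul0r.
  rewrite -big_mkcond -(pair_big xpredT (fun q : 'I_(2 ^ n) => (q < k)%N)
    (fun i j => fine (m (cell T (i, j)))))/=.
  rewrite exchange_big/=; under eq_bigr do rewrite mT.
  by rewrite (big_ord_narrow kn) sumr_const card_ord mulr_natl.
have mM (B : set R) : measurable B -> measurable (angles `*` B : set (plane R)).
  by move=> mB; apply: measurableX => //; exact: measurable_itv.
have le_m (A B : set (plane R)) : measurable A -> measurable B -> A `<=` B -> (m A <= m B)%E.
  by move=> mA mB AB; apply: le_measure; rewrite ?inE.
have mslab n k : measurable (cylinder T `&` [set x : plane R | (dyadic n T x.2 < k)%N]).
  rewrite (_ : _ `&` _ = \bigcup_(q in [set q : grid n | (q.2 < k)%N]) cell T q).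
    by apply: fin_bigcup_measurable => // q _; exact: measurable_cell.
  apply/seteqP; split => [x [Cx /= xk]|x [q /= qk [Cx /= xq]]].
    by exists (cell_index T n x).
  by split => //=; move: qk; rewrite -xq.
have cumul b (s : R) : 0 <= s <= T ->
    m (angles `*` [set` Interval (BLeft 0) (BSide b s)]) = s%:E.
  move=> /andP[s0 sT].
  set C := angles `*` _.
  have mC : measurable C by apply: mM; exact: measurable_itv.
  have bd n : (m C <= (s + T / 2 ^+ n)%:E)%E /\ ((s - T / 2 ^+ n)%:E <= m C)%E.
    have jlt := ltn_ord (dyadic n T s).
    set j := nat_of_ord (dyadic n T s) in jlt.
    have /esym := @dyadicP _ n T s (dyadic n T s) true T_gt0 s0 sT.
    rewrite eqxx itv_boundlr => /andP[h1 h2]; rewrite bnd_simp -/j in h1.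
    have {}h2 : s <= j.+1%:R * T / 2 ^+ n.
      by move: h2; rewrite -/j; case: (_ && _); rewrite /= bnd_simp// => /ltW.
    split.
      apply: (@le_trans _ _ (j.+1%:R * (T / 2 ^+ n))%:E); last first.
        by rewrite lee_fin -natr1 mulrDl mul1r mulrA lerD2r.
      rewrite -slab//; apply: le_m => //.
      move=> x [/= x1]; rewrite itv_boundlr bnd_simp => /andP[x0 xs].
      have {}xs : x.2 <= s by move: xs; clear; case: b; rewrite /= bnd_simp// => /ltW.
      split; first by split => //=; rewrite in_itv/= x0 (le_trans xs).
      by rewrite /= ltnS; exact: dyadic_le.
    apply: (@le_trans _ _ (j%:R * (T / 2 ^+ n))%:E).
      by rewrite lee_fin lerBlDr mulrA -[X in _ + X]mul1r -mulrA -mulrDl natr1 mulrA.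
    rewrite -slab//; last exact: ltnW.
    apply: le_m => //.
    move=> x [[/= x1]]; rewrite in_itv/= => /andP[x0 xT] xj; split => //=.
    have xs : x.2 < s.
      by rewrite ltNge; apply/negP => /(dyadic_le n T_gt0); rewrite leqNgt xj.
    rewrite itv_boundlr bnd_simp x0/=; move: xs; clear; case: b; rewrite /= bnd_simp//; exact: ltW.
  have mfinite : m C \is a fin_num.
    have [u v] := bd 0%N; rewrite fin_numE; apply/andP; split.
      by rewrite gt_eqF// (lt_le_trans _ v)// ltNyr.
    by rewrite lt_eqF// (le_lt_trans u)// ltry.
  rewrite -(fineK mfinite); congr (_%:E); apply/eqP; rewrite -subr_eq0 -normr_le0.
  apply/ler_addgt0Pr => e e0; rewrite add0r.
  have [n hn] := exists_pow2_gt T e0.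
  have [u v] := bd n; rewrite -(fineK mfinite) lee_fin in u; rewrite -(fineK mfinite) lee_fin in v.
  rewrite (le_trans _ (ltW (hn n (leqnn _))))// ler_norml; apply/andP; split; lra.
move=> I IT.
have [->|/set0P[t It]] := eqVneq [set` I] set0.
  by rewrite setX0 !measure0.
(* Clipping the bounds to [[0, T]] rules out infinite ones without changing the set, so that the
   interval is a difference of two initial intervals. *)
have : exists l r, [set` I] = [set` Interval l r] /\ (BLeft 0 <= l)%O /\ (r <= BRight T)%O.
  case: I IT It => l r IT It; exists (l `|` BLeft 0)%O, (r `&` BRight T)%O.
  split; last by rewrite leUr leIr.
  have := set_itvI (Interval l r) `[0, T]; rewrite setIidl// => <-.
move=> [l [r [Ilr [l0 rT]]]]; rewrite Ilr in It *.
move: It => /=; rewrite itv_boundlr => /andP[lt tr].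
have ltr' : (l <= r)%O by rewrite (le_trans lt)// (le_trans _ tr)// bnd_simp.
case: l l0 lt ltr' Ilr => [bl x|[]]; [|by []|]; last first.
  by move=> _; case: (r) rT => [? ?|[]].
move=> l0 lt ltr'.
case: r rT tr ltr' => [br y|[]]; [|by []|]; last by case: (bl).
move=> rT tr ltr' _.
have x0 : 0 <= x by move: l0; case: (bl); rewrite bnd_simp// => /ltW.
have yT : y <= T by move: rT; case: (br); rewrite bnd_simp// => /ltW.
have xy : x <= y by move: ltr'; case: (bl); case: (br); rewrite bnd_simp// => /ltW.
have cx := cumul bl x; have cy := cumul br y.
rewrite x0 (le_trans xy yT) in cx; rewrite (le_trans x0 xy) yT in cy.
move: (cx isT) (cy isT) => {}cx {}cy.
have mitv (J : interval R) : measurable (angles `*` [set` J] : set (plane R)).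
  by apply: mM; exact: measurable_itv.
have UE : @angles R `*` [set` Interval (BLeft 0) (BSide br y)] =
    angles `*` [set` Interval (BLeft 0) (BSide bl x)] `|`
    angles `*` [set` Interval (BSide bl x) (BSide br y)].
  rewrite (itv_bndbnd_setU l0 ltr'); apply/seteqP; split.
    by move=> z [z1 [z2|z2]]; [left|right].
  by move=> z [[z1 z2]|[z1 z2]]; split => //; [left|right].
rewrite UE measureU// in cy; last first.
  apply/seteqP; split => // z [[_ /=]]; rewrite itv_boundlr => /andP[_ z1] [_ /=].
  by rewrite itv_boundlr => /andP[/(le_trans z1)]; rewrite bnd_simp ltxx.
rewrite [X in (X + _)%E](_ : _ = x%:E) in cy; last exact: cx.
rewrite lebesgue_measure_itv/= lte_fin.
have -> : m (angles `*` [set` Interval (BSide bl x) (BSide br y)]) = (y - x)%:E.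
  by rewrite EFinB -cy addeAC subee// add0e.
case: ltP => // yx; suff -> : y = x by rewrite subrr.
by apply/eqP; rewrite eq_le yx xy.
Qed.

End grid_density.

Lemma fmap_ultra (X Y : Type) (f : X -> Y) (F : set_system X) :
  UltraFilter F -> UltraFilter (f @ F).
Proof.
move=> FU; split; first exact: fmap_proper_filter.
move=> G GP FG; apply/seteqP; split => // A GA.
have [//|FnA] := in_ultra_setVsetC (f @^-1` A) FU.
by have /FG GnA : (f @ F) (~` A) by []; have [y []] := filter_ex (filterI GA GnA).
Qed.

Section limits.
Context {R : realType} (T : R).
Hypothesis T_gt0 : 0 < T.

Local Notation grid n := ('I_(2 ^ n) * 'I_(2 ^ n))%type.
Local Notation leb2 := (@lebesgue_measure R \x @lebesgue_measure R)%E.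

(** Additive cell masses need not come from a measure, as mass may escape through the missing sides
    of the cells; the entropy bound prevents it by providing a density. *)
Lemma grid_density (y : forall n, grid n -> R) (a : R) :
  (forall n q, 0 <= y n q) ->
  (forall n q, y n q = \sum_(q' | cell_parent q' == q) y n.+1 q') ->
  (forall n (j : 'I_(2 ^ n)), \sum_(i < 2 ^ n) y n (i, j) = T / 2 ^+ n) ->
  (forall n, grid_entropy T (y n) <= a) ->
  exists (rho : driving_measure T) f,
    [/\ is_density rho f, entropy_integrable T f,
      (entropy_integral T f <= a%:E)%E &
      forall n q, cell_mass rho q = y n q].
Proof.
move=> y0 yr yT ya.
have tp : 0 < 2 * pi :> R by exact: twopi_gt0.
pose l n (q : grid n) : R := 2 * pi / 2 ^+ n * (T / 2 ^+ n).
(* The reference is now plain Lebesgue measure. With masses multiplied by [2 * pi], the ratio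
   [v / l] is the one in [grid_entropy], and the entropy bound becomes [2 * pi * a]. *)
pose v n (q : grid n) : R := 2 * pi * y n q.
have l0 n q : 0 < l n q by rewrite mulr_gt0// divr_gt0// exprn_gt0.
have v0 n q : 0 <= v n q by rewrite mulr_ge0// ltW.
have vr n q : v n q = \sum_(q' | cell_parent q' == q) v n.+1 q'.
  by rewrite /v -mulr_sumr -yr.
have va n : step_entropy l v n <= 2 * pi * a.
  rewrite (le_trans _ (ler_wpM2l (ltW tp) (ya n)))// /step_entropy /grid_entropy mulr_sumr.
  apply: ler_sum => q _; rewrite /v -mulrA ler_wpM2l ?(ltW tp)// ler_wpM2l//.
  rewrite le_eqVlt; apply/orP; left; apply/eqP; congr ln; rewrite /l.
  have n0 : 2 ^+ n != 0 :> R by rewrite gt_eqF// exprn_gt0.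
  have p0 : pi != 0 :> R by rewrite gt_eqF// pi_gt0.
  by move: p0; generalize (pi : R) => P p0; field; rewrite n0 p0 gt_eqF.
have [f [mf f0 fint fi fle]] := @bounded_entropy_density _ _ _ leb2 (cylinder T)
  (fun n => grid n) (cell_index T) (@cell_parent) l v (measurable_cylinder T)
  (measurable_cell T_gt0) (cell_indexS T_gt0) (lebesgue_cell T_gt0) l0 v0 vr _ va.
have [m mE] := @exists_density_measure _ _ _ leb2 (cylinder T) f (2 * pi)^-1
  (measurable_cylinder T) (ltW (eqbRL (invr_gt0 _) tp)) mf (fun x _ => f0 x).
have mcell n (q : grid n) : m (cell T q) = (y n q)%:E.
  rewrite mE; last exact: measurable_cell.
  rewrite setIidl; last by move=> x [].
  by rewrite fint -EFinM /v mulrA mulVf ?gt_eqF// mul1r.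
have msupp : m (~` cylinder T) = 0%E.
  rewrite mE; last by apply: measurableC; exact: measurable_cylinder.
  by rewrite setICl integral_set0 mule0.
have mmarg : forall I : interval R, [set` I] `<=` `[0, T]%classic ->
    m (angles `*` [set` I]) = lebesgue_measure [set` I].
  apply: driving_marginal_dyadic => // [n q|n j]; first by rewrite mcell.
  by under eq_bigr do rewrite mcell/=.
exists (DrivingMeasure msupp mmarg), f; split.
- by split => // A mA; exact: mE.
- exact: fi.
- apply: (@le_trans _ _ ((2 * pi)^-1%:E * (2 * pi * a)%:E)%E).
    by apply: lee_wpmul2l; rewrite ?lee_fin ?invr_ge0 ?(ltW tp).
  by rewrite -EFinM mulrA mulVf ?gt_eqF// mul1r.
- by move=> n q; rewrite /cell_mass/= mcell.
Qed.

(** Cell masses lie in the compact [[0, T]], hence converge along an ultrafilter. Additivity and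
    time marginals are finite sums and pass to the limit; so does the entropy bound, by continuity
    of x ln x. *)
Lemma ultra_cvg_entropy (F : set_system (driving_measure T)) (a : R) :
  UltraFilter F ->
  (forall n, F [set rho | grid_entropy T (@cell_mass _ _ rho n) <= a]) ->
  exists (rho : driving_measure T) f, [/\ F --> rho,
    is_density rho f, entropy_integrable T f & (entropy_integral T f <= a%:E)%E].
Proof.
move=> FU Fa.
have lim_ex n (q : grid n) : exists l : R, cell_mass r q @[r --> F] --> l.
  have := @segment_compact R 0 T; rewrite compact_ultra.
  move=> /(_ ((fun r => cell_mass r q) @ F)) [].
  - exact: fmap_ultra.
  - apply: (@filterS _ F _ setT _ _ filterT) => r _ /=.
    by rewrite in_itv/= cell_mass_ge0 cell_mass_le.
  - by move=> l [_ hl]; exists l.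
pose y n (q : grid n) := sval (cid (lim_ex n q)).
have yP n (q : grid n) : cell_mass r q @[r --> F] --> y n q.
  by rewrite /y; case: cid.
have lim_eq (u : driving_measure T -> R) (l l' : R) : u @ F --> l -> u @ F --> l' -> l = l'.
  by move=> ul ul'; apply: (cvg_unique _ ul ul').
have [||||rho [f [df fi fa yE]]] := @grid_density y a.
- move=> n q; apply: (closed_cvg (fun x : R => 0 <= x) (@closed_ge _ _) _ _ (yP n q)).
  by apply: nearW => r; exact: cell_mass_ge0.
- move=> n q; apply: (lim_eq _ _ _ (yP n q)).
  rewrite (_ : (fun r => _) = (fun r => \sum_(q' | cell_parent q' == q) cell_mass r q')); last first.
    by apply/funext => r; exact: cell_mass_parent.
  by apply: cvg_sum => q'; exact: yP.
- move=> n j; apply: (lim_eq (fun r => \sum_(i < 2 ^ n) cell_mass r (i, j))).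
    by apply: cvg_sum => i; exact: yP.
  rewrite (_ : (fun r => _) = fun=> T / 2 ^+ n); first exact: cvg_cst.
  by apply/funext => r; exact: sum_cell_mass_time.
- move=> n; have Fn := Fa n.
  apply: (closed_cvg (fun x : R => x <= a) (@closed_le _ _) Fn).
  apply: xlnx_sum_cvg.
  + by move=> r q; exact: cell_mass_ge0.
  + move=> q; apply: (closed_cvg (fun x : R => 0 <= x) (@closed_ge _ _) _ _ (yP n q)).
    by apply: nearW => r; exact: cell_mass_ge0.
  + by move=> q; rewrite divr_gt0// mulr_gt0// exprn_gt0.
  + by move=> q; exact: yP.
exists rho; exists f; split => //.
apply: cvg_cell_mass => // n q; rewrite yE; exact: yP.
Qed.

End limits.

(** Integrate the tangent of x ln x at the mean value [y / c]. *)
Lemma jensen_xlnx d (X : measurableType d) (R : realType)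
    (mu : {measure set X -> \bar R}) (D : set X) (f : X -> R) (c y : R) :
  measurable D -> mu D = c%:E -> 0 < c -> measurable_fun D f ->
  (forall x, D x -> 0 <= f x) -> (\int[mu]_(x in D) (f x)%:E = y%:E)%E ->
  mu.-integrable D (fun x => (xlnx (f x))%:E) ->
  ((y * ln (y / c))%:E <= \int[mu]_(x in D) (xlnx (f x))%:E)%E.
Proof.
move=> mD muD c0 mf f0 fy fi.
have y0 : 0 <= y.
  by rewrite -lee_fin -fy; apply: integral_ge0 => x Dx; rewrite lee_fin f0.
have if_ : mu.-integrable D (EFin \o f).
  apply/integrableP; split; first exact/measurable_EFinP.
  rewrite (eq_integral (fun x => (f x)%:E)) ?fy ?ltry// => x.
  by rewrite inE => Dx; rewrite gee0_abs// lee_fin f0.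
have icst (s : R) : mu.-integrable D (fun=> s%:E).
  by apply: (@bounded_integrable _ _ _ _ _ (fun=> s) `|s|) => //; rewrite muD ltry.
have tangent s : 0 < s ->
    ((y * ln s + y - s * c)%:E <= \int[mu]_(x in D) (xlnx (f x))%:E)%E.
  move=> s0.
  have ig : mu.-integrable D (EFin \o (fun x => f x * ln s + f x)).
    apply: eq_integrable (integrableZl mD (ln s + 1) if_) => // x _.
    by rewrite /= -EFinM; congr (_%:E); ring.
  have -> : (y * ln s + y - s * c)%:E = (\int[mu]_(x in D) (f x * ln s + f x - s)%:E)%E.
    rewrite (integralB_EFin mD ig (icst s)) integral_cst// muD EFinB -EFinM.
    congr (_ - _)%E.
    rewrite (_ : (fun x => _) = (fun x => (ln s + 1)%:E * (f x)%:E)%E); last first.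
      by apply/funext => x; rewrite -EFinM; congr (_%:E); ring.
    by rewrite integralZl// fy -EFinM; congr (_%:E); ring.
  apply: le_integral => //; first exact: (integrableB mD ig (icst s)).
  by move=> x; rewrite inE => Dx; rewrite lee_fin xlnx_tangent// f0.
(* There is no tangent at 0. The tangent at [e / c] gives the lower bound [- e] instead, for every
   [e > 0]. *)
have [y_0|yn0] := eqVneq y 0.
  rewrite y_0 mul0r; have ffin := integrable_fin_num mD fi.
  rewrite -(fineK ffin) lee_fin -oppr_le0; apply/ler_addgt0Pr => e e0; rewrite add0r.
  have := tangent (e / c); rewrite divr_gt0// => /(_ isT).
  by rewrite -(fineK ffin) lee_fin y_0 mul0r !add0r divfK ?gt_eqF// lerNl.
have yp : 0 < y by rewrite lt_neqAle eq_sym yn0.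
apply: le_trans (tangent (y / c) (divr_gt0 yp c0)).
by rewrite lee_fin divfK ?gt_eqF// addrK.
Qed.

Lemma xlnx_convex (R : realType) (l x y : R) : 0 <= l <= 1 -> 0 <= x -> 0 <= y ->
  xlnx (l * x + (1 - l) * y) <= l * xlnx x + (1 - l) * xlnx y.
Proof.
move=> /andP[l0 l1] x0 y0; set z := l * x + (1 - l) * y.
have l1' : 0 <= 1 - l by rewrite subr_ge0.
have z0 : 0 <= z by rewrite addr_ge0 ?mulr_ge0.
have [z_0|zn0] := eqVneq z 0.
  have /eqP : z = 0 by [].
  rewrite paddr_eq0 ?mulr_ge0// !mulf_eq0 => /andP[h1 h2].
  rewrite z_0 {1}/xlnx mul0r.
  have -> : l * xlnx x = 0 by rewrite /xlnx; case/orP: h1 => /eqP ->; rewrite !(mul0r, mulr0).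
  have -> : (1 - l) * xlnx y = 0 by rewrite /xlnx; case/orP: h2 => /eqP ->; rewrite !(mul0r, mulr0).
  by rewrite addr0.
have zp : 0 < z by rewrite lt_neqAle eq_sym zn0.
have := lerD (ler_wpM2l l0 (xlnx_tangent x0 zp)) (ler_wpM2l l1' (xlnx_tangent y0 zp)).
apply: le_trans; rewrite le_eqVlt; apply/orP; left; apply/eqP.
rewrite /xlnx; transitivity ((l * x + (1 - l) * y) * ln z + (l * x + (1 - l) * y) - z); last by ring.
by rewrite -/z addrK.
Qed.

(** * The entropy of a driving measure and its convexity *)

Section entropy.
Context {R : realType} (T : R).
Hypothesis T_gt0 : 0 < T.
Implicit Types (rho : driving_measure T) (f g : plane R -> R).

Local Notation grid n := ('I_(2 ^ n) * 'I_(2 ^ n))%type.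
Local Notation leb2 := (@lebesgue_measure R \x @lebesgue_measure R)%E.

Let mC := @measurable_cylinder R T.
Let tp : 0 < 2 * pi :> R. Proof. exact: twopi_gt0. Qed.

Lemma lebesgue_cylinder : leb2 (cylinder T) = (2 * pi * T)%:E.
Proof.
rewrite product_measure1E; [|exact: measurable_itv|exact: measurable_itv].
rewrite EFinM; congr (_ * _)%E; (apply: etrans (lebesgue_measure_itv _) _; rewrite /= lte_fin).
  by rewrite tp EFinN sube0.
by rewrite T_gt0 EFinN sube0.
Qed.

Lemma density_integral rho f (A : set (plane R)) : is_density rho f -> measurable A ->
  A `<=` cylinder T ->
  (\int[leb2]_(x in A) (f x)%:E = (2 * pi)%:E * rho A)%E.
Proof.
move=> [mf f0 rf] mA AC; rewrite rf// setIidl// muleA -EFinM mulfV ?mul1e// gt_eqF//.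
Qed.

Lemma density_integrable rho f : is_density rho f ->
  leb2.-integrable (cylinder T) (EFin \o f).
Proof.
move=> df; have [mf f0 _] := df; apply/integrableP; split; first exact/measurable_EFinP.
rewrite (eq_integral (EFin \o f)); last first.
  by move=> x; rewrite inE => Dx; rewrite gee0_abs// lee_fin f0.
by rewrite (density_integral df)// driving_cylinder// -EFinM ltry.
Qed.

Lemma density_ae_unique rho f g : is_density rho f -> is_density rho g ->
  ae_eq leb2 (cylinder T) (EFin \o f) (EFin \o g).
Proof.
move=> df dg; apply: integral_ae_eq => //.
- exact: density_integrable df.
- by case: dg => mg _ _; exact/measurable_EFinP.
- by move=> E EC mE; rewrite (density_integral df mE EC) (density_integral dg mE EC).
Qed.

Lemma measurable_xlnx d (X : measurableType d) (D : set X) (h : X -> R) :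
  measurable_fun D h -> measurable_fun D (fun x => xlnx (h x)).
Proof.
move=> mh; apply: measurable_funM => //.
by apply: measurableT_comp mh; exact: measurable_ln.
Qed.

Lemma entropy_integral_unique rho f g : is_density rho f -> is_density rho g ->
  entropy_integral T f = entropy_integral T g.
Proof.
move=> df dg; congr (_ * _)%E; apply: ae_eq_integral => //.
- by case: df => mf _ _; apply/measurable_EFinP; exact: measurable_xlnx.
- by case: dg => mg _ _; apply/measurable_EFinP; exact: measurable_xlnx.
- by apply: filterS (density_ae_unique df dg) => x h /h [->].
Qed.

Lemma driving_entropyE rho f : is_density rho f -> entropy_integrable T f ->
  driving_entropy rho = entropy_integral T f.
Proof.
move=> df fi; rewrite /driving_entropy; case: pselect => [ex|[]]; last by exists f.
case: cid => g /= [dg gi]; exact: entropy_integral_unique dg df.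
Qed.

Lemma driving_entropy_fin rho : (driving_entropy rho < +oo)%E ->
  exists2 f, is_density rho f & entropy_integrable T f.
Proof.
rewrite /driving_entropy; case: pselect => [[f [df fi]] _|_]; last by rewrite ltxx.
by exists f.
Qed.

(** Mixtures and weak limits are known on measurable sets only, and two measures agreeing there may
    be distinct elements of the type. *)
Lemma driving_entropy_ext rho rho' : (forall A, measurable A -> rho A = rho' A) ->
  driving_entropy rho = driving_entropy rho'.
Proof.
have dE (r r' : driving_measure T) f : (forall A, measurable A -> r A = r' A) ->
    is_density r f -> is_density r' f.
  by move=> rr [mf f0 rf]; split => // A mA; rewrite -rr// rf.
move=> rr; have rr' A (mA : measurable A) : rho' A = rho A by rewrite rr.
rewrite {2}/driving_entropy; case: pselect => [ex|nex].
  by case: cid => f /= [df fi]; apply: driving_entropyE => //; exact: dE df.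
rewrite /driving_entropy; case: pselect => // -[f [df fi]].
by exfalso; apply: nex; exists f; split => //; exact: dE df.
Qed.

(** Jensen's inequality in each cell: averaging a density over the cells lowers its entropy. *)
Lemma grid_entropy_le rho f n : is_density rho f -> entropy_integrable T f ->
  ((grid_entropy T (@cell_mass _ _ rho n))%:E <= entropy_integral T f)%E.
Proof.
move=> df fi; have [mf f0 _] := df.
have mc := measurable_cell T_gt0.
have cover : cylinder T = \big[setU/set0]_(q <- index_enum (grid n)) cell T q.
  rewrite -bigcup_seq; apply/seteqP; split => [x Cx|x [q _ []]//].
  by exists (cell_index T n x) => //=; rewrite mem_index_enum.
have cC (q : grid n) : cell T q `<=` cylinder T by move=> x [].
rewrite /entropy_integral cover integral_bigsetU_EFin//=; last 3 first.
- by rewrite index_enum_uniq.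
- by move=> p q _ _ [x [[_ /= <-] [_ /= <-]]].
- by rewrite -cover; apply/measurable_EFinP; exact: measurable_xlnx.
apply: (@le_trans _ _ ((2 * pi)^-1%:E * \sum_(q : grid n)
    (2 * pi * (cell_mass rho q * ln (cell_mass rho q / (T / (2 ^+ n * 2 ^+ n)))))%:E)%E).
  by rewrite sumEFin -mulr_sumr -EFinM mulrA mulVf ?gt_eqF// mul1r.
apply: lee_wpmul2l; first by rewrite lee_fin invr_ge0 ltW.
apply: lee_sum => q _.
have n0 : 0 < 2 ^+ n :> R by rewrite exprn_gt0.
have p0 : 0 < pi :> R by exact: pi_gt0.
have := @jensen_xlnx _ _ _ leb2 (cell T q) f (2 * pi / 2 ^+ n * (T / 2 ^+ n)) (2 * pi * cell_mass rho q)
  (mc n q) (lebesgue_cell T_gt0 q).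
rewrite mulr_gt0 ?divr_gt0// => /(_ isT).
rewrite (_ : 2 * pi * cell_mass rho q / (2 * pi / 2 ^+ n * (T / 2 ^+ n)) =
  cell_mass rho q / (T / (2 ^+ n * 2 ^+ n))); last first.
  by move: p0; generalize (pi : R) => P p0; field; rewrite !gt_eqF.
rewrite mulrA; apply.
- exact: measurable_funS mf.
- by move=> x /cC /f0.
- by rewrite (density_integral df)// cell_massE// EFinM.
- exact: integrableS fi.
Qed.

Lemma driving_entropy_grid rho n (a : R) : (driving_entropy rho <= a%:E)%E ->
  grid_entropy T (@cell_mass _ _ rho n) <= a.
Proof.
move=> Ha; have [f df fi] := driving_entropy_fin (le_lt_trans Ha (ltry _)).
by rewrite -lee_fin (le_trans (grid_entropy_le n df fi))// -(driving_entropyE df fi).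
Qed.

(** Level 0 is enough: its single cell has mass [T] under both measures. *)
Lemma driving_entropy_ge0 rho : (0 <= driving_entropy rho)%E.
Proof.
have [->//|/eqP Hn] := eqVneq (driving_entropy rho) +oo%E.
have [f df fi] : exists2 f, is_density rho f & entropy_integrable T f.
  by apply: driving_entropy_fin; rewrite ltey; apply/eqP.
rewrite (driving_entropyE df fi); apply: le_trans (grid_entropy_le 0 df fi).
rewrite lee_fin /grid_entropy; set c := T / _.
have c0 : 0 < c by rewrite /c expr0 mulr1 divr1.
apply: (@le_trans _ _ (\sum_(q : grid 0) (cell_mass rho q - c))).
  by rewrite sumrB sum_cell_mass// sumr_const card_prod card_ord /c expr0 !mulr1 divr1 subrr.
apply: ler_sum => q _; have y0 := cell_mass_ge0 rho q.
have [->|yn0] := eqVneq (cell_mass rho q) 0; first by rewrite mul0r sub0r oppr_le0 ltW.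
have yp : 0 < cell_mass rho q by rewrite lt_neqAle eq_sym yn0.
by rewrite ln_div ?posrE// mulrBr lerBrDl addrA xlnx_tangent.
Qed.

Lemma convex_driving_entropy : convex_rate (@driving_entropy R T).
Proof.
move=> l r1 r2 r l01 rE.
(* At the end points one of the two measures has weight 0 and may have infinite entropy; [r] then
   agrees with the other one. *)
have [l_0|ln0] := eqVneq l 0.
  rewrite l_0 mul0e add0e subr0 mul1e (_ : driving_entropy r = driving_entropy r2)//.
  by apply: driving_entropy_ext => A mA; rewrite rE// l_0 mul0e add0e subr0 mul1e.
have [l_1|ln1] := eqVneq l 1.
  rewrite l_1 subrr mul0e adde0 mul1e (_ : driving_entropy r = driving_entropy r1)//.
  by apply: driving_entropy_ext => A mA; rewrite rE// l_1 subrr mul0e adde0 mul1e.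
have /andP[l0' l1'] := l01.
have l0 : 0 < l by rewrite lt_neqAle eq_sym ln0.
have l1 : 0 < 1 - l by rewrite subr_gt0 lt_neqAle ln1.
have [H1|/eqP H1] := eqVneq (driving_entropy r1) +oo%E.
  rewrite H1 gt0_muley ?lte_fin// addye ?leey//.
  by rewrite gt_eqF// (lt_le_trans ltNy0)// mule_ge0 ?lee_fin ?(ltW l1)// driving_entropy_ge0.
have [H2|/eqP H2] := eqVneq (driving_entropy r2) +oo%E.
  rewrite H2 [X in (_ + X)%E]gt0_muley ?lte_fin// addey ?leey//.
  by rewrite gt_eqF// (lt_le_trans ltNy0)// mule_ge0 ?lee_fin ?(ltW l0)// driving_entropy_ge0.
have [f1 df1 fi1] : exists2 f, is_density r1 f & entropy_integrable T f.
  by apply: driving_entropy_fin; rewrite ltey; apply/eqP.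
have [f2 df2 fi2] : exists2 f, is_density r2 f & entropy_integrable T f.
  by apply: driving_entropy_fin; rewrite ltey; apply/eqP.
have [mf1 f10 r1E] := df1; have [mf2 f20 r2E] := df2.
pose f x := l * f1 x + (1 - l) * f2 x.
have mf : measurable_fun (cylinder T) f.
  by apply: measurable_funD; apply: measurable_funM.
have f0 x : cylinder T x -> 0 <= f x.
  by move=> Cx; rewrite addr_ge0// mulr_ge0// ?(ltW l1)// ?f10// f20.
have df : is_density r f.
  split => // A mA; rewrite rE// r1E// r2E//.
  have mAC : measurable (A `&` cylinder T) by exact: measurableI.
  have mS (h : plane R -> R) : measurable_fun (cylinder T) h ->
      measurable_fun (A `&` cylinder T) (EFin \o h).
    by move=> mh; apply/measurable_EFinP; apply: measurable_funS mh => // x [].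
  have h0 (h : plane R -> R) : (forall x, cylinder T x -> 0 <= h x) ->
      forall x, (A `&` cylinder T) x -> (0 <= (h x)%:E)%E.
    by move=> hh x [_ /hh]; rewrite lee_fin.
  rewrite /f; under [in RHS]eq_integral do rewrite EFinD !EFinM.
  rewrite ge0_integralD//; last 4 first.
  - by move=> x Ax; apply: mule_ge0; [rewrite lee_fin|exact: (h0 _ f10 _ Ax)].
  - by apply: emeasurable_funM => //; exact: mS.
  - by move=> x Ax; apply: mule_ge0; [rewrite lee_fin ltW|exact: (h0 _ f20 _ Ax)].
  - by apply: emeasurable_funM => //; exact: mS.
  rewrite (ge0_integralZl leb2 mAC (mS _ mf1) (k := l%:E) (h0 _ f10)) ?lee_fin//.
  rewrite (ge0_integralZl leb2 mAC (mS _ mf2) (k := (1 - l)%:E) (h0 _ f20)) ?lee_fin ?(ltW l1)//.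
  have I1 : (0 <= l%:E * \int[leb2]_(x in A `&` cylinder T) (f1 x)%:E)%E.
    by apply: mule_ge0; [rewrite lee_fin|apply: integral_ge0; exact: (h0 _ f10)].
  have I2 : (0 <= (1 - l)%:E * \int[leb2]_(x in A `&` cylinder T) (f2 x)%:E)%E.
    by apply: mule_ge0; [rewrite lee_fin ltW|apply: integral_ge0; exact: (h0 _ f20)].
  rewrite [RHS]ge0_muleDr//.
  by congr (_ + _)%E; rewrite muleCA.
pose b x := l * xlnx (f1 x) + (1 - l) * xlnx (f2 x).
have ib : leb2.-integrable (cylinder T) (EFin \o b).
  have := integrableD mC (integrableZl mC l fi1) (integrableZl mC (1 - l) fi2).
  by apply: eq_integrable => // x _; rewrite /= -!EFinM -EFinD.
have fb x : cylinder T x -> xlnx (f x) <= b x.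
  by move=> Cx; apply: xlnx_convex => //; [exact: f10|exact: f20].
have i1 : leb2.-integrable (cylinder T) (EFin \o (fun=> 1)).
  have Cfin : (leb2 (cylinder T) < +oo)%E by rewrite lebesgue_cylinder ltry.
  by apply: (@bounded_integrable _ _ _ _ _ _ 1) => // x _; rewrite normr1.
(* x ln x of the mixture lies between -1 and the integrable [b], hence is at most [|b| + 1] in
   absolute value. *)
have fi : entropy_integrable T f.
  apply: (@le_integrable _ _ _ _ _ mC _ (fun x => `|b x|%:E + 1%:E)%E).
  - by apply/measurable_EFinP; exact: measurable_xlnx.
  - move=> x Cx; rewrite -EFinD /= lee_fin [leRHS]ger0_norm ?addr_ge0//.
    have h1 := fb x Cx; have h2 := xlnx_ge (f0 x Cx); have h3 := f0 x Cx; have h4 := ler_norm (b x).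
    rewrite -/(xlnx (f x)) ler_norml; apply/andP; split; last lra.
    have := normr_ge0 (b x); lra.
  - by apply: integrableD => //; exact: integrable_norm.
rewrite (driving_entropyE df fi) (driving_entropyE df1 fi1) (driving_entropyE df2 fi2).
rewrite /entropy_integral muleCA [X in (_ + X)%E]muleCA -muleDr//; last first.
  by apply: fin_num_adde_defl; apply: fin_numM => //; exact: (integrable_fin_num mC fi2).
apply: lee_wpmul2l; first by rewrite lee_fin invr_ge0 ltW.
rewrite -!integralZl// -integralD//; last 2 first.
- exact: integrableZl.
- exact: integrableZl.
apply: (le_integral mC fi (integrableD mC (integrableZl mC l fi1) (integrableZl mC (1 - l) fi2))).
by move=> x; rewrite inE => Cx; rewrite -!EFinM -EFinD lee_fin; exact: fb.
Qed.

End entropy.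

(** * Weak evaluations determine a measure on measurable sets *)

Lemma measurable_plane_rays (R : realType) :
  @measurable _ (plane R) =
  <<s [set A | exists a b : R, A = `]-oo, a[%classic `*` `]-oo, b[%classic] >>.
Proof.
set G := [set A | _]; apply/seteqP; split; last first.
  apply: smallest_sub; first exact: sigma_algebra_measurable.
  by move=> _ [a [b ->]]; apply: measurableX; exact: measurable_itv.
pose GT := g_sigma_algebraType G.
have setTE : [set: R] = \bigcup_(n : nat) `]-oo, n%:R[%classic.
  apply/esym/seteqP; split => // x _; exists (Num.truncn x).+1 => //=.
  by rewrite in_itv/= truncnS_gt.
have mfst : measurable_fun [set: GT] (fst : GT -> measurableTypeR R).
  apply: (measurability _ (RGenInftyO.measurableE R)) => _ [_ [a ->] <-].
  rewrite setTI (_ : _ @^-1` _ = \bigcup_(n : nat) (`]-oo, a[%classic `*` `]-oo, n%:R[%classic)).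
    by apply: bigcupT_measurable => n; apply: sub_sigma_algebra; exists a, n%:R.
  apply/seteqP; split => [x /= xa|x [n _ []]//].
  have [n _ xn] : (\bigcup_(n : nat) `]-oo, n%:R[%classic) x.2 by rewrite -setTE.
  by exists n.
have msnd : measurable_fun [set: GT] (snd : GT -> measurableTypeR R).
  apply: (measurability _ (RGenInftyO.measurableE R)) => _ [_ [a ->] <-].
  rewrite setTI (_ : _ @^-1` _ = \bigcup_(n : nat) (`]-oo, n%:R[%classic `*` `]-oo, a[%classic)).
    by apply: bigcupT_measurable => n; apply: sub_sigma_algebra; exists n%:R, a.
  apply/seteqP; split => [x /= xa|x [n _ []]//].
  have [n _ xn] : (\bigcup_(n : nat) `]-oo, n%:R[%classic) x.1 by rewrite -setTE.
  by exists n.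
apply: smallest_sub; first exact: smallest_sigma_algebra.
rewrite subUset; split => _ [B mB <-].
  by have := mfst measurableT B mB.
by have := msnd measurableT B mB.
Qed.

Section weak_uniqueness.
Context {R : realType} (T : R).
Hypothesis T_gt0 : 0 < T.
Variables rho rho' : driving_measure T.
Hypothesis weak_eq : forall g, weak_eval rho g = weak_eval rho' g.

Let mC := @measurable_cylinder R T.

Let pos_set (h : R * R * R -> R) : set (plane R) :=
  cylinder T `&` [set x | 0 < h (circle_point x)].

(** Continuous functions increasing with [k] to the indicator of the positive reals; they give the
    mass of any set where a continuous function is positive. *)
Let clamp (k : nat) (y : R) : R := Num.min 1 (k%:R * Num.max 0 y).

Let clamp_continuous k (h : R * R * R -> R) : continuous h ->
  continuous (fun z => clamp k (h z)).
Proof.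
move=> hc z.
have mc : {for z, continuous (fun z => k%:R * Num.max 0 (h z) : R^o)}.
  apply: (@continuousM _ _ (fun=> k%:R) (fun z => Num.max 0 (h z))); first exact: cvg_cst.
  by apply: (@continuous_max _ _ (fun=> 0) h); [exact: cvg_cst|exact: hc].
by apply: (@continuous_min _ _ (fun=> 1)) mc; exact: cvg_cst.
Qed.

Let clamp_bound k y : `|clamp k y| <= 1.
Proof.
rewrite ger0_norm; last by rewrite le_min ler01 mulr_ge0// le_max lexx.
by rewrite ge_min lexx.
Qed.

Let test k (h : R * R * R -> R) (hc : continuous h) : test_function T :=
  exist _ (fun z => clamp k (h z)) (continuous_subspaceT (@clamp_continuous k h hc)).

Let measurable_h (h : R * R * R -> R) (hc : continuous h) :
  measurable_fun (cylinder T) (fun x => h (circle_point x)).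
Proof.
have hg : {within unit_circle `*` `[0, T]%classic, continuous h}.
  exact: continuous_subspaceT.
exact: (measurable_test_function T_gt0 (exist _ h hg)).
Qed.

Lemma measurable_pos_set (h : R * R * R -> R) : continuous h -> measurable (pos_set h).
Proof.
move=> hc; have := measurable_h hc mC (measurable_itv `]0, +oo[).
congr (measurable _); apply/seteqP; split => x [Cx /=]; rewrite ?in_itv/= ?andbT => hx;
  by split => //=; rewrite in_itv/= andbT.
Qed.

Let cvg_pos_set (r : driving_measure T) (h : R * R * R -> R) (hc : continuous h) :
  weak_eval r (test k hc) @[k --> \oo] --> fine (r (pos_set h)).
Proof.
have fC : (r (cylinder T) < +oo)%E by rewrite driving_cylinder// ltry.
have mk k : measurable_fun (cylinder T) (fun x => clamp k (h (circle_point x))).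
  exact: (measurable_test_function T_gt0 (test k hc)).
have ik k : r.-integrable (cylinder T) (EFin \o (fun x => clamp k (h (circle_point x)))).
  by apply: (@bounded_integrable _ _ _ _ _ _ 1) => // x _; exact: clamp_bound.
have mS := measurable_pos_set hc.
have [|||||] := @dominated_convergence _ _ _ r (cylinder T) mC
  (fun k x => (clamp k (h (circle_point x)))%:E) (fun x => (\1_(pos_set h) x)%:E) (fun=> 1%:E).
- by move=> k; apply/measurable_EFinP.
- by apply/measurable_EFinP; exact: measurable_indic.
- apply: aeW => x Cx; apply: cvg_EFin; first exact: nearW.
  rewrite indicE; have [h0|h0] := ltP 0 (h (circle_point x)).
    rewrite mem_set//=.
    apply: cvg_near_cst; exists (Num.truncn (h (circle_point x))^-1).+1 => // k /= hk.
    rewrite /clamp (max_idPr (ltW h0)); apply/min_idPl.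
    rewrite -ler_pdivrMr// mul1r (le_trans (ltW (truncnS_gt _)))// ler_nat//.
  rewrite memNset/=; last by move=> [_ /=]; rewrite ltNge h0.
  apply: cvg_near_cst; apply: nearW => k.
  have e0 : Num.max 0 (h (circle_point x)) = 0 by apply/max_idPl.
  by rewrite /= /clamp e0 mulr0; apply/min_idPr.
- apply/integrableP; split; first exact: measurable_cst.
  by rewrite integral_cst// normr1 mul1e.
- by apply: aeW => x k _; rewrite lee_fin clamp_bound.
move=> _ _; rewrite integral_indic// setIAC setIid => h1.
have fin : r (pos_set h) \is a fin_num.
  rewrite ge0_fin_numE// (le_lt_trans _ fC)// le_measure ?inE//; by move=> x [].
rewrite -(fineK fin) in h1.
by move/fine_cvg : h1; apply.
Qed.

Lemma weak_eq_pos_set (h : R * R * R -> R) : continuous h -> rho (pos_set h) = rho' (pos_set h).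
Proof.
move=> hc.
have fin (r : driving_measure T) : r (pos_set h) \is a fin_num.
  rewrite ge0_fin_numE// (le_lt_trans _ (ltry T))// -(driving_cylinder T_gt0 r).
  by rewrite le_measure ?inE//; [exact: measurable_pos_set|move=> x []].
rewrite -(fineK (fin rho)) -(fineK (fin rho')); congr (_%:E).
have := @cvg_pos_set rho h hc; under eq_fun do rewrite weak_eq.
by move=> h1; apply: (cvg_unique _ h1 (@cvg_pos_set rho' h hc)).
Qed.

Let rho_fin (r : driving_measure T) (A : set (plane R)) : measurable A ->
  A `<=` cylinder T -> (r A < +oo)%E.
Proof.
move=> mA AC; rewrite (le_lt_trans _ (ltry T))// -(driving_cylinder T_gt0 r).
by rewrite le_measure ?inE.
Qed.

(* Continuous functions of (cos theta, sin theta, t). In the cylinder, the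
   quadrant {theta < a, t < b} is a Boolean combination of the sets where they
   are positive, a different one for a <= pi and for a > pi. *)
Let hT (b : R) (z : R * R * R) : R := b - z.2.
Let hS (b : R) (z : R * R * R) : R := Num.min (- z.1.2) (b - z.2).
Let hC (a b : R) (z : R * R * R) : R := Num.min (z.1.1 - a) (b - z.2).
Let hCS (a b : R) (z : R * R * R) : R := Num.min (z.1.1 - a) (Num.min (- z.1.2) (b - z.2)).
Let hSC (a b : R) (z : R * R * R) : R := Num.min (a - z.1.1) (Num.min (- z.1.2) (b - z.2)).

Let c1 : continuous (fun z : R * R * R => z.1.1).
Proof. by move=> z; apply: (@continuous_comp _ _ _ fst fst); exact: cvg_fst. Qed.

Let c2 : continuous (fun z : R * R * R => z.1.2).
Proof.
by move=> z; apply: (@continuous_comp _ _ _ fst snd); [exact: cvg_fst|exact: cvg_snd].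
Qed.

Let c3 : continuous (fun z : R * R * R => z.2).
Proof. by move=> z; exact: cvg_snd. Qed.

Let hT_continuous b : continuous (hT b).
Proof. by move=> z; apply: cvgB; [exact: cvg_cst|exact: c3]. Qed.

Let hS_continuous b : continuous (hS b).
Proof.
move=> z; apply: (@continuous_min _ _ (fun z : R * R * R => - z.1.2) (hT b)).
  by apply: cvgN; exact: c2.
exact: hT_continuous.
Qed.

Let hC_continuous a b : continuous (hC a b).
Proof.
move=> z; apply: (@continuous_min _ _ (fun z : R * R * R => z.1.1 - a) (hT b)).
  by apply: cvgB; [exact: c1|exact: cvg_cst].
exact: hT_continuous.
Qed.

Let hCS_continuous a b : continuous (hCS a b).
Proof.
move=> z; apply: (@continuous_min _ _ (fun z : R * R * R => z.1.1 - a) (hS b)).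
  by apply: cvgB; [exact: c1|exact: cvg_cst].
exact: hS_continuous.
Qed.

Let hSC_continuous a b : continuous (hSC a b).
Proof.
move=> z; apply: (@continuous_min _ _ (fun z : R * R * R => a - z.1.1) (hS b)).
  by apply: cvgB; [exact: cvg_cst|exact: c1].
exact: hS_continuous.
Qed.

Let sin_lt0 (x : R) : 0 <= x < 2 * pi -> (sin x < 0) = (pi < x).
Proof.
move=> /andP[x0 x2]; have [xpi|xpi] := leP x pi.
  by apply/negbTE; rewrite -leNgt sin_ge0_pi// x0.
rewrite -(subrK pi x) sinDpi oppr_lt0 sin_gt0_pi// subr_gt0 xpi/= ltrBlDr.
by rewrite -mulr2n -mulr_natl.
Qed.

Let cos_gt (x a : R) : 0 <= x <= pi -> 0 <= a <= pi -> (cos a < cos x) = (x < a).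
Proof. by move=> x0 a0; rewrite ltr_cos ?in_itv. Qed.

Let cos_lt (x a : R) : pi < x < 2 * pi -> pi < a < 2 * pi -> (cos x < cos a) = (x < a).
Proof.
have h (y : R) : pi < y < 2 * pi -> cos y = - cos (y - pi) /\ 0 <= y - pi <= pi.
  move=> /andP[y1 y2]; split; first by rewrite -{1}(subrK pi y) cosDpi.
  by rewrite subr_ge0 ltW//= lerBlDr -mulr2n -mulr_natl ltW.
move=> /h[-> hx] /h[-> ha]; rewrite ltrN2 cos_gt//.
by rewrite ltrD2r.
Qed.

Lemma weak_eq_rectangle (a b : R) :
  rho (`]-oo, a[%classic `*` `]-oo, b[%classic) =
  rho' (`]-oo, a[%classic `*` `]-oo, b[%classic).
Proof.
set S : set (plane R) := _ `*` _.
have mS : measurable S by apply: measurableX; exact: measurable_itv.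
have restr (r : driving_measure T) : r S = r (cylinder T `&` S).
  have SD0 : r (S `\` cylinder T) = 0%E.
    have mD : measurable (S `\` cylinder T) by exact: measurableD.
    apply: (subset_measure0 mD (measurableC mC)); last exact: driving_support.
    by move=> x [].
  rewrite (measureDI r mS mC).
  by rewrite [X in (X + _)%E]SD0 add0e setIC.
rewrite !restr.
have pos (h : R * R * R -> R) (hc : continuous h) : rho (pos_set h) = rho' (pos_set h).
  exact: weak_eq_pos_set.
have mp := measurable_pos_set.
have pC h : pos_set h `<=` cylinder T by move=> x [].
have inS x : S x <-> x.1 < a /\ x.2 < b by rewrite /S /= !in_itv/=.
have [a0|a0] := leP a 0.
  rewrite (_ : _ `&` _ = set0) ?measure0//; apply/seteqP; split => // x [[/= + _] /inS[xa _]].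
  by rewrite /angles/= in_itv/= => /andP[x0 _]; move: (le_lt_trans x0 xa); rewrite ltNge a0.
have [a2|a2] := leP (2 * pi) a.
  rewrite (_ : _ `&` _ = pos_set (hT b)); first exact: pos.
  apply/seteqP; split => x [Cx].
    by move=> /inS[_ xb]; split => //=; rewrite /hT/= subr_gt0.
  rewrite /hT/= subr_gt0 => xb; split => //; apply/inS; split => //.
  by case: Cx => /= + _; rewrite /angles/= in_itv/= => /andP[_ /lt_le_trans]; apply.
(* For [0 < a <= pi], the condition [cos a < cos theta] selects the angles below [a] and their
   mirror images above [2 * pi - a]; the latter have negative sine and are removed. *)
have [api|api] := leP a pi.
  rewrite (_ : _ `&` _ = pos_set (hC (cos a) b) `\` pos_set (hCS (cos a) b)).
    rewrite !measureD ?rho_fin//; do 1?exact: mp.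
    rewrite setIidr; last first.
      by move=> x [Cx]; rewrite /hC /hCS /= !lt_min => /and3P[h1 h2 h3]; split => //=; rewrite lt_min h1.
    by congr (_ - _)%E; exact: pos.
  apply/seteqP; split => x.
    move=> [[/= x1 x2] /inS[xa xb]]; move: (x1); rewrite /angles/= in_itv/= => /andP[x0 x2p].
    have xpi : x.1 <= pi by rewrite (le_trans (ltW xa)).
    split.
      split => //=; rewrite /hC/= lt_min !subr_gt0 xb andbT cos_gt//; first by rewrite x0.
      by rewrite ltW.
    by move=> [_]; rewrite /hCS /= !lt_min oppr_gt0 sin_lt0 ?x0// [pi < _]ltNge xpi andbF.
  move=> [[[/= x1 x2]]]; rewrite /hC/= lt_min !subr_gt0 => /andP[xa xb].
  move=> nh; split => //; apply/inS; split => //.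
  move: (x1); rewrite /angles/= in_itv/= => /andP[x0 x2p].
  have xpi : x.1 <= pi.
    rewrite leNgt; apply/negP => pix; apply: nh; split => //=.
    by rewrite /hCS/= !lt_min !subr_gt0 xa xb oppr_gt0 sin_lt0 ?x0// pix.
  by move: xa; rewrite cos_gt ?x0// ltW.
(* For [pi < a < 2 * pi], an angle below [a] either is at most [pi], where the sine is nonnegative,
   or has negative sine and cosine below [cos a], the cosine increasing there. *)
rewrite (_ : _ `&` _ = (pos_set (hT b) `\` pos_set (hS b)) `|` pos_set (hSC (cos a) b)).
  rewrite !measureU; do ?[exact: mp|apply: measurableD; exact: mp].
  + rewrite !measureD ?rho_fin//; do 1?exact: mp.
    rewrite setIidr; last first.
      by move=> x [Cx]; rewrite /hS /hT /= !lt_min => /andP[h1 h2]; split.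
    by congr (_ - _ + _)%E; exact: pos.
  + apply/seteqP; split => // x [[_ nS]] [Cx]; rewrite /hSC/= !lt_min => /and3P[_ h1 h2].
    by apply: nS; split => //=; rewrite /hS lt_min h1.
  + apply/seteqP; split => // x [[_ nS]] [Cx]; rewrite /hSC/= !lt_min => /and3P[_ h1 h2].
    by apply: nS; split => //=; rewrite /hS lt_min h1.
apply/seteqP; split => x.
  move=> [[/= x1 x2] /inS[xa xb]]; move: (x1); rewrite /angles/= in_itv/= => /andP[x0 x2p].
  have [xpi|xpi] := leP x.1 pi; [left|right].
    split; first by split => //=; rewrite /hT subr_gt0.
    by move=> [_]; rewrite /hS/= lt_min oppr_gt0 sin_lt0 ?x0// [pi < _]ltNge xpi.
  split => //=; rewrite /hSC/= !lt_min !subr_gt0 xb oppr_gt0 sin_lt0 ?x0// xpi/= andbT.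
  by rewrite cos_lt ?xpi ?api.
move=> [[[[/= x1 x2]]]|[[/= x1 x2]]]; move: (x1); rewrite /angles/= in_itv/= => /andP[x0 x2p].
  rewrite /hT/= subr_gt0 => xb nS; split => //; apply/inS; split => //.
  rewrite (le_lt_trans _ api)// leNgt; apply/negP => pix; apply: nS; split => //=.
  by rewrite /hS/= lt_min subr_gt0 xb oppr_gt0 sin_lt0 ?x0// pix.
rewrite /hSC/= !lt_min !subr_gt0 oppr_gt0 sin_lt0 ?x0// => /and3P[xa xpi xb].
by split => //; apply/inS; split => //; move: xa; rewrite cos_lt ?xpi ?api.
Qed.

Lemma weak_eq_measure (A : set (plane R)) : measurable A -> rho A = rho' A.
Proof.
pose g (n : nat) : set (plane R) := `]-oo, n%:R[%classic `*` `]-oo, n%:R[%classic.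
apply: (@measure_unique _ R (plane R) _ g (measurable_plane_rays R)).
- move=> _ _ [a [b ->]] [a' [b' ->]]; exists (Num.min a a'), (Num.min b b').
  by apply/seteqP; split => x; rewrite /= !in_itv/= !lt_min => -[];
    [move=> [-> ->] [-> ->]|move=> /andP[-> ->] /andP[-> ->]].
- by move=> n; exists n%:R, n%:R.
- apply/seteqP; split => // x _; exists (Num.truncn (Num.max x.1 x.2)).+1 => //=.
  rewrite /g/= !in_itv/=; split; apply: le_lt_trans (truncnS_gt _); by rewrite le_max lexx ?orbT.
- by move=> _ [a [b ->]]; exact: weak_eq_rectangle.
- move=> n; set S := g n.
  have mS : measurable S by apply: measurableX; exact: measurable_itv.
  rewrite (measureDI rho mS mC).
  rewrite [X in (X + _)%E](_ : _ = 0%E); last first.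
    have mD : measurable (S `\` cylinder T) by exact: measurableD.
    apply: (subset_measure0 mD (measurableC mC)); last exact: driving_support.
    by move=> x [].
  rewrite add0e rho_fin//; exact: measurableI.
Qed.

End weak_uniqueness.

(** * Compact level sets, lower semicontinuity, and reduction to a finite level *)

Section good_rate_function.
Context {R : realType} (T : R).
Hypothesis T_gt0 : 0 < T.

Local Notation grid n := ('I_(2 ^ n) * 'I_(2 ^ n))%type.

Lemma grid_entropy_refine (rho : driving_measure T) n m : (n <= m)%N ->
  grid_entropy T (@cell_mass _ _ rho n) <= grid_entropy T (@cell_mass _ _ rho m).
Proof.
move=> nm; have tp : 0 < 2 * pi :> R by exact: twopi_gt0.
pose l n (q : grid n) : R := 2 * pi / 2 ^+ n * (T / 2 ^+ n).
pose v n (q : grid n) : R := 2 * pi * cell_mass rho q.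
have l0 k q : 0 < l k q by rewrite mulr_gt0// divr_gt0// exprn_gt0.
have v0 k q : 0 <= v k q by rewrite mulr_ge0 ?cell_mass_ge0// ltW.
have vr k q : v k q = \sum_(q' | cell_parent q' == q) v k.+1 q'.
  by rewrite /v -mulr_sumr -cell_mass_parent.
have E k : step_entropy l v k = 2 * pi * grid_entropy T (@cell_mass _ _ rho k).
  rewrite /step_entropy /grid_entropy mulr_sumr; apply: eq_bigr => q _.
  rewrite /v -!mulrA; congr (_ * (_ * (_ * ln _))); rewrite /l.
  have n0 : 2 ^+ k != 0 :> R by rewrite gt_eqF// exprn_gt0.
  have p0 : pi != 0 :> R by rewrite gt_eqF// pi_gt0.
  by move: p0; generalize (pi : R) => P p0; field; rewrite n0 p0 gt_eqF.
have := @step_entropy_le _ _ _ _ (cylinder T) (fun n => grid n) (cell_index T)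
  (@cell_parent) l v (measurable_cylinder T) (measurable_cell T_gt0)
  (cell_indexS T_gt0) (lebesgue_cell T_gt0) l0 v0 vr (m - n) n.
by rewrite subnK// !E ler_pM2l.
Qed.

Lemma cvg_weak_eval (F : set_system (driving_measure T)) (FF : Filter F)
    (rho : driving_measure T) (g : test_function T) :
  F --> rho -> weak_eval r g @[r --> F] --> weak_eval rho g.
Proof.
move=> Fr.
have h : {for rho, continuous (@weak_eval R T)} by exact: initial_continuous.
have p := @proj_continuous (test_function T) (fun=> R) g (weak_eval rho).
have c : {for rho, continuous (fun r : driving_measure T => weak_eval r g)}.
  exact: (continuous_comp h p).
by apply: (cvg_trans (cvg_app (fun r : driving_measure T => weak_eval r g) Fr)); exact: c.
Qed.

(** Stands in for the Hausdorff property, which can only hold up to the values on non-measurable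
    sets. *)
Lemma cvg_driving_unique (F : set_system (driving_measure T)) (FF : ProperFilter F)
    (rho rho' : driving_measure T) (A : set (plane R)) :
  F --> rho -> F --> rho' -> measurable A -> rho A = rho' A.
Proof.
move=> h h' mA; apply: weak_eq_measure => // g.
pose we (r : driving_measure T) : R := weak_eval r g.
have h1 : we r @[r --> F] --> we rho by exact: cvg_weak_eval.
have h2 : we r @[r --> F] --> we rho' by exact: cvg_weak_eval.
by apply: (cvg_unique _ h1 h2).
Qed.

Lemma entropy_ultra (F : set_system (driving_measure T)) (a : R) : UltraFilter F ->
  (forall n, F [set rho | grid_entropy T (@cell_mass _ _ rho n) <= a]) ->
  exists2 rho, F --> rho & (driving_entropy rho <= a%:E)%E.
Proof.
move=> FU /(ultra_cvg_entropy T_gt0 FU)[rho [f [Frho df fi fa]]].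
by exists rho => //; rewrite (driving_entropyE T_gt0 df fi).
Qed.

Lemma entropy_level_ultra (F : set_system (driving_measure T)) (a : R) : UltraFilter F ->
  F [set rho | (driving_entropy rho <= a%:E)%E] ->
  exists2 rho, F --> rho & (driving_entropy rho <= a%:E)%E.
Proof.
move=> FU Fa; apply: entropy_ultra => n; apply: filterS Fa => rho.
exact: driving_entropy_grid.
Qed.

(** Every ultrafilter on a level set converges inside it, which is compactness. If lower
    semicontinuity failed at [rho], the neighbourhoods of [rho] would meet the level set; an
    ultrafilter refining their traces has a limit of entropy at most [a], equal to [rho] on
    measurable sets. *)
Lemma good_driving_entropy : good_rate (@driving_entropy R T).
Proof.
split; first exact: driving_entropy_ge0.
- move=> rho a Ha; apply: contrapT => noV.
  pose F := within [set r : driving_measure T | (driving_entropy r <= a%:E)%E] (nbhs rho).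
  have FP : ProperFilter F.
    split; last exact: within_filter.
    move=> F0; apply: noV.
    exists (~` [set r : driving_measure T | (driving_entropy r <= a%:E)%E]).
      exact: F0.
    by move=> r /= /negP; rewrite -ltNge.
  have [G [GU FG]] := ultraFilterLemma FP.
  have Ga : G [set r : driving_measure T | (driving_entropy r <= a%:E)%E].
    by apply: FG; exact: withinT.
  have [rho' Grho' Ha'] := entropy_level_ultra GU Ga.
  have Grho : G --> rho.
    by move=> A rA; apply: FG; exact: cvg_within rA.
  have := Ha; rewrite (@driving_entropy_ext _ _ T_gt0 rho rho'); first by rewrite ltNge Ha'.
  by move=> A mA; exact: (cvg_driving_unique _ Grho Grho').
- move=> a; rewrite compact_ultra => F FU Fa.
  by have [rho Frho Hrho] := entropy_level_ultra FU Fa; exists rho.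
Qed.

(* Otherwise the sets {rho in C | grid entropy at level n <= a} form a decreasing
   sequence of nonempty sets; a limit point of it would be in C, with entropy at
   most a. *)
Lemma closed_grid_entropy (C : set (driving_measure T)) (a : R) : closed C ->
  (a%:E < ereal_inf (@driving_entropy R T @` C))%E ->
  exists n, forall rho, C rho -> a < grid_entropy T (@cell_mass _ _ rho n).
Proof.
move=> cC aC; apply: contrapT => /forallNP noN.
pose B n := [set rho | C rho /\ grid_entropy T (@cell_mass _ _ rho n) <= a].
have Bdec n m : (n <= m)%N -> B m `<=` B n.
  by move=> nm r [Cr hr]; split => //; apply: le_trans hr; exact: grid_entropy_refine.
have Bn0 n : B n !=set0.
  have /existsNP[rho /not_implyP[Crho /negP]] := noN n.
  by rewrite -leNgt => h; exists rho.
pose F : set_system (driving_measure T) := filter_from setT B.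
have FP : ProperFilter F.
  apply: filter_from_proper; last by move=> n _; exact: Bn0.
  apply: filter_from_filter; first by exists 0%N.
  move=> i j _ _; exists (maxn i j) => //; rewrite subsetI; split; apply: Bdec.
    exact: leq_maxl.
  exact: leq_maxr.
have [G [GU FG]] := ultraFilterLemma FP.
have [rho Grho Hrho] : exists2 rho, G --> rho & (driving_entropy rho <= a%:E)%E.
  by apply: entropy_ultra => n; apply: FG; exists n => // r [].
have Crho : C rho.
  apply: cC => V rV.
  have GC : G C by apply: FG; exists 0%N => // r [].
  by have [r [Vr Cr]] := filter_ex (filterI (Grho V rV) GC); exists r.
have : (ereal_inf (@driving_entropy R T @` C) <= driving_entropy rho)%E.
  by apply: ereal_inf_lbound; exists rho.
by move=> /(lt_le_trans aC); rewrite ltNge Hrho.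
Qed.

End good_rate_function.

(** * Slit measures and words *)

Definition slit_time {R : realType} (T c : R) n (k : nat) (j : 'I_(2 ^ n)) : R :=
  fine (lebesgue_measure (slit_interval c k `&` [set` dyadic_itv T true j])).

Section slit_cells.
Context {R : realType} (T c : R).
Hypotheses (T_gt0 : 0 < T) (c_gt0 : 0 < c).
Variables (th : nat -> R) (thS : forall k, th k \in `[0, 2 * pi[) (n K : nat).
Hypothesis TK : T < K%:R * c.
Hypothesis KT : K.-1%:R * c <= T.

Local Notation grid n := ('I_(2 ^ n) * 'I_(2 ^ n))%type.

Let lebesgue_slit k : lebesgue_measure (slit_interval c k) = c%:E.
Proof.
rewrite lebesgue_measure_itv/= lte_fin ltr_pM2r// ltr_nat ltnSn -EFinB.
by congr (_%:E); rewrite -natr1; ring.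
Qed.

Let mslit k : measurable (slit_interval c k). Proof. exact: measurable_itv. Qed.

Let mJ (j : 'I_(2 ^ n)) : measurable [set` dyadic_itv T true j].
Proof. exact: measurable_itv. Qed.

Let slit_timeE k (j : 'I_(2 ^ n)) :
  lebesgue_measure (slit_interval c k `&` [set` dyadic_itv T true j]) = (slit_time T c k j)%:E.
Proof.
rewrite fineK// ge0_fin_numE// (le_lt_trans _ (ltry c))// -(lebesgue_slit k).
by apply: le_measure; rewrite ?inE; [exact: (measurableI _ _ (mslit k) (mJ j))|exact: mslit|move=> t []].
Qed.

Let slit_time_bound k (j : 'I_(2 ^ n)) : 0 <= slit_time T c k j <= c.
Proof.
apply/andP; split; first exact: fine_ge0.
rewrite -lee_fin -slit_timeE -(lebesgue_slit k).
by apply: le_measure; rewrite ?inE; [exact: (measurableI _ _ (mslit k) (mJ j))|exact: mslit|move=> t []].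
Qed.

(** Slits from number [K] on start after [T], so the series stops; the last slit kept may be cut by
    [T], which [slit_time] takes into account. *)
Lemma slit_cell (c0 : 0 < c) (q : grid n) :
  cell_mass (slit_measure T c0 thS) q =
  \sum_(k < K) (dyadic n (2 * pi) (th k) == q.1)%:R * slit_time T c k q.2.
Proof.
rewrite /cell_mass /=.
transitivity (fine (\sum_(k <oo) ((dyadic n (2 * pi) (th k) == q.1)%:R * slit_time T c k q.2)%:E)%E); last first.
  have zero k : (K <= k)%N -> slit_time T c k q.2 = 0.
    move=> Kk; rewrite /slit_time (_ : _ `&` _ = set0) ?measure0//.
    apply/seteqP; split => // t [+ tJ].
    rewrite /slit_interval/= in_itv/= => /andP[kt _]; have := @dyadic_itv_sub _ n T true q.2 T_gt0 t tJ; rewrite /= in_itv/= => /andP[_].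
    by rewrite leNgt (lt_le_trans TK)// (le_trans _ kt)// ler_pM2r// ler_nat.
  rewrite (nneseries_split _ K); last first.
    by move=> k _; rewrite lee_fin mulr_ge0//; have /andP[] := slit_time_bound k q.2.
  rewrite add0n eseries0 ?adde0; last first.
    by move=> k Kk _; rewrite zero// mulr0.
  by rewrite sumEFin/= big_mkord.
congr fine; rewrite /slit_fun.
transitivity (\int[lebesgue_measure]_(t in `[0%R, T]%classic) \sum_(k <oo)
   ((dyadic n (2 * pi) (th k) == q.1)%:R * \1_(slit_interval c k `&` [set` dyadic_itv T true q.2]) t)%:E)%E.
  apply: eq_integral => t; rewrite inE/= in_itv/= => /andP[t0 tT].
  apply: eq_eseriesr => k _.
  rewrite diracE (_ : (th k \in ysection (cell T q) t) =
    (dyadic n (2 * pi) (th k) == q.1) && (t \in [set` dyadic_itv T true q.2])); last first.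
    have /andP[th0 th2] := thS k.
    rewrite (dyadicP _ (closed := false))//; last exact: twopi_gt0.
    by rewrite mem_ysection; apply/idP/andP; rewrite !inE cellE.
  rewrite -EFinM !indicE in_setI; congr (_%:E).
  by case: (_ == _); case: (t \in slit_interval c k); case: (t \in [set` _]); rewrite ?(mul0r, mulr0, mul1r).
rewrite integral_nneseries//; last first.
  move=> k; apply/measurable_EFinP; apply: measurable_funM => //.
  by apply: measurable_indic; exact: (measurableI _ _ (mslit k) (mJ _)).
apply: eq_eseriesr => k _.
under eq_integral do rewrite EFinM.
rewrite ge0_integralZl//; last first.
  by apply/measurable_EFinP; apply: measurable_indic; exact: (measurableI _ _ (mslit k) (mJ _)).
rewrite integral_indic//; last exact: (measurableI _ _ (mslit k) (mJ _)).
rewrite setIidl; last first.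
  by move=> t [_ tJ]; exact: (@dyadic_itv_sub _ n T true q.2 T_gt0 t tJ).
by rewrite [RHS]EFinM; congr (_ * _)%E; exact: slit_timeE.
Qed.

(** A slit is credited in full to the slab of its starting time. The error is at most [c], and is
    zero unless the slit contains an end of slab [j]; the two indicators single out the slits
    containing these ends. *)
Lemma slit_time_dist (k : nat) (j : 'I_(2 ^ n)) : (k < K)%N ->
  `|slit_time T c k j - c * (dyadic n T (k%:R * c) == j)%:R| <=
  c * (k == Num.truncn (j%:R * T / 2 ^+ n / c))%:R +
  c * (k == Num.truncn (j.+1%:R * T / 2 ^+ n / c))%:R.
Proof.
move=> kK; have /andP[s0 sc] := slit_time_bound k j.
set al := j%:R * T / 2 ^+ n; set be := j.+1%:R * T / 2 ^+ n.
have kc0 : 0 <= k%:R * c by rewrite mulr_ge0// ltW.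
have kcT : k%:R * c <= T.
  by rewrite (le_trans _ KT)// ler_pM2r// ler_nat -ltnS (ltn_predK kK).
have kS : k.+1%:R * c = k%:R * c + c by rewrite -natr1 mulrDl mul1r.
have trunc (x : R) : k%:R * c <= x < k.+1%:R * c -> k == Num.truncn (x / c).
  move=> /andP[h1 h2]; rewrite eq_sym truncn_eq; last by rewrite divr_ge0 ?(ltW c_gt0)// (le_trans kc0).
  by rewrite ler_pdivlMr// ltr_pdivrMr// h1.
have bound0 : 0 <= c * (k == Num.truncn (al / c))%:R + c * (k == Num.truncn (be / c))%:R.
  by rewrite addr_ge0// mulr_ge0// ltW.
have disj : slit_interval c k `&` [set` dyadic_itv T true j] = set0 -> slit_time T c k j = 0.
  by move=> h; rewrite /slit_time h measure0.
have inJ (t : R) : [set` dyadic_itv T true j] t -> al <= t <= be.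
  rewrite /= itv_boundlr bnd_simp -/al => /andP[-> /=].
  by rewrite -/be; case: (_ == _)%N; rewrite /= bnd_simp// => /ltW.
have albe : al <= be by rewrite !ler_pM2r ?invr_gt0 ?exprn_gt0// ler_nat.
have beT : be <= T.
  by rewrite ler_pdivrMr ?exprn_gt0// mulrC ler_pM2l// -natrX ler_nat ltn_ord.
have half (b : bool) (x y : R) : 0 <= x -> x <= c -> (y = 0 \/ y = c) -> `|x - y| <= c.
  by move=> x0 xc [->|->]; rewrite ler_norml; apply/andP; split; lra.
have half' : `|slit_time T c k j - c * (dyadic n T (k%:R * c) == j)%:R| <= c.
  by apply: (half true) => //; case: eqP; rewrite ?mulr1 ?mulr0; [right|left].
have [kal|kal] := leP al (k%:R * c); last first.
  have -> : (dyadic n T (k%:R * c) == j) = false.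
    apply/negbTE/negP; rewrite (dyadicP _ (closed := true))// => /inJ /andP[+ _].
    by rewrite leNgt kal.
  have [kal'|kal'] := leP (k.+1%:R * c) al.
    rewrite disj ?mulr0 ?subr0 ?normr0//; apply/seteqP; split => // t [+ /inJ /andP[t1 _]].
    by rewrite /slit_interval/= in_itv/= => /andP[_]; rewrite ltNge (le_trans kal').
  rewrite (trunc al) ?(ltW kal)// mulr1; apply: (@le_trans _ _ c).
    by rewrite mulr0 subr0 ger0_norm.
  by rewrite lerDl mulr_ge0// ltW.
have [kbe'|kbe'] := ltP be (k%:R * c).
  have -> : (dyadic n T (k%:R * c) == j) = false.
    apply/negbTE/negP; rewrite (dyadicP _ (closed := true))// => /inJ /andP[_].
    by rewrite leNgt kbe'.
  rewrite disj ?mulr0 ?subr0 ?normr0//; apply/seteqP; split => // t [+ /inJ /andP[_ t1]].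
  by rewrite /slit_interval/= in_itv/= => /andP[+ _]; rewrite leNgt (le_lt_trans t1).
have [kbe|kbe] := leP (k.+1%:R * c) be; last first.
  rewrite (trunc be) ?kbe'// mulr1; apply: (le_trans half').
  by rewrite lerDr mulr_ge0// ltW.
have sub : slit_interval c k `<=` [set` dyadic_itv T true j].
  move=> t; rewrite /slit_interval/= in_itv/= => /andP[t1 t2].
  rewrite itv_boundlr bnd_simp -/al (le_trans kal)//= -/be.
  by case: (_ == _)%N; rewrite /= bnd_simp ?(lt_le_trans t2)// ltW// (lt_le_trans t2).
have -> : (dyadic n T (k%:R * c) == j).
  rewrite (dyadicP _ (closed := true))//; apply: sub.
  by rewrite /slit_interval/= in_itv/= lexx kS ltrDl.
by rewrite /slit_time setIidl// lebesgue_slit/= mulr1 subrr normr0.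
Qed.

Definition cell_count (u : 'I_K -> 'I_(2 ^ n)) (q : grid n) : R :=
  \sum_(k < K) ((u k == q.1) && (dyadic n T (k%:R * c) == q.2))%:R.

Lemma cell_mass_count (c0 : 0 < c) (q : grid n) :
  `|cell_mass (slit_measure T c0 thS) q -
    c * cell_count (fun k => dyadic n (2 * pi) (th k)) q| <= 2 * c.
Proof.
rewrite slit_cell /cell_count mulr_sumr -sumrB.
apply: (le_trans (ler_norm_sum _ _ _)).
(* Only the slits straddling the two ends of the time slab contribute. *)
pose k0 := Num.truncn (q.2%:R * T / 2 ^+ n / c).
pose k1 := Num.truncn (q.2.+1%:R * T / 2 ^+ n / c).
apply: (@le_trans _ _ (\sum_(k < K) (c * ((k : nat) == k0)%:R + c * ((k : nat) == k1)%:R))).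
  apply: ler_sum => k _; case: eqP => _ /=.
    by rewrite mul1r; apply: slit_time_dist.
  rewrite mul0r mulr0 subr0 normr0 addr_ge0// mulr_ge0// ltW//.
have h (m : nat) : \sum_(k < K) c * ((k : nat) == m)%:R <= c.
  rewrite -mulr_sumr -[leRHS]mulr1 ler_pM2l//.
  have [mK|mK] := ltnP m K.
    rewrite (bigD1 (Ordinal mK))//= eqxx big1 ?addr0// => i.
    by rewrite -val_eqE/= => /negbTE ->.
  by rewrite big1// => i _; rewrite ltn_eqF// (leq_trans (ltn_ord i)).
by rewrite big_split/= mulr_natl mulr2n lerD.
Qed.

End slit_cells.

Lemma dyadic_coarser (R : realType) (b y y' : R) m n : 0 < b -> (m <= n)%N ->
  dyadic n b y = dyadic n b y' -> dyadic m b y = dyadic m b y'.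
Proof.
move=> b0 mn; rewrite -(subnK mn); elim: (n - m)%N => [//|p IH] h; apply: IH.
by rewrite (dyadicS _ y b0) (dyadicS _ y' b0); congr half_ord.
Qed.

Section words.
Context {R : realType} d {Omega : measurableType d} (P : probability Omega R).
Variable theta : nat -> {RV P >-> R}.
Hypothesis theta_angle : forall w k, theta k w \in `[0, 2 * pi[.
Hypothesis theta_unif : forall k, uniform_angle (theta k).
Hypothesis theta_ind : mutually_independent theta.

Definition word n K (w : Omega) : {ffun 'I_K -> 'I_(2 ^ n)} :=
  [ffun k : 'I_K => dyadic n (2 * pi) (theta k w)].

Lemma letter_setE n k (i : 'I_(2 ^ n)) :
  [set w | dyadic n (2 * pi) (theta k w) = i] =
  theta k @^-1` [set` dyadic_itv (2 * pi) false i].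
Proof.
apply/seteqP; split => w /=; have /andP[th0 th2] := theta_angle w k.
  by move=> <-; rewrite -dyadicP// twopi_gt0.
by rewrite -dyadicP ?twopi_gt0// => /eqP.
Qed.

Lemma letter_prob n k (i : 'I_(2 ^ n)) :
  P (theta k @^-1` [set` dyadic_itv (2 * pi) false i]) = ((2 ^+ n)^-1)%:E.
Proof.
have mI := @measurable_itv R (dyadic_itv (2 * pi) false i).
have := theta_unif k mI.
rewrite /distribution /pushforward => ->; rewrite /uniform_prob.
rewrite (eq_integral (fun=> ((2 * pi)^-1)%:E)); last first.
  move=> x; rewrite inE => /(dyadic_itv_sub twopi_gt0) /=.
  rewrite in_itv/= => /andP[x0 x2].
  by rewrite /uniform_pdf x0 (ltW x2)/= subr0.
rewrite integral_cst /=; last exact: mI.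
by rewrite lebesgue_dyadic_itv ?twopi_gt0// -EFinM mulrA mulVf ?mul1r// gt_eqF// twopi_gt0.

Qed.

(** Independence is phrased with sets indexed by all integers; positions beyond [K] are left
    unconstrained. *)
Let letter_box n K (u : {ffun 'I_K -> 'I_(2 ^ n)}) (k : nat) : set R :=
  oapp (fun k' : 'I_K => [set` dyadic_itv (2 * pi) false (u k')]) setT (insub k).

Let mletter_box n K u k : measurable (@letter_box n K u k).
Proof.
rewrite /letter_box; case: insubP => [k' _ _|_] /=; [exact: measurable_itv|exact: measurableT].
Qed.

Let word_setE n K (u : {ffun 'I_K -> 'I_(2 ^ n)}) :
  [set w | word n K w = u] = \bigcap_(k in [set` iota 0 K]) (theta k @^-1` letter_box u k).
Proof.
apply/seteqP; split => [w <- k /=|w h].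
  rewrite mem_iota add0n => /andP[_ kK]; rewrite /letter_box insubT/= ffunE/=.
  have : [set w' | dyadic n (2 * pi) (theta k w') = dyadic n (2 * pi) (theta k w)] w by [].
  by rewrite letter_setE.
apply/ffunP => k; rewrite ffunE.
have := h k; rewrite /= mem_iota add0n ltn_ord => /(_ isT).
rewrite /letter_box valK/=.
have := letter_setE k (u k) => /seteqP[_ +]; exact.
Qed.

Lemma measurable_word n K (u : {ffun 'I_K -> 'I_(2 ^ n)}) :
  measurable [set w | word n K w = u].
Proof.
rewrite word_setE; apply: fin_bigcap_measurable => // k _.
by rewrite -[X in measurable X]setTI; exact: measurable_funPT.
Qed.

Lemma word_prob n K (u : {ffun 'I_K -> 'I_(2 ^ n)}) :
  P [set w | word n K w = u] = ((2 ^+ n)^-1 ^+ K)%:E.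
Proof.
rewrite word_setE theta_ind ?iota_uniq//.
rewrite (eq_big_seq (fun=> ((2 ^+ n)^-1)%:E)); last first.
  move=> k; rewrite mem_iota add0n => /andP[_ kK].
  by rewrite /letter_box insubT/= letter_prob.
rewrite big_const_seq count_predT size_iota.
by elim: K {u} => [//|K IH]; rewrite iterS IH exprS EFinM.
Qed.

Lemma measurable_word_set n K (S : {set {ffun 'I_K -> 'I_(2 ^ n)}}) :
  measurable [set w | word n K w \in S].
Proof.
rewrite (_ : [set w | _] = \bigcup_(u in [set u | u \in S]) [set w | word n K w = u]).
  by apply: fin_bigcup_measurable => // u _; exact: measurable_word.
by apply/seteqP; split => [w wS|w [u /= uS wu]]; [exists (word n K w)|rewrite /= wu].
Qed.

Lemma word_set_prob n K (S : {set {ffun 'I_K -> 'I_(2 ^ n)}}) :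
  P [set w | word n K w \in S] = (#|S|%:R * (2 ^+ n)^-1 ^+ K)%:E.
Proof.
have mW := measurable_word_set S.
(* The words form a single finite partition of the probability space, used here as a constant
   sequence of partitions. *)
have := @integral_step _ _ _ P setT (fun=> {ffun 'I_K -> 'I_(2 ^ n)}) (fun=> word n K)
  (fun _ _ => (2 ^+ n)^-1 ^+ K) measurableT _ _ 0%N (fun u => (u \in S)%:R) (fun=> ler0n _ _).
move=> /(_ _ _)/=.
rewrite (_ : \int[P]_(w in setT) _ =
    \int[P]_(w in setT) (\1_[set w | word n K w \in S] w)%:E)%E; last first.
  apply: eq_integral => w _; rewrite indicE; congr (_%:E); congr (nat_of_bool _)%:R.
  by apply/idP/idP; rewrite inE.
rewrite integral_indic// setIT => ->.
- rewrite -mulr_suml; congr (_ * _)%:E; rewrite -sum1_card natr_sum [RHS]big_mkcond/=.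
  by apply: eq_bigr => u _; case: (u \in S).
- by move=> _ u; rewrite setTI; exact: measurable_word.
- by move=> _ u; rewrite setTI; exact: word_prob.
Qed.

End words.

Section slit_number.
Context {R : realType} (T c : R).
Hypotheses (T_gt0 : 0 < T) (c_gt0 : 0 < c).

Definition slit_number : nat := (Num.truncn (T / c)).+1.

Lemma slit_number_gt : T < slit_number%:R * c.
Proof. by rewrite -ltr_pdivrMr// truncnS_gt. Qed.

Lemma slit_number_le : slit_number.-1%:R * c <= T.
Proof.
by rewrite -ler_pdivlMr//= truncn_le divr_ge0// ltW.
Qed.

End slit_number.

Section measurable_events.
Context {R : realType} d {Omega : measurableType d} (P : probability Omega R).
Variable theta : nat -> {RV P >-> R}.
Hypothesis theta_angle : forall w k, theta k w \in `[0, 2 * pi[.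
Variables (T c : R).
Hypotheses (T_gt0 : 0 < T) (c_gt0 : 0 < c).

Let Y w := slit_measure T c_gt0 (theta_angle w).
Let K := slit_number T c.

Lemma cell_mass_word n w w' : word theta n K w = word theta n K w' ->
  forall m q, (m <= n)%N -> @cell_mass R T (Y w) m q = cell_mass (Y w') q.
Proof.
move=> ww m q mn.
rewrite !(slit_cell T_gt0 c_gt0 _ (slit_number_gt T c_gt0)).
apply: eq_bigr => k _; congr (_ %:R * _); congr nat_of_bool; congr (_ == _).
apply: (dyadic_coarser (@twopi_gt0 R) mn).
by have /ffunP/(_ k) := ww; rewrite !ffunE.
Qed.

(* A weakly open event is the union over n of the events, on the words of level
   n, that force membership in O. *)
Lemma measurable_slit_open (O : set (driving_measure T)) : open O ->
  measurable [set w | O (Y w)].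
Proof.
move=> oO.
pose S n : {set {ffun 'I_K -> 'I_(2 ^ n)}} :=
  [set u | `[< forall w, word theta n K w = u -> O (Y w) >]]%SET.
rewrite (_ : [set w | _] = \bigcup_n [set w | word theta n K w \in S n]).
  by apply: bigcupT_measurable => n; exact: measurable_word_set.
apply/seteqP; split => [w Ow|w [n _ /=]]; last first.
  by rewrite !inE => /asboolP; exact.
have [n hn] := cell_ball_nbhs T_gt0 (open_nbhs_nbhs (conj oO Ow)).
exists n => //=; rewrite !inE; apply/asboolP => w' ww.
apply: hn => m q mn; rewrite (cell_mass_word ww)// subrr normr0.
by rewrite invr_gt0.
Qed.

Lemma measurable_slit_closed (C : set (driving_measure T)) : closed C ->
  measurable [set w | C (Y w)].
Proof.
move=> cC; rewrite -[X in measurable X]setCK; apply: measurableC.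
exact: (measurable_slit_open (closed_openC cC)).
Qed.

End measurable_events.

(** * Types and tilting *)

Section method_of_types.
Context {R : realType} (L J : finType) (K : nat) (j : 'I_K -> J).
Implicit Types (u : {ffun 'I_K -> L}) (q : L * J).

(** Each position has a fixed class [j k], its time slab in the application. Counting letters
    jointly with classes gives the conditional type of the word. *)
Definition letter_count u q : nat :=
  (\sum_(k < K) ((u k == q.1) && (j k == q.2)))%N.

Definition class_count (x : J) : nat := (\sum_(k < K) (j k == x))%N.

Lemma letter_count_le u q : (letter_count u q <= class_count q.2)%N.
Proof. by apply: leq_sum => k _; case: (u k == q.1); case: (j k == q.2). Qed.

Lemma class_count_le x : (class_count x <= K)%N.
Proof.
apply: (@leq_trans (\sum_(k < K) 1)%N); last by rewrite sum1_card card_ord.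
by apply: leq_sum => k _; exact: leq_b1.
Qed.

Lemma sum_letter_count u x :
  (\sum_(i : L) letter_count u (i, x))%N = class_count x.
Proof.
rewrite /letter_count exchange_big; apply: eq_bigr => k _ /=.
rewrite (bigD1 (u k))//= eqxx/= big1 ?addn0// => i.
by rewrite eq_sym => /negbTE ->.
Qed.

Lemma prod_letters u (F : L * J -> R) :
  \prod_(k < K) F (u k, j k) = \prod_q F q ^+ letter_count u q.
Proof.
rewrite (partition_big (fun k => (u k, j k)) xpredT)//=; apply: eq_bigr => q _.
rewrite (eq_bigr (fun=> F q)); last by move=> k /eqP ->.
rewrite prodr_const; congr (_ ^+ _).
rewrite -sum1_card /letter_count big_mkcond; apply: eq_bigr => k _.
case: q => a b; rewrite unfold_in /=; by case: (_ && _).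
Qed.

Lemma sum_words (F : 'I_K -> L -> R) :
  \sum_(u : {ffun 'I_K -> L}) \prod_(k < K) F k (u k) = \prod_(k < K) \sum_i F k i.
Proof. by rewrite bigA_distr_bigA. Qed.

(** Minus the sum over the classes of their size times the Shannon entropy of the letter frequencies
    in the class. *)
Definition type_cost u : R :=
  \sum_q (letter_count u q)%:R * ln ((letter_count u q)%:R / (class_count q.2)%:R).

Lemma prod_expR (p : L * J -> R) u :
  (forall q, 0 <= p q) -> (forall q, p q = 0 -> letter_count u q = 0%N) ->
  \prod_q p q ^+ letter_count u q = expR (\sum_q (letter_count u q)%:R * ln (p q)).
Proof.
move=> p0 pn; rewrite expR_sum; apply: eq_bigr => q _.
have [pq0|pq0] := eqVneq (p q) 0; first by rewrite pn// expr0 mul0r expR0.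
by rewrite expRM_natl lnK// posrE lt_neqAle eq_sym pq0 p0.
Qed.

(* The letters drawn independently with the empirical frequencies of a type give
   to each word of this type a probability equal to the exponential below. *)
Lemma card_type_class (c : L * J -> nat) :
  #|[set u : {ffun 'I_K -> L} | [forall q, letter_count u q == c q]]%SET|%:R *
  expR (\sum_q (c q)%:R * ln ((c q)%:R / (class_count q.2)%:R)) <= 1 :> R.
Proof.
set S := finset _.
pose p q : R := (c q)%:R / (class_count q.2)%:R.
have p0 q : 0 <= p q by rewrite divr_ge0.
have [->|/set0Pn[u0 u0S]] := eqVneq S finset.set0; first by rewrite cards0 mul0r.
have cE q : c q = letter_count u0 q.
  by move: u0S; rewrite inE => /forallP/(_ q)/eqP.
have -> : #|S|%:R * expR (\sum_q (c q)%:R * ln ((c q)%:R / (class_count q.2)%:R)) =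
    \sum_(u in S) \prod_(k < K) p (u k, j k).
  rewrite -sum1_card natr_sum mulr_suml; apply: eq_bigr => u uS.
  have uE q : letter_count u q = c q by move: uS; rewrite inE => /forallP/(_ q)/eqP.
  rewrite mul1r prod_letters prod_expR//; first by congr expR; apply: eq_bigr => q _; rewrite uE.
  move=> q; rewrite uE => /eqP; rewrite mulf_eq0 invr_eq0 !pnatr_eq0 => /orP[/eqP//|/eqP h].
  by apply/eqP; rewrite cE -leqn0 -h letter_count_le.
apply: (@le_trans _ _ (\sum_(u : {ffun 'I_K -> L}) \prod_(k < K) p (u k, j k))).
  rewrite [leRHS](bigID (mem S))/= lerDl sumr_ge0// => u _.
  by apply: prodr_ge0 => k _; exact: p0.
rewrite (sum_words (fun k i => p (i, j k))).
apply: prodr_ile1 => k _; rewrite sumr_ge0//= /p/= -mulr_suml -natr_sum.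
rewrite (eq_bigr (fun i => letter_count u0 (i, j k))); last by move=> i _; rewrite cE.
rewrite sum_letter_count; have [->|h] := eqVneq (class_count (j k)) 0%N; first by rewrite mul0r.
by rewrite divff// pnatr_eq0.
Qed.

(** A type takes values in ['I_K.+1] on the pairs, which bounds the number of types by the power of
    [K.+1]; each type class is bounded by [card_type_class]. *)
Lemma card_words_le (S : {set {ffun 'I_K -> L}}) (B : R) :
  (forall u, u \in S -> B <= type_cost u) ->
  #|S|%:R <= K.+1%:R ^+ (#|L| * #|J|) * expR (- B) :> R.
Proof.
move=> SB.
pose type u : {ffun L * J -> 'I_K.+1} := [ffun q => inord (letter_count u q)].
have typeE u q : type u q = letter_count u q :> nat.
  by rewrite ffunE inordK// ltnS (leq_trans (letter_count_le _ _))// class_count_le.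
rewrite -sum1_card natr_sum (partition_big type xpredT)//=.
apply: (@le_trans _ _ (\sum_(t : {ffun L * J -> 'I_K.+1}) expR (- B))); last first.
  by rewrite sumr_const card_ffun card_prod card_ord -natrX mulr_natl.
apply: ler_sum => t _; rewrite sumr_const.
set n := #|_|.
have [->|n0] := posnP n; first by rewrite mulr0n expR_ge0.
have /card_gt0P[u0] : (0 < #|[pred u in S | type u == t]|)%N by [].
rewrite inE => /andP[u0S /eqP u0t].
have h := card_type_class (fun q => t q).
have cost : \sum_q (t q)%:R * ln ((t q)%:R / (class_count q.2)%:R) = type_cost u0.
  by apply: eq_bigr => q _; rewrite -u0t typeE.
rewrite cost in h.
rewrite expRN -[leRHS]mul1r ler_pdivlMr ?expR_gt0//.
apply: le_trans h; apply: ler_pM; rewrite ?ler0n ?expR_ge0//.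
  rewrite ler_nat /n; apply: subset_leq_card; apply/(fintype.subsetP) => u.
  rewrite !inE => /andP[_ /eqP <-]; apply/forallP => q; by rewrite typeE.
by rewrite ler_expR SB.
Qed.

End method_of_types.

Section tilting.
Context {R : realType} (L J : finType) (K : nat) (j : 'I_K -> J).
Implicit Types (u : {ffun 'I_K -> L}) (q : L * J).
Variable p : L * J -> R.
Hypothesis p_ge0 : forall q, 0 <= p q.
Hypothesis p_sum : forall x, \sum_i p (i, x) = 1.

(** The probability of [u] when the letters are independent, that of position [k] having law
    [p (_, j k)]. *)
Definition tilt u : R := \prod_(k < K) p (u k, j k).

Lemma tilt_ge0 u : 0 <= tilt u. Proof. exact: prodr_ge0. Qed.

Lemma sum_tilt : \sum_u tilt u = 1.
Proof.
rewrite (sum_words (fun k i => p (i, j k))) big1// => k _; exact: p_sum.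
Qed.

Lemma tilt_second_moment (g : 'I_K -> L -> R) :
  (forall k, \sum_i p (i, j k) * g k i = 0) ->
  \sum_u tilt u * (\sum_k g k (u k)) ^+ 2 = \sum_k \sum_i p (i, j k) * g k i ^+ 2.
Proof.
move=> g0.
have prodE (F : 'I_K -> L -> R) :
    \sum_u tilt u * \prod_(k < K) F k (u k) = \prod_(k < K) \sum_i p (i, j k) * F k i.
  rewrite -(sum_words (fun k i => p (i, j k) * F k i)); apply: eq_bigr => u _.
  by rewrite big_split.
have pick (k : 'I_K) (G : L -> R) :
    \sum_u tilt u * G (u k) = \sum_i p (i, j k) * G i.
  have := prodE (fun m i => if m == k then G i else 1).
  rewrite (bigD1 k)//= eqxx [X in _ = _ * X -> _]big1 ?mulr1; last first.
    move=> m /negbTE mk; under eq_bigr do rewrite mk mulr1; exact: p_sum.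
  move=> <-; apply: eq_bigr => u _; rewrite (bigD1 k)//= eqxx big1 ?mulr1// => m /negbTE ->//.
under eq_bigr do rewrite expr2 big_distrlr/= mulr_sumr.
rewrite exchange_big/=; apply: eq_bigr => k _.
under eq_bigr do rewrite mulr_sumr.
rewrite exchange_big/= (bigD1 k)//= [X in _ + X]big1 ?addr0.
  by rewrite -(pick k (fun i => g k i ^+ 2)); apply: eq_bigr => u _; rewrite expr2.
move=> m mk.
(* The correlation of two distinct positions, as a product over all positions: its factor at [k] is
   the mean of [g k], which is 0. *)
have := prodE (fun n i => (if n == k then g k i else 1) * (if n == m then g m i else 1)).
rewrite [X in _ = X -> _](bigD1 k)//= eqxx eq_sym (negbTE mk).
under [X in _ = X * _ -> _]eq_bigr do rewrite mulr1.
rewrite g0 mul0r => E; apply: etrans E; apply: eq_bigr => u _; congr (_ * _).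
rewrite (bigD1 k)//= (bigD1 m)//= !eqxx (negbTE mk) eq_sym (negbTE mk) big1 ?mulr1 ?mul1r//.
by move=> n /andP[/negbTE -> /negbTE ->]; rewrite mulr1.
Qed.

Let n_ u q : R := (letter_count j u q)%:R.
Let N_ x : R := (class_count j x)%:R.

(** The deviation of a count is a sum of [K] independent centred variables bounded by 1, so its
    variance is at most [K]. *)
Lemma tilt_chebyshev q (s : R) : 0 < s ->
  \sum_(u | s < `|n_ u q - N_ q.2 * p q|) tilt u <= K%:R / s ^+ 2.
Proof.
move=> s0.
pose g (k : 'I_K) (i : L) : R := (j k == q.2)%:R * ((i == q.1)%:R - p q).
have gE u : n_ u q - N_ q.2 * p q = \sum_k g k (u k).
  rewrite /n_ /N_ /letter_count /class_count !natr_sum mulr_suml -sumrB.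
  apply: eq_bigr => k _; rewrite /g; case: (j k == q.2); case: (u k == q.1) => /=; ring.
have p1 : p q <= 1.
  rewrite -(p_sum q.2) (bigD1 q.1)//= -surjective_pairing lerDl sumr_ge0//.
have g0 k : \sum_i p (i, j k) * g k i = 0.
  rewrite /g; have [jk|_] := eqVneq (j k) q.2; last first.
    by rewrite big1// => i _; rewrite mul0r mulr0.
  under eq_bigr do rewrite mul1r mulrBr; rewrite sumrB -mulr_suml p_sum mul1r.
  rewrite (bigD1 q.1)//= eqxx mulr1 big1; last by move=> i /negbTE ->; rewrite mulr0.
  by rewrite addr0 jk -surjective_pairing subrr.
have g1 k i : g k i ^+ 2 <= 1.
  rewrite -(real_normK (num_real (g k i))); apply: exprn_ile1 => //.
  rewrite /g normrM; have := p_ge0 q.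
  case: (j k == q.2); rewrite ?normr0 ?mul0r// normr1 mul1r => p0.
  by rewrite ler_norml; case: (i == q.1) => /=; apply/andP; split; lra.
rewrite ler_pdivlMr ?exprn_gt0//.
apply: (@le_trans _ _ (\sum_u tilt u * (\sum_k g k (u k)) ^+ 2)).
  rewrite [leRHS](bigID (fun u => s < `|n_ u q - N_ q.2 * p q|))/= -[leLHS]addr0.
  apply: lerD; last by apply: sumr_ge0 => u _; rewrite mulr_ge0 ?tilt_ge0 ?sqr_ge0.
  rewrite mulr_suml; apply: ler_sum => u hu; rewrite ler_wpM2l ?tilt_ge0//.
  by rewrite -gE -[leRHS](real_normK (num_real _)) lerXn2r ?nnegrE ?(ltW hu)// ltW.
rewrite (tilt_second_moment g0) -[leRHS]mulr1 -[K in leRHS]card_ord mulr_natl -sumr_const.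
apply: ler_sum => k _; rewrite -(p_sum (j k)); apply: ler_sum => i _.
by rewrite -[leRHS]mulr1 ler_wpM2l.
Qed.

Definition typical (s : R) : {set {ffun 'I_K -> L}} :=
  [set u : {ffun 'I_K -> L} | [forall q, `|n_ u q - N_ q.2 * p q| <= s]]%SET.

(* By Chebyshev's inequality the typical words carry half of the tilted law, and
   on them its density with respect to the uniform law is at most [expR A]. *)
Lemma card_typical (s : R) : (0 < #|L|)%N -> 0 < s ->
  (#|L| * #|J|)%:R * (K%:R / s ^+ 2) <= 2^-1 ->
  expR (- (\sum_q N_ q.2 * (p q * ln (#|L|%:R * p q)) + s * \sum_q `|ln (#|L|%:R * p q)|)) / 2 <=
  #|typical s|%:R * (#|L|%:R^-1) ^+ K.
Proof.
move=> L_gt0 s0 small.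
have Lne0 : #|L|%:R != 0 :> R by rewrite pnatr_eq0 -lt0n.
set A := _ + _.
have half : 2^-1 <= \sum_(u in typical s) tilt u.
  have : \sum_(u | u \notin typical s) tilt u <= 2^-1.
    apply: le_trans small.
    (* Union bound over the pairs whose count deviates. *)
    apply: (@le_trans _ _ (\sum_(q : L * J) \sum_(u | s < `|n_ u q - N_ q.2 * p q|) tilt u)).
      rewrite (exchange_big_dep xpredT)//= big_mkcond; apply: ler_sum => u _.
      case: ifPn => [|_]; last by rewrite sumr_ge0// => q _; exact: tilt_ge0.
      rewrite inE negb_forall => /existsP[q]; rewrite -ltNge => hq.
      by rewrite (bigD1 q)//= lerDl sumr_ge0// => q' _; exact: tilt_ge0.
    rewrite -card_prod mulr_natl -sumr_const; apply: ler_sum => q _.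
    exact: tilt_chebyshev.
  have := sum_tilt; rewrite (bigID (mem (typical s)))/= => h1 h2; lra.
have bound u : u \in typical s -> tilt u <= (#|L|%:R^-1) ^+ K * expR A.
  rewrite inE => /forallP hu.
  have [t0|tn0] := eqVneq (tilt u) 0.
    by rewrite t0 mulr_ge0 ?expR_ge0// exprn_ge0// invr_ge0.
  (* A word of positive probability contains no letter of probability 0, so the convention for
     [ln 0] does no harm. *)
  have pn q : p q = 0 -> letter_count j u q = 0%N.
    move=> pq; apply/eqP; rewrite -leqn0 leqNgt; apply/negP => n0.
    move: tn0; rewrite /tilt prod_letters (bigD1 q)//= pq expr0n gtn_eqF//= mul0r eqxx//.
  have E : tilt u = (#|L|%:R^-1) ^+ K * \prod_q (#|L|%:R * p q) ^+ letter_count j u q.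
    rewrite -prod_letters /tilt big_split/= prodr_const card_ord mulrA -exprMn.
    by rewrite mulVf// expr1n mul1r.
  rewrite E ler_wpM2l ?exprn_ge0 ?invr_ge0// prod_expR; last 2 first.
  - by move=> q; rewrite mulr_ge0.
  - by move=> q /eqP; rewrite mulf_eq0 (negbTE Lne0)/= => /eqP /pn.
  rewrite ler_expR /A mulr_sumr -big_split; apply: ler_sum => q _ /=.
  (* In the exponent, replacing the count by its mean costs at most [s] times the absolute
     logarithm. *)
  rewrite mulrA -lerBlDl -mulrBl; apply: le_trans (ler_norm _) _.
  by rewrite normrM ler_wpM2r//; exact: hu.
have h : 2^-1 <= #|typical s|%:R * (#|L|%:R^-1) ^+ K * expR A.
  apply: (le_trans half); rewrite -mulrA -sum1_card natr_sum mulr_suml.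
  by apply: ler_sum => u /bound; rewrite mul1r.
by rewrite expRN -mulrC ler_pdivrMr ?expR_gt0.
Qed.

End tilting.

(** With [h = x - y > 0], the increment is [h * ln x + y * (ln x - ln y)]. The tangent inequality
    puts the last term in [[0, h]]. The first is at most [h * b] if [x >= 1], and otherwise at most
    [2 * sqrt h], since [h <= x]. *)
Lemma xlnx_unif_continuous (R : realType) (b e : R) : 0 < b -> 0 < e ->
  exists2 d : R, 0 < d & forall x y, 0 <= x <= b -> 0 <= y <= b -> `|x - y| <= d ->
    `|xlnx x - xlnx y| <= e.
Proof.
move=> b0 e0.
(* The last two bounds give [2 * sqrt h <= e / 2] and [h * (b + 1) <= e / 2]. *)
pose d := Num.min 1 (Num.min ((e / 4) ^+ 2) (e / (2 * (b + 1)))).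
have d0 : 0 < d by rewrite !lt_min ltr01 exprn_gt0 ?divr_gt0// mulr_gt0// addr_gt0.
have main x y : 0 <= y -> y <= x -> x <= b -> x - y <= d -> `|xlnx x - xlnx y| <= e.
  move=> y0 yx xb xyd.
  have x0 : 0 <= x by exact: le_trans yx.
  have [xy|xy] := eqVneq x y; first by rewrite xy subrr normr0 ltW.
  set h := x - y.
  have h0 : 0 < h by rewrite subr_gt0 lt_neqAle eq_sym xy.
  have xp : 0 < x by rewrite (le_lt_trans y0)// -subr_gt0.
  have [h1 [h2 h3]] : h <= 1 /\ h <= (e / 4) ^+ 2 /\ h <= e / (2 * (b + 1)).
    by move: xyd; rewrite !le_min => /andP[-> /andP[-> ->]].
  have bh : h * (b + 1) <= e / 2.
    have -> : e / 2 = e / (2 * (b + 1)) * (b + 1) by field; rewrite gt_eqF// addr_gt0.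
    by rewrite ler_wpM2r// addr_ge0// ltW.
  have sh : 2 * Num.sqrt h <= e / 2.
    have : Num.sqrt h <= e / 4.
      by rewrite -[leRHS]ger0_norm ?divr_ge0 ?(ltW e0)// -sqrtr_sqr ler_wsqrtr.
    lra.
  have E : xlnx x - xlnx y = h * ln x + y * (ln x - ln y) by rewrite /xlnx /h; ring.
  have part2 : 0 <= y * (ln x - ln y) <= h.
    have [->|yn0] := eqVneq y 0; first by rewrite mul0r lexx ltW.
    have yp : 0 < y by rewrite lt_neqAle eq_sym yn0.
    rewrite mulr_ge0 ?subr_ge0 ?ler_ln ?posrE//=.
    have := xlnx_tangent y0 xp; rewrite /xlnx /h; lra.
  have part1 : `|h * ln x| <= e / 2 + h * b.
    rewrite normrM (gtr0_norm h0); have [x1|x1] := leP 1 x.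
      rewrite ger0_norm ?ln_ge0//; apply: (@le_trans _ _ (h * b)); last by rewrite lerDr divr_ge0// ltW.
      by rewrite ler_wpM2l ?(ltW h0)// (le_trans (ltW (ln_sublinear xp))).
    rewrite ler0_norm; last by rewrite ln_le0// ltW.
    have hx : h <= x by rewrite /h lerBlDr lerDl.
    apply: (@le_trans _ _ `|xlnx h|).
      rewrite /xlnx normrM (gtr0_norm h0) ler_wpM2l ?(ltW h0)//.
      by rewrite ler0_norm ?ln_le0// lerN2 ler_ln ?posrE.
    apply: (le_trans (norm_xlnx_le (ltW h0) h1)); apply: (le_trans sh).
    by rewrite lerDl mulr_ge0 ?(ltW h0)// ltW.
  rewrite E; apply: (le_trans (ler_normD _ _)).
  have /andP[p0 p1] := part2; rewrite (ger0_norm p0); lra.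
exists d => // x y /andP[x0 xb] /andP[y0 yb].
have [yx|xy] := leP y x.
  by rewrite (ger0_norm (_ : 0 <= x - y)) ?subr_ge0//; exact: main.
rewrite distrC => h; rewrite distrC; apply: main => //; first exact: ltW.
exact: le_trans (ler_norm _) h.
Qed.

Section word_estimates.
Context {R : realType} (T : R) (n : nat).
Hypothesis T_gt0 : 0 < T.

Local Notation grid := ('I_(2 ^ n) * 'I_(2 ^ n))%type.
Local Notation M := (2 ^+ n : R).

Definition slit_slab (c : R) (k : 'I_(slit_number T c)) : 'I_(2 ^ n) :=
  dyadic n T (k%:R * c).

Let M_gt0 : 0 < M. Proof. by rewrite exprn_gt0. Qed.
Let M_ge1 : 1 <= M. Proof. by rewrite exprn_ege1// ler1n. Qed.

Definition slit_word (c : R) (th : nat -> R) : {ffun 'I_(slit_number T c) -> 'I_(2 ^ n)} :=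
  [ffun k : 'I_(slit_number T c) => dyadic n (2 * pi) (th k)].

Lemma cell_mass_letter_count c (c0 : 0 < c) (th : nat -> R)
    (thS : forall k, th k \in `[0, 2 * pi[) (q : grid) :
  `|cell_mass (slit_measure T c0 thS) q -
    c * (letter_count (@slit_slab c) (slit_word c th) q)%:R| <= 2 * c.
Proof.
have := cell_mass_count T_gt0 c0 thS (slit_number_gt T c0) (slit_number_le T_gt0 c0) c0 q.
rewrite /cell_count /letter_count natr_sum.
by under [in X in _ -> X]eq_bigr do rewrite ffunE.
Qed.

(** Summed over the angular cells, the masses give the time marginal [T / M] and the letter counts
    the class count; each of the [M] cells has error [2 * c]. *)
Lemma class_count_dist c (x : 'I_(2 ^ n)) : 0 < c ->
  `|T / M - c * (class_count (@slit_slab c) x)%:R| <= 2 * c * M.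
Proof.
move=> c0.
(* The class counts do not depend on the angles: any sequence will do. *)
pose th0 (k : nat) : R := 0.
have thS k : th0 k \in `[0, 2 * pi[ by rewrite in_itv/= lexx/= twopi_gt0.
rewrite -(sum_cell_mass_time T_gt0 (slit_measure T c0 thS) x).
rewrite -(sum_letter_count (@slit_slab c) (slit_word c th0)) natr_sum mulr_sumr -sumrB.
apply: (le_trans (ler_norm_sum _ _ _)).
apply: (@le_trans _ _ (\sum_(i < 2 ^ n) 2 * c)).
  by apply: ler_sum => i _; exact: cell_mass_letter_count.
by rewrite sumr_const card_ord -natrX mulr_natr.
Qed.

(** Scaling by [c] leaves the ratios unchanged and makes the counts comparable to masses. Splitting
    the logarithm removes the quotients, which are not uniformly continuous near 0. *)
Lemma type_cost_xlnx c (u : {ffun 'I_(slit_number T c) -> 'I_(2 ^ n)}) : 0 < c ->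
  c * type_cost (@slit_slab c) u =
  \sum_q xlnx (c * (letter_count (@slit_slab c) u q)%:R) -
  \sum_x xlnx (c * (class_count (@slit_slab c) x)%:R) :> R.
Proof.
move=> c0.
have -> : \sum_x xlnx (c * (class_count (@slit_slab c) x)%:R) =
    \sum_(q : grid) c * (letter_count (@slit_slab c) u q)%:R *
      ln (c * (class_count (@slit_slab c) q.2)%:R).
  rewrite (eq_bigr (fun q : grid => (fun i x => c * (letter_count (@slit_slab c) u (i, x))%:R *
      ln (c * (class_count (@slit_slab c) x)%:R)) q.1 q.2)); last by move=> [].
  rewrite -(pair_bigA _ (fun i x => c * (letter_count (@slit_slab c) u (i, x))%:R *
      ln (c * (class_count (@slit_slab c) x)%:R)))/= exchange_big; apply: eq_bigr => x _ /=.
  by rewrite -mulr_suml -mulr_sumr -natr_sum sum_letter_count.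
rewrite /type_cost mulr_sumr -sumrB; apply: eq_bigr => q _.
have [->|n0] := posnP (letter_count (@slit_slab c) u q).
  by rewrite /xlnx !(mul0r, mulr0) subr0.
have N0 : (0 < class_count (@slit_slab c) q.2)%N by rewrite (leq_trans n0)// letter_count_le.
rewrite /xlnx ln_div ?posrE ?ltr0n// !lnM ?posrE ?ltr0n//; ring.
Qed.

(** Same shape as the scaled type cost; [T * ln M] is the price of the uniform law on the [M]
    angular cells. *)
Lemma grid_entropy_xlnx (r : driving_measure T) :
  grid_entropy T (@cell_mass _ _ r n) =
  \sum_(q : grid) xlnx (cell_mass r q) - \sum_(x < 2 ^ n) xlnx (T / M) + T * ln M.
Proof.
have TM : 0 < T / M by rewrite divr_gt0.
rewrite /grid_entropy (eq_bigr (fun q : grid => xlnx (cell_mass r q) - cell_mass r q * ln (T / (M * M)))).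
  rewrite sumrB -mulr_suml sum_cell_mass// sumr_const card_ord -[_ *+ (2 ^ n)]mulr_natl natrX.
  rewrite /xlnx !ln_div ?posrE ?mulr_gt0// lnM ?posrE//.
  have -> : M * (T / M * (ln T - ln M)) = T * (ln T - ln M) by field; rewrite gt_eqF.
  ring.
move=> q _; have [->|y0] := eqVneq (cell_mass r q) 0; first by rewrite /xlnx !mul0r subr0.
rewrite ln_div ?posrE ?divr_gt0 ?mulr_gt0// ?mulrBr//.
by rewrite lt_neqAle eq_sym y0 cell_mass_ge0.
Qed.

Lemma grid_entropy_type_cost (e : R) : 0 < e -> exists2 c1 : R, 0 < c1 &
  forall c (c0 : 0 < c) (th : nat -> R) (thS : forall k, th k \in `[0, 2 * pi[),
    c < c1 ->
    grid_entropy T (@cell_mass _ _ (slit_measure T c0 thS) n) <=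
    c * (type_cost (@slit_slab c) (slit_word c th) + (slit_number T c)%:R * ln M) + e.
Proof.
move=> e0.
have M2 : 0 < M * M + M by rewrite addr_gt0// mulr_gt0.
have T1 : 0 < T + 1 by rewrite addr_gt0.
(* [M * M] cells and [M] slabs are compared, so the total error is [e / 2]. *)
have [d d0 hd] := xlnx_unif_continuous T1 (divr_gt0 e0 (mulr_gt0 (ltr0n R 2) M2)).
have lnM0 : 0 <= ln M by rewrite ln_ge0.
(* The second bound keeps the scaled counts in [[0, T + 1]], where the modulus [d] is valid. *)
pose c1 := Num.min (d / (2 * M)) (1 / (2 * M)).
exists c1; first by rewrite !lt_min !divr_gt0 ?mulr_gt0.
move=> c c0 th thS; rewrite lt_min => /andP[cd c12].
have cMd : 2 * c * M <= d.
  by move/ltW: cd; rewrite ler_pdivlMr ?mulr_gt0// mulrA [c * 2]mulrC.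
have cM1 : 2 * c * M <= 1.
  by move/ltW: c12; rewrite ler_pdivlMr ?mulr_gt0// mulrA [c * 2]mulrC.
have c2M : 2 * c <= 2 * c * M by rewrite ler_peMr// mulr_ge0// ltW.
set r := slit_measure T c0 thS; set u := slit_word c th.
pose nn q : R := c * (letter_count (@slit_slab c) u q)%:R.
pose NN x : R := c * (class_count (@slit_slab c) x)%:R.
have nnE q : `|cell_mass r q - nn q| <= 2 * c by exact: cell_mass_letter_count.
have NNE x : `|T / M - NN x| <= 2 * c * M by exact: class_count_dist.
have nn0 q : 0 <= nn q by rewrite mulr_ge0// ltW.
have NN0 x : 0 <= NN x by rewrite mulr_ge0// ltW.
have TM : T / M <= T by rewrite ler_pdivrMr// ler_peMr// ltW.
have TM0 : 0 <= T / M by rewrite divr_ge0// ltW.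
have A q : xlnx (cell_mass r q) - xlnx (nn q) <= e / (2 * (M * M + M)).
  apply: le_trans (ler_norm _) _; apply: hd.
  - by rewrite cell_mass_ge0 (le_trans (cell_mass_le T_gt0 _ _))// lerDl.
  - have := cell_mass_le T_gt0 r q; have := nnE q; rewrite ler_norml => /andP[h1 h2] h3.
    rewrite nn0/=; lra.
  - by rewrite (le_trans (nnE q))// (le_trans c2M).
have B x : xlnx (NN x) - xlnx (T / M) <= e / (2 * (M * M + M)).
  apply: le_trans (ler_norm _) _; apply: hd.
  - have := NNE x; rewrite ler_norml => /andP[h1 h2].
    rewrite NN0/=; lra.
  - by rewrite TM0 (le_trans TM)// lerDl.
  - by rewrite distrC (le_trans (NNE x)).
rewrite grid_entropy_xlnx mulrDr type_cost_xlnx//.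
have SA : \sum_(q : grid) xlnx (cell_mass r q) - \sum_q xlnx (nn q) <= M * M * (e / (2 * (M * M + M))).
  rewrite -sumrB; apply: (@le_trans _ _ (\sum_(q : grid) e / (2 * (M * M + M)))).
    by apply: ler_sum => q _; exact: A.
  by rewrite sumr_const card_prod card_ord -[leLHS]mulr_natl natrM !natrX.
have SB : \sum_x xlnx (NN x) - \sum_(x < 2 ^ n) xlnx (T / M) <= M * (e / (2 * (M * M + M))).
  rewrite -sumrB; apply: (@le_trans _ _ (\sum_(x < 2 ^ n) e / (2 * (M * M + M)))).
    by apply: ler_sum => x _; exact: B.
  by rewrite sumr_const card_ord -[leLHS]mulr_natl natrX.
have SC : T - c * (slit_number T c)%:R <= 0.
  by rewrite subr_le0 mulrC ltW// slit_number_gt.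
have SC' : T * ln M <= c * ((slit_number T c)%:R * ln M).
  by rewrite mulrA ler_wpM2r// -subr_le0.
have half : M * M * (e / (2 * (M * M + M))) + M * (e / (2 * (M * M + M))) = e / 2.
  by rewrite -mulrDl; field; rewrite gt_eqF.
rewrite -/(nn _) -/(NN _); lra.
Qed.

End word_estimates.

(** * The large deviation bounds *)

Lemma cell_mass_coarse_dist (R : realType) (T : R) (r r' : driving_measure T) m n
    (q : 'I_(2 ^ m) * 'I_(2 ^ m)) : 0 < T -> (m <= n)%N ->
  `|cell_mass r q - cell_mass r' q| <=
  \sum_(q' : 'I_(2 ^ n) * 'I_(2 ^ n)) `|cell_mass r q' - cell_mass r' q'|.
Proof.
move=> T0 mn; rewrite -(subnK mn).
have cE (s : driving_measure T) := @sum_coarsen R (fun n => 'I_(2 ^ n) * 'I_(2 ^ n))%type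
  (@cell_parent) (fun n q => cell_mass s q) (fun n q => cell_mass_parent T0 s q) (n - m) m q.
rewrite /= in cE; rewrite (cE r) (cE r') -sumrB.
apply: (le_trans (ler_norm_sum _ _ _)).
rewrite [leRHS](bigID (fun j => coarsen (@cell_parent) j == q))/= lerDl.
exact: sumr_ge0.
Qed.

Section slit_probabilities.
Context {R : realType} d {Omega : measurableType d} (P : probability Omega R).
Variable theta : nat -> {RV P >-> R}.
Hypothesis theta_angle : forall w k, theta k w \in `[0, 2 * pi[.
Hypothesis theta_unif : forall k, uniform_angle (theta k).
Hypothesis theta_ind : mutually_independent theta.
Variable T : R.
Hypothesis T_gt0 : 0 < T.

Let slits c (c0 : 0 < c) w := slit_measure T c0 (theta_angle w).

Lemma slit_number_ub (c : R) : 0 < c -> (slit_number T c)%:R * c <= T + c.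
Proof.
move=> c0; have := slit_number_le T_gt0 c0.
by rewrite /slit_number/= -natr1 mulrDl mul1r lerD2r.
Qed.

(** [ln K.+1] is at most [2 * sqrt K.+1], and [c * sqrt K.+1] is at most the root of [c * (T + 2)],
    which vanishes with [c]. *)
Lemma poly_le_exp (m : nat) (e : R) : 0 < e -> exists2 c1 : R, 0 < c1 &
  forall c, 0 < c -> c < c1 ->
    (slit_number T c).+1%:R ^+ m <= expR (e / c).
Proof.
move=> e0.
have m0 : 0 < m.+1%:R :> R by rewrite ltr0n.
have T2 : 0 < T + 2 by rewrite addr_gt0.
pose c1 := Num.min 1 ((e / (2 * m.+1%:R)) ^+ 2 / (T + 2)).
exists c1; first by rewrite lt_min ltr01 divr_gt0// exprn_gt0// divr_gt0// mulr_gt0.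
move=> c c0; rewrite lt_min => /andP[cle1 cs].
set K := slit_number T c.
have K1 : 0 < K.+1%:R :> R by rewrite ltr0n.
rewrite -[K.+1%:R]lnK ?posrE// -expRM_natl ler_expR ler_pdivlMr//.
have lnK : ln K.+1%:R <= 2 * Num.sqrt K.+1%:R :> R.
  have s0 : 0 < Num.sqrt K.+1%:R :> R by rewrite sqrtr_gt0.
  rewrite -{1}(sqr_sqrtr (ltW K1)) lnXn// mulr_natl.
  by rewrite lerMn2r/= ltW// ln_sublinear.
have Kc : K.+1%:R * c <= T + 2.
  have := slit_number_ub c0; rewrite -/K -natr1 mulrDl mul1r => h; lra.
have sq : c * Num.sqrt K.+1%:R <= e / (2 * m.+1%:R).
  rewrite -[X in X * _](ger0_norm (ltW c0)) -sqrtr_sqr -sqrtrM ?sqr_ge0//.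
  rewrite -[leRHS]ger0_norm; last by rewrite divr_ge0// ?mulr_ge0// ltW.
  rewrite -sqrtr_sqr ler_wsqrtr//.
  rewrite expr2 -mulrA [c * K.+1%:R]mulrC.
  apply: (@le_trans _ _ (c * (T + 2))); first by rewrite ler_wpM2l// ltW.
  by rewrite -ler_pdivlMr// ltW.
apply: (@le_trans _ _ (m.+1%:R * (2 * (c * Num.sqrt K.+1%:R)))).
  rewrite -mulrA; apply: ler_pM => //.
  - by rewrite mulr_ge0 ?(ltW c0)// ln_ge0// ler1n.
  - by rewrite ler_nat.
  - by rewrite mulrC mulrCA ler_wpM2l// ltW.
apply: (@le_trans _ _ (m.+1%:R * (2 * (e / (2 * m.+1%:R))))).
  by rewrite ler_wpM2l// ler_wpM2l.
by rewrite le_eqVlt; apply/orP; left; apply/eqP; field; rewrite gt_eqF.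
Qed.

Lemma slit_upper (C : set (driving_measure T)) (a a' : R) : closed C ->
  (a%:E < ereal_inf (@driving_entropy R T @` C))%E -> a' < a ->
  exists2 c1 : R, 0 < c1 & forall c (c0 : 0 < c), c < c1 ->
    (P [set w | C (slits c0 w)] <= (expR (- (a' / c)))%:E)%E.
Proof.
move=> cC aC a'a; have [n hn] := closed_grid_entropy T_gt0 cC aC.
(* One [e] pays for passing from cell masses to types, the other for the number of types:
   [a - 2 * e = a']. *)
pose e := (a - a') / 2.
have e0 : 0 < e by rewrite divr_gt0// subr_gt0.
have [c1 c1_gt0 h1] := grid_entropy_type_cost n T_gt0 e0.
have [c2 c2_gt0 h2] := poly_le_exp (2 ^ n * 2 ^ n) e0.
exists (Num.min c1 c2); first by rewrite lt_min c1_gt0.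
move=> c c0; rewrite lt_min => /andP[cc1 cc2].
set K := slit_number T c.
have M0 : 0 < 2 ^+ n :> R by rewrite exprn_gt0.
(* Solved from [a < c * (type_cost + K * ln (2 ^+ n)) + e]. The subtracted term cancels the
   probability of a single word. *)
pose B := (a - e) / c - K%:R * ln (2 ^+ n).
pose S : {set {ffun 'I_K -> 'I_(2 ^ n)}} :=
  [set u : {ffun 'I_K -> 'I_(2 ^ n)} | B <= type_cost (@slit_slab _ T n c) u]%SET.
apply: (@le_trans _ _ (P [set w | word theta n K w \in S])).
  apply: le_measure; rewrite ?inE.
  - exact: measurable_slit_closed.
  - exact: measurable_word_set.
  - move=> w /= Cw; rewrite inE.
    have := h1 c c0 _ (theta_angle w) cc1; have := hn _ Cw; rewrite -/K => h3 h4.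
    have h5 := lt_le_trans h3 h4.
    rewrite /B lerBlDr ler_pdivrMr// mulrC; apply/ltW.
    by rewrite ltrBlDr.
rewrite word_set_prob// lee_fin.
have cardS : #|S|%:R <= K.+1%:R ^+ (2 ^ n * 2 ^ n) * expR (- B).
  have := @card_words_le R _ _ K (@slit_slab _ T n c) S B.
  by rewrite !card_ord; apply => u; rewrite inE.
have MK : expR (- B) * (2 ^+ n)^-1 ^+ K = expR (- ((a - e) / c)).
  rewrite /B opprB addrC expRD -mulrA expRM_natl lnK ?posrE//.
  by rewrite exprVn mulfV ?mulr1// gt_eqF// exprn_gt0.
apply: (@le_trans _ _ (K.+1%:R ^+ (2 ^ n * 2 ^ n) * expR (- B) * (2 ^+ n)^-1 ^+ K)).
  by rewrite ler_wpM2r// exprn_ge0// invr_ge0 ltW.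
rewrite -mulrA MK.
apply: (@le_trans _ _ (expR (e / c) * expR (- ((a - e) / c)))).
  by rewrite ler_wpM2r ?expR_ge0// h2.
rewrite -expRD ler_expR le_eqVlt; apply/orP; left; apply/eqP.
by rewrite /e; field; rewrite gt_eqF.
Qed.

Lemma slit_lower (O : set (driving_measure T)) (rho : driving_measure T) (h e : R) :
  open O -> O rho -> (driving_entropy rho <= h%:E)%E -> 0 < e ->
  exists2 c1 : R, 0 < c1 & forall c (c0 : 0 < c), c < c1 ->
    ((expR (- ((h + e) / c)))%:E <= P [set w | O (slits c0 w)])%E.
Proof.
move=> oO Orho Hrho e0.
have [n hn] := cell_ball_nbhs T_gt0 (open_nbhs_nbhs (conj oO Orho)).
have hnrho := driving_entropy_grid T_gt0 n Hrho.
pose M : R := 2 ^+ n.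
have M0 : 0 < M by rewrite exprn_gt0.
have M1 : 1 <= M by rewrite exprn_ege1// ler1n.
(* The conditional law under [rho] of the angular cell, given the time slab. *)
pose p (q : 'I_(2 ^ n) * 'I_(2 ^ n)) : R := cell_mass rho q / (T / M).
have TM0 : 0 < T / M by rewrite divr_gt0.
have p0 q : 0 <= p q by rewrite divr_ge0 ?cell_mass_ge0// ltW.
have psum x : \sum_i p (i, x) = 1.
  by rewrite -mulr_suml sum_cell_mass_time// divff// gt_eqF.
have p1 q : p q <= 1.
  by rewrite -(psum q.2) (bigD1 q.1)//= -surjective_pairing lerDl sumr_ge0.
pose Lg : R := \sum_q `|ln (M * p q)|.
have Lg0 : 0 <= Lg by exact: sumr_ge0.
have n1 : 0 < n.+1%:R :> R by rewrite ltr0n.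
(* The tolerance on each cell mass: the first bound limits its effect on the exponent to [e / 4],
   the second its sum over the cells to a quarter of the radius of the ball. *)
pose eta : R := Num.min (e / (4 * (Lg + 1))) ((4 * M * M * n.+1%:R)^-1).
have Lg1 : 0 < Lg + 1 by rewrite ltr_wpDl.
have eta0 : 0 < eta by rewrite lt_min divr_gt0 ?mulr_gt0//= invr_gt0 !mulr_gt0.
have etaL : eta * Lg <= e / 4.
  apply: (@le_trans _ _ (e / (4 * (Lg + 1)) * (Lg + 1))).
    by apply: ler_pM => //; rewrite ?(ltW eta0) ?ge_min ?lexx// lerDl.
  by rewrite le_eqVlt; apply/orP; left; apply/eqP; field; rewrite gt_eqF.
(* In order: the number of slits, Chebyshev's condition, the class counts in the exponent, the
   factor 1/2, and the rounding errors of the cell masses. *)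
pose c1 : R := Num.min (Num.min 1 (eta ^+ 2 / (2 * M * M * (T + 1))))
  (Num.min (Num.min (e / (8 * M * (Lg + 1))) (e / (2 * ln 2)))
    ((16 * M * M * M * n.+1%:R)^-1)).
have T1 : 0 < T + 1 by rewrite addr_gt0.
have ln2 : 0 < ln 2 :> R by rewrite ln_gt0// ltr1n.
exists c1.
  rewrite !lt_min ltr01 !divr_gt0 ?exprn_gt0 ?mulr_gt0//=.
  by rewrite invr_gt0 !mulr_gt0.
move=> c c0; rewrite !lt_min => /andP[/andP[cl1 cl2] /andP[/andP[cl3 cl4] cl5]].
set K := slit_number T c.
pose j : 'I_K -> 'I_(2 ^ n) := @slit_slab _ T n c.
pose s := eta / c.
have s0 : 0 < s by rewrite divr_gt0.
have small : (#|'I_(2 ^ n)| * #|'I_(2 ^ n)|)%:R * (K%:R / s ^+ 2) <= 2^-1 :> R.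
  rewrite !card_ord natrM !natrX -/M.
  have -> : M * M * (K%:R / s ^+ 2) = M * M * (K%:R * c) * c / eta ^+ 2.
    by rewrite /s; field; rewrite !gt_eqF.
  rewrite ler_pdivrMr ?exprn_gt0//.
  apply: (@le_trans _ _ (M * M * (T + 1) * c)).
    rewrite ler_wpM2r ?(ltW c0)// ler_wpM2l ?mulr_ge0 ?(ltW M0)//.
    by rewrite (le_trans (slit_number_ub c0))// lerD2l ltW.
  move/ltW: cl2; rewrite ler_pdivlMr ?mulr_gt0// => cl2; lra.
have card0 : (0 < #|'I_(2 ^ n)|)%N by rewrite card_ord expn_gt0.
have typ := card_typical j p0 psum card0 s0 small.
rewrite card_ord natrX -/M in typ.
apply: (@le_trans _ _ (P [set w | word theta n K w \in typical j p s])); last first.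
  apply: le_measure; rewrite ?inE.
  - exact: measurable_word_set.
  - exact: measurable_slit_open.
  - move=> w /=; rewrite inE => /forallP tw.
    apply: hn => m q mn; apply: le_lt_trans (cell_mass_coarse_dist _ _ q T_gt0 mn) _.
    have each (q' : 'I_(2 ^ n) * 'I_(2 ^ n)) : `|cell_mass (slits c0 w) q' - cell_mass rho q'| <= 2 * c + eta + 2 * c * M.
      have h1 := cell_mass_letter_count T_gt0 c0 (theta_angle w) q'.
      have h2 := class_count_dist T_gt0 q'.2 c0.
      have h3 := tw q'.
      have h4 : `|c * (letter_count j (slit_word T n c (fun k => theta k w)) q')%:R -
          c * (class_count j q'.2)%:R * p q'| <= eta.
        rewrite -mulrA -mulrBr normrM (gtr0_norm c0) mulrC -ler_pdivlMr//.
      have h5 : `|c * (class_count j q'.2)%:R * p q' - cell_mass rho q'| <= 2 * c * M.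
        have -> : cell_mass rho q' = T / M * p q' by rewrite /p mulrC divfK// gt_eqF.
        rewrite -mulrBl normrM (ger0_norm (p0 q')) distrC.
        by rewrite -[leRHS]mulr1; apply: ler_pM.
      apply: (le_trans (ler_distD (c * (letter_count j (slit_word T n c (fun k => theta k w)) q')%:R) _ _)).
      rewrite -addrA; apply: lerD => //.
      apply: (le_trans (ler_distD (c * (class_count j q'.2)%:R * p q') _ _)).
      exact: lerD.
    apply: (@le_lt_trans _ _ (\sum_(q' : 'I_(2 ^ n) * 'I_(2 ^ n)) (2 * c + eta + 2 * c * M))).
      by apply: ler_sum.
    rewrite sumr_const card_prod card_ord -[ltLHS]mulr_natl natrM !natrX -/M.
    have u1 : M * M * eta <= (4 * n.+1%:R)^-1.
      have : eta <= (4 * M * M * n.+1%:R)^-1 by rewrite ge_min lexx orbT.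
      move=> /(ler_wpM2l (mulr_ge0 (ltW M0) (ltW M0))) /le_trans; apply.
      by rewrite le_eqVlt; apply/orP; left; apply/eqP; field; rewrite !gt_eqF.
    have u2 : M * M * (4 * c * M) < (4 * n.+1%:R)^-1.
      have k0 : 0 < M * M * (4 * M) by rewrite !mulr_gt0.
      have := cl5; rewrite -(ltr_pM2l k0).
      have -> : M * M * (4 * M) * (16 * M * M * M * n.+1%:R)^-1 = (4 * n.+1%:R)^-1.
        by field; rewrite !gt_eqF.
      by rewrite (_ : M * M * (4 * M) * c = M * M * (4 * c * M)); last by ring.
    have u3 : M * M * (2 * c) <= M * M * (2 * c * M).
      by rewrite ler_wpM2l ?mulr_ge0 ?(ltW M0)// ler_peMr// mulr_ge0// ltW.
    have u4 : (4 * n.+1%:R)^-1 + (4 * n.+1%:R)^-1 < n.+1%:R^-1 :> R.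
      have -> : (4 * n.+1%:R)^-1 + (4 * n.+1%:R)^-1 = 2^-1 * n.+1%:R^-1 :> R.
        by field; rewrite gt_eqF.
      by rewrite gtr_pMl ?invr_gt0// invf_lt1// ltr1n.
    apply: le_lt_trans u4.
    apply: (@le_trans _ _ (M * M * eta + M * M * (4 * c * M))); last by rewrite lerD// ltW.
    rewrite -subr_ge0 in u3; rewrite -subr_ge0.
    by rewrite [leRHS](_ : _ = M * M * (2 * c * M) - M * M * (2 * c)) //; ring.
rewrite word_set_prob// lee_fin -/M; apply: le_trans typ.
(* The probability 1/2 joins the exponent. After multiplication by [c] the excess over [h] is at
   most [e / 4] for the tolerance, [e / 4] for the class counts and [e / 2] for [c * ln 2]. *)
have two : 2^-1 = expR (- ln 2) :> R by rewrite expRN lnK// posrE.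
rewrite two -expRD ler_expR -opprD lerN2 ler_pdivlMr//.
set A1 := \sum_q _.
have A1E : c * A1 <= h + 2 * c * M * Lg.
  apply: le_trans (lerD hnrho (lexx _)).
  rewrite /grid_entropy mulr_sumr /Lg mulr_sumr -big_split/=; apply: ler_sum => q _.
  have -> : cell_mass rho q / (T / (2 ^+ n * 2 ^+ n)) = M * p q.
    by rewrite /p /M; field; rewrite !gt_eqF.
  have -> : cell_mass rho q = T / M * p q by rewrite /p mulrC divfK// gt_eqF.
  rewrite -lerBlDl -[X in _ - X]mulrA [X in X - _]mulrA -mulrBl.
  apply: le_trans (ler_norm _) _; rewrite normrM distrC.
  apply: ler_pM => //; first exact: (class_count_dist T_gt0 q.2 c0).
  by rewrite normrM (ger0_norm (p0 q)) -[leRHS]mul1r ler_wpM2r.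
have v1 : 2 * c * M * Lg <= e / 4.
  apply: (@le_trans _ _ (c * (8 * M * (Lg + 1)) / 4)).
    rewrite -subr_ge0.
    have -> : c * (8 * M * (Lg + 1)) / 4 - 2 * c * M * Lg = 2 * c * M by field.
    by rewrite !mulr_ge0// ltW.
  by rewrite ler_wpM2r// -ler_pdivlMr ?mulr_gt0// ltW.
have v2 : c * ln 2 <= e / 2.
  move/ltW: cl4; rewrite ler_pdivlMr ?mulr_gt0// => cl4; lra.
have v3 : s * c = eta by rewrite /s divfK// gt_eqF.
rewrite -/Lg.
have -> : (A1 + s * Lg + ln 2) * c = c * A1 + eta * Lg + c * ln 2.
  by rewrite -v3; ring.
lra.
Qed.

End slit_probabilities.

Lemma limf_esup_le (R : realType) (f : R -> \bar R) (F : set_system R)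
    {FF : Filter F} (y : \bar R) :
  (\forall x \near F, (f x <= y)%E) -> (limf_esup f F <= y)%E.
Proof.
move=> fy; rewrite limf_esupE; apply: ge_ereal_inf.
exists (ereal_sup (f @` [set x | (f x <= y)%E])); first by exists [set x | (f x <= y)%E].
by apply: ge_ereal_sup => _ [x /= fx <-].
Qed.

Lemma limf_einf_ge (R : realType) (f : R -> \bar R) (F : set_system R)
    {FF : Filter F} (y : \bar R) :
  (\forall x \near F, (y <= f x)%E) -> (y <= limf_einf f F)%E.
Proof.
move=> fy; rewrite /limf_einf leeNr; apply: limf_esup_le.
by apply: filterS fy => x; rewrite leeN2.
Qed.

(** * The capacity increment compared with [eps ^+ 2 / 4] *)

Section capacity.
Context {R : realType}.
Implicit Type eps : R.

Lemma capacity_le eps : 0 < eps -> capacity eps <= eps ^+ 2 / 4.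
Proof.
move=> e0; rewrite /capacity e0; apply: (@le_trans _ _ (eps ^+ 2 / (4 * (1 + eps)))).
  by apply: le_ln1Dx; rewrite (lt_le_trans (ltrN10 _))// divr_ge0 ?sqr_ge0// mulr_ge0// addr_ge0// ltW.
rewrite ler_wpM2l ?sqr_ge0// lef_pV2 ?posrE ?mulr_gt0 ?addr_gt0//.
by rewrite ler_peMr// lerDl ltW.
Qed.

(** The exponential of the capacity is [(2 + eps)^2 / (4 (1 + eps))]. Applying [ln (1 + x) <= x] to
    its inverse bounds the capacity below by [(eps / (2 + eps))^2]. *)
Lemma capacity_ge eps : 0 < eps -> eps ^+ 2 / 4 <= (1 + eps / 2) ^+ 2 * capacity eps.
Proof.
move=> e0; have e1 : 0 < 1 + eps by rewrite addr_gt0.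
have e2 : 0 < 2 + eps by rewrite addr_gt0.
have u0 : 0 < 1 + eps ^+ 2 / (4 * (1 + eps)).
  by rewrite -expR_capacity// expR_gt0.
have h : eps ^+ 2 / (2 + eps) ^+ 2 <= capacity eps.
  rewrite -[leRHS]opprK lerNr /capacity e0 -lnV ?posrE//.
  have -> : (1 + eps ^+ 2 / (4 * (1 + eps)))^-1 = 1 + - (eps ^+ 2 / (2 + eps) ^+ 2).
    have e3 : 0 < 4 * (1 + eps) + eps ^+ 2 by rewrite addr_gt0 ?mulr_gt0 ?exprn_gt0.
    by field; rewrite !gt_eqF.
  apply: le_ln1Dx; rewrite ltrN2 ltr_pdivrMr ?exprn_gt0// mul1r ltrXn2r// ?(ltW e0)//.
  by rewrite ltrDr.
have := ler_wpM2l (sqr_ge0 (1 + eps / 2)) h; apply: le_trans.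
by rewrite le_eqVlt; apply/orP; left; apply/eqP; field; rewrite gt_eqF.
Qed.

Lemma near_capacity_lt (c1 : R) : 0 < c1 -> \forall eps \near 0^'+, capacity eps < c1.
Proof.
move=> c1_gt0; near=> eps.
have e0 : 0 < eps by near: eps; exact: nbhs_right_gt.
apply: (le_lt_trans (capacity_le e0)).
have e1 : eps < 1 by near: eps; exact: nbhs_right_lt.
have e2 : eps < c1 by near: eps; exact: nbhs_right_lt.
have : eps ^+ 2 <= eps by rewrite expr2 ler_piMl// ltW.
lra.
Unshelve. all: by end_near. Qed.

End capacity.

Section ldp.
Context {R : realType} d {Omega : measurableType d} (P : probability Omega R).
Variable theta : nat -> {RV P >-> R}.
Hypothesis theta_angle : forall w k, theta k w \in `[0, 2 * pi[.
Hypothesis theta_unif : forall k, uniform_angle (theta k).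
Hypothesis theta_ind : mutually_independent theta.
Variable T : R.
Hypothesis T_gt0 : 0 < T.

Let Y eps w := HL0_measure T (theta_angle w) eps.

Let log_prob (S : set (driving_measure T)) eps :=
  (((4 / eps ^+ 2)^-1)%:E * lne (P [set w | S (Y eps w)]))%E.

Lemma HL0_upper (C : set (driving_measure T)) (a a' : R) : closed C ->
  (a%:E < ereal_inf (@driving_entropy R T @` C))%E -> a' < a ->
  (limf_esup (log_prob C) 0^'+ <= (- a')%:E)%E.
Proof.
move=> cC aC a'a; apply: limf_esup_le.
(* [capacity_le] has the right direction only for [a' >= 0]; for negative [a'] it is enough that
   probabilities are at most 1. *)
have [a'0|a'0] := ltP a' 0.
  near=> eps; apply: (@le_trans _ _ 0%E); last by rewrite lee_fin oppr_ge0 ltW.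
  apply: mule_ge0_le0; first by rewrite lee_fin invr_ge0 divr_ge0 ?sqr_ge0.
  by rewrite lne_le0 probability_le1//; exact: measurable_slit_closed.
have [c1 c1_gt0 hc] := slit_upper theta_angle theta_unif theta_ind T_gt0 cC aC a'a.
near=> eps.
have e0 : 0 < eps by near: eps; exact: nbhs_right_gt.
have cc1 : capacity eps < c1 by near: eps; exact: near_capacity_lt.
have c0 := capacity_gt0 eps.
have PC := hc _ (capacity_gt0 eps) cc1.
apply: (@le_trans _ _ (((4 / eps ^+ 2)^-1)%:E * (- (a' / capacity eps))%:E)%E).
  apply: lee_wpmul2l; first by rewrite lee_fin invr_ge0 divr_ge0 ?sqr_ge0.
  rewrite -[leRHS](_ : lne (expR (- (a' / capacity eps)))%:E = _); last first.
    by rewrite lne_EFin ?expR_gt0// expRK.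
  by rewrite lee_lne ?in_itv/= ?leey ?andbT ?lee_fin ?expR_ge0 ?measure_ge0.
rewrite -EFinM lee_fin mulrN lerN2 invf_div mulrA ler_pdivlMr// mulrC.
by rewrite ler_wpM2r// capacity_le.
Unshelve. all: by end_near. Qed.

Lemma HL0_lower (O : set (driving_measure T)) (rho : driving_measure T) (h e : R) :
  open O -> O rho -> (driving_entropy rho <= h%:E)%E -> 0 < e -> 0 <= h ->
  ((- (h + e))%:E <= limf_einf (log_prob O) 0^'+)%E.
Proof.
move=> oO Orho hrho e0 h0; apply: limf_einf_ge.
have e2 : 0 < e / 2 by rewrite divr_gt0.
have d0 : 0 < h + e / 2 by rewrite ltr_wpDl.
have [c1 c1_gt0 hc] := slit_lower theta_angle theta_unif theta_ind T_gt0 oO Orho hrho e2.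
near=> eps.
have eps0 : 0 < eps by near: eps; exact: nbhs_right_gt.
have cc1 : capacity eps < c1 by near: eps; exact: near_capacity_lt.
have c0 := capacity_gt0 eps.
have PO := hc _ (capacity_gt0 eps) cc1.
apply: (@le_trans _ _ (((4 / eps ^+ 2)^-1)%:E * (- ((h + e / 2) / capacity eps))%:E)%E); last first.
  apply: lee_wpmul2l; first by rewrite lee_fin invr_ge0 divr_ge0 ?sqr_ge0.
  rewrite -[leLHS](_ : lne (expR (- ((h + e / 2) / capacity eps)))%:E = _); last first.
    by rewrite lne_EFin ?expR_gt0// expRK.
  by rewrite lee_lne ?in_itv/= ?leey ?andbT ?lee_fin ?expR_ge0 ?measure_ge0.
rewrite -EFinM lee_fin mulrN lerN2 invf_div mulrA ler_pdivrMr//.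
apply: (@le_trans _ _ ((1 + eps / 2) ^+ 2 * capacity eps * (h + e / 2))).
  by rewrite ler_wpM2r ?(ltW d0)// capacity_ge.
rewrite mulrAC ler_wpM2r ?(ltW c0)//.
have eps1 : eps < 1 by near: eps; exact: nbhs_right_lt.
(* Half of [e] went into [slit_lower]. The other half absorbs the factor [(1 + eps / 2)^2], which is
   at most [1 + 2 * eps]. *)
have epse : eps < e / 2 / (2 * (h + e / 2)).
  by near: eps; apply: nbhs_right_lt; rewrite divr_gt0// mulr_gt0.
have epse' : 2 * (h + e / 2) * eps < e / 2 by rewrite mulrC -ltr_pdivlMr// mulr_gt0.
apply: (@le_trans _ _ ((1 + 2 * eps) * (h + e / 2))); last lra.
rewrite ler_wpM2r ?(ltW d0)//.
have : eps ^+ 2 <= eps by rewrite expr2 ler_piMl// ltW.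
lra.
Unshelve. all: by end_near. Qed.

Lemma HL0_large_deviations :
  large_deviation_principle P Y (fun eps => 4 / eps ^+ 2) (@driving_entropy R T).
Proof.
split=> [C cC|O oO].
  case I : (ereal_inf _) => [r| |]; last by rewrite leey.
    apply/lee_addgt0Pr => e e0.
    rewrite -EFinN -EFinD (_ : - r + e = - (r - e)); last by ring.
    apply: (@HL0_upper _ (r - e / 2)) => //; last by lra.
    by rewrite I lte_fin gtrBl divr_gt0.
  (* The infimum is infinite, so the upper limit lies below every real number. *)
  rewrite leeNy_eq; apply/eqP/eq_ninfty => r; rewrite -[r]opprK.
  by apply: (@HL0_upper _ (- r + 1)) => //; rewrite ?I ?ltry// ltrDl.
rewrite leeNl; apply: le_ereal_inf_tmp => _ [rho Orho <-].
case H : (driving_entropy rho) => [h| |]; last 2 first.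
- by rewrite leey.
- by have := driving_entropy_ge0 T_gt0 rho; rewrite H.
apply/lee_addgt0Pr => e e0; rewrite leeNl -EFinD -EFinN.
apply: (HL0_lower oO Orho) => //; first by rewrite H.
by have := driving_entropy_ge0 T_gt0 rho; rewrite H lee_fin.
Qed.

End ldp.

Theorem theorem1p1 (R : realType) (T : R) (d : measure_display)
    (Omega : measurableType d) (P : probability Omega R)
    (theta : nat -> {RV P >-> R})
    (theta_angle : forall w k, theta k w \in `[0, 2 * pi[) :
  0 < T ->
  (forall k, uniform_angle (theta k)) ->
  mutually_independent theta ->
  [/\ convex_rate (@driving_entropy R T),
      good_rate (@driving_entropy R T) &
      large_deviation_principle P
        (fun eps w => HL0_measure T (theta_angle w) eps)
        (fun eps => 4 / eps ^+ 2)
        (@driving_entropy R T)].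
Proof.
move=> T_gt0 theta_unif theta_ind; split.
- exact: convex_driving_entropy.
- exact: good_driving_entropy.
- exact: HL0_large_deviations.
Qed.
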